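(* Let $\boldsymbol{M}$ be a weight sequence such that $\widetilde{\boldsymbol{M}}$ is a weight sequence and $(p!)_p\subset\widetilde{\boldsymbol{M}}$, and let $\boldsymbol{A}$ be a sequence satisfying $\operatorname{(nq)}$ and such that $\widehat{\boldsymbol{A}}$ is a weight sequence. Then the following are equivalent: (i) $\displaystyle\sum_{p=0}^\infty\frac{1}{\widetilde{m}_p^{1/2}}=\infty$, where $\widetilde m_p=\widetilde M_{p+1}/\widetilde M_p$. (ii) $\mathcal{B}\colon\mathcal{A}_{\{\widetilde{\boldsymbol{M}}\}}(\mathbb{H})\to\Lambda_{\{\widetilde{\boldsymbol{M}}\}}$ is injective. (iii) $\mathcal{M}\colon C_{\{\boldsymbol{M}\}}(0,\infty)\to\Lambda_{\{\widetilde{\boldsymbol{M}}\}}$ is injective. (iv) $\mathcal{M}\colon\mathcal{S}_{\{\boldsymbol{M}\}}(0,\infty)\to\Lambda_{\{\widetilde{\boldsymbol{M}}\}}$ is injective. (v) $\mathcal{M}\colon\mathcal{S}^{\{\widehat{\boldsymbol{A}}\}}_{\{\boldsymbol{M}\}}(0,\infty)\to\Lambda_{\{\widetilde{\boldsymbol{M}}\}}$ is injective.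
   Context: Sequences are of positive reals indexed by $\mathbb{N}_0$; quotients $m_p=M_{p+1}/M_p$. A sequence is a weight sequence if it is log-convex ($M_p^2\le M_{p-1}M_{p+1}$, $p\ge1$) and its quotients tend to $\infty$. For a weight sequence $\boldsymbol{M}$ with $M_0=1$, $\widetilde{\boldsymbol{M}}=(\widetilde M_p)_p$ with $\widetilde M_p=M_{p+1}\log(e^2m_{p+1}/m_p)$. $\operatorname{(nq)}$ for $\boldsymbol{A}$: $\sum_p1/((p+1)a_p)<\infty$, $a_p=A_{p+1}/A_p$. $\widehat{\boldsymbol{A}}=(p!A_p)_p$. $(p!)_p\subset\boldsymbol{N}$ means $p!\le Ch^pN_p$ for all $p$ and some $C,h>0$. $\mathbb{H}$ = open upper half-plane. For a sequence $\boldsymbol{N}$, $\mathcal{A}_{\{\boldsymbol{N}\}}(\mathbb{H})$ is the space of holomorphic $f$ on $\mathbb{H}$ with $\sup_p\sup_{z\in\mathbb{H}}|f^{(p)}(z)|/(h^pN_p)<\infty$ for some $h>0$; such $f$ and its derivatives extend continuously to $\overline{\mathbb{H}}$ and $f^{(p)}(0)$ is the value of the extension at $0$. $\Lambda_{\{\boldsymbol{N}\}}$ is the space of complex sequences with $\sup_p|c_p|/(h^pN_p)<\infty$ for some $h>0$. $\mathcal{B}(f)=(f^{(p)}(0))_p$. $C_{\{\boldsymbol{M}\}}(0,\infty)$: continuous $\varphi$ on $(0,\infty)$ with $\sup_p\sup_{x>0}x^p|\varphi(x)|/(h^pM_p)<\infty$ for some $h>0$. $\mathcal{S}_{\{\boldsymbol{M}\}}(0,\infty)$: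 $\varphi\in C^\infty(\mathbb{R})$ supported in $[0,\infty)$ such that for some $h>0$, $\sup_p\sup_x|x^p\varphi^{(q)}(x)|/(h^pM_p)<\infty$ for every $q$. $\mathcal{S}^{\{\widehat{\boldsymbol{A}}\}}_{\{\boldsymbol{M}\}}(0,\infty)$: $\varphi\in C^\infty(\mathbb{R})$ supported in $[0,\infty)$ with $\sup_{p,q}\sup_x|x^p\varphi^{(q)}(x)|/(h^{p+q}M_pq!A_q)<\infty$ for some $h>0$. $\mathcal{M}(\varphi)=(\int_0^\infty x^p\varphi(x)\,dx)_p$, which maps $C_{\{\boldsymbol{M}\}}(0,\infty)$ into $\Lambda_{\{\widetilde{\boldsymbol{M}}\}}$. *)

(* Defs.v *)
From Stdlib Require Import Reals.
From Coquelicot Require Import Coquelicot.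
Open Scope R_scope.

Definition quot (M : nat -> R) (p : nat) : R := M (S p) / M p.

Definition weight_seq (M : nat -> R) : Prop :=
  (forall p, 0 < M p) /\
  (forall p, (1 <= p)%nat -> M p ^ 2 <= M (p - 1)%nat * M (S p)) /\
  is_lim_seq (quot M) p_infty.

Definition Mtilde (M : nat -> R) (p : nat) : R :=
  M (S p) * ln (exp 2 * quot M (S p) / quot M p).

Definition nq (A : nat -> R) : Prop :=
  ex_series (fun p => / (INR (S p) * quot A p)).

Definition Ahat (A : nat -> R) (p : nat) : R := INR (Factorial.fact p) * A p.

Definition fact_incl (N : nat -> R) : Prop :=
  exists C h, 0 < C /\ 0 < h /\ forall p, INR (Factorial.fact p) <= C * h ^ p * N p.

Definition HH (z : C) : Prop := 0 < Im z.

(* F is the sequence of complex derivatives (F 0 = f, F (p+1) = (F p)')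
   on HH of a function f in A_{N}(HH):
   sup_p sup_{z in HH} |f^(p)(z)| / (h^p N_p) < oo for some h > 0. *)
Definition AH_derivs (N : nat -> R) (F : nat -> C -> C) : Prop :=
  (forall p z, HH z -> is_derive (K := C_AbsRing) (V := C_NormedModule)
                          (F p) z (F (S p) z)) /\
  exists h Cst, 0 < h /\ forall p z, HH z -> Cmod (F p z) <= Cst * h ^ p * N p.

(* the value at 0 of the continuous extension of g to the closure of HH *)
Definition ext_value_at0 (g : C -> C) (v : C) : Prop :=
  filterlim g (within HH (locally (RtoC 0))) (locally v).

Definition B_injective (N : nat -> R) : Prop :=
  forall (F G : nat -> C -> C) (b : nat -> C),
    AH_derivs N F -> AH_derivs N G ->
    (forall p, ext_value_at0 (F p) (b p)) ->
    (forall p, ext_value_at0 (G p) (b p)) ->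
    forall z, HH z -> F 0%nat z = G 0%nat z.

Definition in_CM (M : nat -> R) (phi : R -> C) : Prop :=
  (forall x, 0 < x -> continuous phi x) /\
  exists h Cst, 0 < h /\
    forall p x, 0 < x -> x ^ p * Cmod (phi x) <= Cst * h ^ p * M p.

Definition smooth_supp_pos (Phi : nat -> R -> C) : Prop :=
  (forall q x, is_derive (K := R_AbsRing) (V := C_R_NormedModule)
                 (Phi q) x (Phi (S q) x)) /\
  (forall x, x < 0 -> Phi 0%nat x = RtoC 0).

Definition in_SM (M : nat -> R) (phi : R -> C) : Prop :=
  exists Phi : nat -> R -> C, Phi 0%nat = phi /\ smooth_supp_pos Phi /\
  exists h, 0 < h /\ forall q, exists Cst,
    forall p x, Rabs x ^ p * Cmod (Phi q x) <= Cst * h ^ p * M p.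

Definition in_SMA (M A : nat -> R) (phi : R -> C) : Prop :=
  exists Phi : nat -> R -> C, Phi 0%nat = phi /\ smooth_supp_pos Phi /\
  exists h Cst, 0 < h /\ forall p q x,
    Rabs x ^ p * Cmod (Phi q x) <= Cst * h ^ (p + q) * M p * Ahat A q.

Definition is_moments (phi : R -> C) (m : nat -> C) : Prop :=
  forall p, is_RInt_gen (V := C_R_NormedModule)
              (fun x => (RtoC (x ^ p) * phi x)%C)
              (at_right 0) (Rbar_locally p_infty) (m p).

Definition moment_injective (S : (R -> C) -> Prop) : Prop :=
  forall (phi psi : R -> C) (m : nat -> C),
    S phi -> S psi -> is_moments phi m -> is_moments psi m ->
    forall x, 0 < x -> phi x = psi x.

(* Main.v *)
Require Import Defs.
From Stdlib Require Import Reals Lra Lia Classical.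
From Coquelicot Require Import Coquelicot.
Open Scope R_scope.

(** Write N for [Mtilde M] and n_p for its quotients.

    (i) => (ii).  Let f be flat at 0.  Replacing e^(ixz) by J_0(2 sqrt(s x)) turns the derivatives
    of f into V_p(s), the integral of e^(sv) v^-1 f^(p)(i/v) over the line Re v = 1, and in t = 2 sqrt s
    the Bessel operator sends V_p to a multiple of V_(p+1).  So t |-> V_0 behaves like a function whose
    2p-th derivative is O(h^p N_(p+1)), and Bang's argument gives V_0 = 0 when sum n_p^(-1/2) diverges.
    The Laplace transform in s of V_0 together with Cauchy's theorem for the reflected point yields
    vanishing Poisson integrals of v^-1 f(i/v) on Re v = 1, hence f = 0 on a circle tangent to the real
    axis at 0; dilations of f give the whole half-plane.

    (ii) => (iii).  The Laplace transform of phi lies in the class of N; if it vanishes, so do all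
    integrals of phi against x^n e^(-nx/a), which concentrate at a.

    (iii) => (iv) => (v) are inclusions.

    (v) => (i).  If sum n_p^(-1/2) < oo then sum c_k < oo with c_k = m_k^(-1/2).  The function
    prod (1 + c_k w)^-2 is holomorphic on Re w > 0 and O(M_p |w|^(-2p)), so by Cauchy's theorem its
    imaginary part on w = i sqrt x has vanishing Stieltjes moments.  Iterated averaging over intervals of
    lengths proportional to the inverse quotients of [Ahat A], summable by (nq), makes it smooth of
    class [Ahat A] while keeping the support, the decay and the vanishing moments. *)

(** * Complex-valued functions of a real variable *)

(** The exponent 1/2 in the criterion is what calls for a second-order operator: each derivative of
    f on the half-plane has to count as two real derivatives. The map z = i/v sends the line Re v =
    1 to the circle with diameter [0, i], so flatness at 0 becomes rapid decay in v and every
    integral converges absolutely. Bang's argument needs bounds with the true constants of the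
    class; integrating once from 0 buys one further power of 1/v at the price of one derivative,
    whence the index p + 1.

    In the converse direction, (i) concerns the quotients of [Mtilde M] while the density must decay
    as prescribed by M; the logarithmic factors are absorbed by a telescoping bound. Vanishing
    moments have to survive infinitely many averagings and a limit, which is why they are carried as
    quantitative bounds on truncated moments.

    All improper integrals are dominated by a multiple of 1/(1 + y^2) and all contours are vertical
    lines, so Cauchy's theorem reduces to comparing neighbouring lines. *)

Definition rder (g : R -> C) (t : R) (l : C) : Prop :=
  is_derive (fun x => Re (g x)) t (Re l) /\ is_derive (fun x => Im (g x)) t (Im l).

Definition ccont (g : R -> C) (t : R) : Prop :=
  continuous (fun x => Re (g x)) t /\ continuous (fun x => Im (g x)) t.

Lemma C_ext (z w : C) : Re z = Re w -> Im z = Im w -> z = w.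
Proof. destruct z, w; simpl; intros; subst; reflexivity. Qed.

Lemma Re_minus (z w : C) : Re (z - w)%C = Re z - Re w.
Proof. reflexivity. Qed.

Lemma Im_minus (z w : C) : Im (z - w)%C = Im z - Im w.
Proof. reflexivity. Qed.

Lemma Im_le_Cmod (z : C) : Rabs (Im z) <= Cmod z.
Proof. eapply Rle_trans; [apply Rmax_r | apply Rmax_Cmod]. Qed.

Lemma Cmod_le_ReIm (z : C) : Cmod z <= Rabs (Re z) + Rabs (Im z).
Proof.
  unfold Cmod. apply Rsqr_incr_0_var.
  - rewrite Rsqr_sqrt by nra.
    assert (H1 := pow2_abs (Re z)). assert (H2 := pow2_abs (Im z)).
    assert (0 <= Rabs (Re z)) by apply Rabs_pos. assert (0 <= Rabs (Im z)) by apply Rabs_pos.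
    unfold Re, Im in *. unfold Rsqr. nra.
  - assert (0 <= Rabs (Re z)) by apply Rabs_pos. assert (0 <= Rabs (Im z)) by apply Rabs_pos. lra.
Qed.

Lemma rder_eq (g : R -> C) (t : R) (l l' : C) : rder g t l -> l = l' -> rder g t l'.
Proof. intros H <-; exact H. Qed.

Lemma rder_ext f g t l : (forall x, f x = g x) -> rder f t l -> rder g t l.
Proof.
  intros H [H1 H2]; split; (eapply is_derive_ext; [| eassumption]); intros; simpl; now rewrite H.
Qed.

Lemma rder_const c t : rder (fun _ => c) t 0%C.
Proof. split; apply @is_derive_const. Qed.

Lemma rder_plus f g t l m : rder f t l -> rder g t m -> rder (fun x => (f x + g x)%C) t (l + m)%C.
Proof.
  intros [H1 H2] [H3 H4]; split; simpl.
  - apply (is_derive_plus (fun x => Re (f x)) (fun x => Re (g x))); auto.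
  - apply (is_derive_plus (fun x => Im (f x)) (fun x => Im (g x))); auto.
Qed.

Lemma is_derive_Rmult (f g : R -> R) (t l m : R) :
  is_derive f t l -> is_derive g t m -> is_derive (fun x => f x * g x) t (l * g t + f t * m).
Proof.
  intros. apply (is_derive_mult f g); auto. intros; apply Rmult_comm.
Qed.

Lemma is_derive_Rminus (f g : R -> R) (t l m : R) :
  is_derive f t l -> is_derive g t m -> is_derive (fun x => f x - g x) t (l - m).
Proof. intros. apply (is_derive_minus f g); auto. Qed.

Lemma is_derive_Rplus (f g : R -> R) (t l m : R) :
  is_derive f t l -> is_derive g t m -> is_derive (fun x => f x + g x) t (l + m).
Proof. intros. apply (is_derive_plus f g); auto. Qed.

Lemma is_derive_eq (f : R -> R) (t l l' : R) : is_derive f t l -> l = l' -> is_derive f t l'.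
Proof. intros H <-; exact H. Qed.

Lemma rder_mult f g t l m :
  rder f t l -> rder g t m -> rder (fun x => (f x * g x)%C) t (l * g t + f t * m)%C.
Proof.
  intros [H1 H2] [H3 H4]; split.
  - eapply is_derive_eq.
    + apply (is_derive_Rminus (fun x => Re (f x) * Re (g x)) (fun x => Im (f x) * Im (g x)));
      apply is_derive_Rmult; eassumption.
    + simpl; unfold Re, Im; ring.
  - eapply is_derive_eq.
    + apply (is_derive_Rplus (fun x => Re (f x) * Im (g x)) (fun x => Im (f x) * Re (g x)));
      apply is_derive_Rmult; eassumption.
    + simpl; unfold Re, Im; ring.
Qed.

Lemma rder_scal c g t l : rder g t l -> rder (fun x => (c * g x)%C) t (c * l)%C.
Proof.
  intros H. eapply rder_eq; [apply rder_mult; [apply rder_const | exact H] |]. simpl. ring.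
Qed.

Lemma rder_opp g t l : rder g t l -> rder (fun x => (- g x)%C) t (- l)%C.
Proof.
  intros H. apply rder_ext with (fun x => (- (1) * g x)%C). { intros; ring. }
  eapply rder_eq; [apply rder_scal, H | ring].
Qed.

Lemma rder_minus f g t l m : rder f t l -> rder g t m -> rder (fun x => (f x - g x)%C) t (l - m)%C.
Proof. intros. apply rder_plus; [assumption | now apply rder_opp]. Qed.

Lemma rder_RtoC (f : R -> R) (t l : R) : is_derive f t l -> rder (fun x => RtoC (f x)) t (RtoC l).
Proof. intros; split; simpl; [assumption | apply @is_derive_const]. Qed.

Lemma is_derive_Rinv (f : R -> R) (t l : R) :
  is_derive f t l -> f t <> 0 -> is_derive (fun x => / f x) t (- l / (f t) ^ 2).
Proof. intros. now apply is_derive_inv. Qed.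

Lemma Cnz_sq (z : C) : z <> 0%C -> 0 < Re z ^ 2 + Im z ^ 2.
Proof.
  intros H. rewrite <- Cmod2_alt. apply pow_lt. now apply Cmod_gt_0.
Qed.

Lemma rder_inv g t l :
  rder g t l -> g t <> 0%C -> rder (fun x => (/ g x)%C) t (- l * (/ g t) * (/ g t))%C.
Proof.
  intros [H1 H2] Hz. assert (Hs := Cnz_sq _ Hz).
  assert (Hd : is_derive (fun x => / (Re (g x) ^ 2 + Im (g x) ^ 2)) t
     (- (2 * Re (g t) * Re l + 2 * Im (g t) * Im l) / (Re (g t) ^ 2 + Im (g t) ^ 2) ^ 2)).
  { apply (is_derive_Rinv (fun x => Re (g x) ^ 2 + Im (g x) ^ 2)); [| lra].
    apply is_derive_ext with (fun x => Re (g x) * Re (g x) + Im (g x) * Im (g x)).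
    { intros; simpl; ring. }
    eapply is_derive_eq; [apply (is_derive_Rplus (fun x => Re (g x) * Re (g x))
      (fun x => Im (g x) * Im (g x))); apply is_derive_Rmult; eassumption |].
    simpl; unfold Re, Im; ring. }
  split.
  - apply is_derive_ext with (fun x => Re (g x) * / (Re (g x) ^ 2 + Im (g x) ^ 2)).
    { intros; reflexivity. }
    eapply is_derive_eq; [apply (is_derive_Rmult (fun x => Re (g x))); eassumption |].
    simpl. unfold Re, Im in *. field. simpl in Hs. lra.
  - apply is_derive_ext with (fun x => (-1 * Im (g x)) * / (Re (g x) ^ 2 + Im (g x) ^ 2)).
    { intros; simpl. unfold Re, Im, Rdiv. simpl. ring. }
    eapply is_derive_eq.
    { apply (is_derive_Rmult (fun x => -1 * Im (g x))); [apply (is_derive_Rmult (fun _ => -1) (fun x => Im (g x)));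
        [apply @is_derive_const | exact H2] | exact Hd]. }
    simpl. unfold Re, Im, zero in *. simpl in *. field. lra.
Qed.

Lemma rder_cont g t l : rder g t l -> ccont g t.
Proof.
  intros [H1 H2]; split; apply (ex_derive_continuous (V := R_NormedModule)); eexists; eassumption.
Qed.

Lemma ccont_ext f g t : (forall x, f x = g x) -> ccont f t -> ccont g t.
Proof.
  intros H [H1 H2]; split.
  - apply continuous_ext with (fun x => Re (f x)); [intros; now rewrite H | exact H1].
  - apply continuous_ext with (fun x => Im (f x)); [intros; now rewrite H | exact H2].
Qed.

Lemma ccont_const c t : ccont (fun _ => c) t.
Proof. split; apply continuous_const. Qed.

Lemma ccont_plus f g t : ccont f t -> ccont g t -> ccont (fun x => (f x + g x)%C) t.
Proof.
  intros [H1 H2] [H3 H4]; split; simpl.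
  - apply (continuous_plus (fun x => Re (f x)) (fun x => Re (g x))); auto.
  - apply (continuous_plus (fun x => Im (f x)) (fun x => Im (g x))); auto.
Qed.

Lemma ccont_mult f g t : ccont f t -> ccont g t -> ccont (fun x => (f x * g x)%C) t.
Proof.
  intros [H1 H2] [H3 H4]; split; simpl.
  - apply (continuous_minus (fun x => Re (f x) * Re (g x)) (fun x => Im (f x) * Im (g x)));
    [apply (continuous_mult (fun x => Re (f x)) (fun x => Re (g x)))
    |apply (continuous_mult (fun x => Im (f x)) (fun x => Im (g x)))]; auto.
  - apply (continuous_plus (fun x => Re (f x) * Im (g x)) (fun x => Im (f x) * Re (g x)));
    [apply (continuous_mult (fun x => Re (f x)) (fun x => Im (g x)))
    |apply (continuous_mult (fun x => Im (f x)) (fun x => Re (g x)))]; auto.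
Qed.

Lemma ccont_scal c g t : ccont g t -> ccont (fun x => (c * g x)%C) t.
Proof. intros. apply (ccont_mult (fun _ => c)); [apply ccont_const | assumption]. Qed.

Lemma ccont_minus f g t : ccont f t -> ccont g t -> ccont (fun x => (f x - g x)%C) t.
Proof.
  intros. apply ccont_ext with (fun x => (f x + - (1) * g x)%C). { intros; ring. }
  apply ccont_plus; [assumption | now apply ccont_scal].
Qed.

Definition cexp (z : C) : C := (exp (Re z) * cos (Im z), exp (Re z) * sin (Im z)).

Lemma cexp_plus z w : cexp (z + w)%C = (cexp z * cexp w)%C.
Proof.
  apply C_ext; simpl; unfold Re, Im; rewrite exp_plus, ?cos_plus, ?sin_plus; ring.
Qed.

Lemma cexp_RtoC (x : R) : cexp (RtoC x) = RtoC (exp x).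
Proof. apply C_ext; simpl; rewrite ?cos_0, ?sin_0; ring. Qed.

Lemma cexp_0 : cexp 0%C = 1%C.
Proof. rewrite cexp_RtoC, exp_0. reflexivity. Qed.

Lemma Cmod_cexp z : Cmod (cexp z) = exp (Re z).
Proof.
  unfold Cmod, cexp. simpl.
  replace (_ + _) with (Rsqr (exp (Re z))).
  - apply sqrt_Rsqr. left. apply exp_pos.
  - assert (H := sin2_cos2 (Im z)). unfold Rsqr in *. nra.
Qed.

Lemma rder_cexp g t l : rder g t l -> rder (fun x => cexp (g x)) t (l * cexp (g t))%C.
Proof.
  intros [H1 H2].
  assert (E : is_derive (fun x => exp (Re (g x))) t (Re l * exp (Re (g t)))).
  { apply (is_derive_comp exp (fun x => Re (g x))); [apply is_derive_exp | exact H1]. }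
  assert (Cc : is_derive (fun x => cos (Im (g x))) t (Im l * - sin (Im (g t)))).
  { apply (is_derive_comp cos (fun x => Im (g x))); [apply is_derive_cos | exact H2]. }
  assert (S : is_derive (fun x => sin (Im (g x))) t (Im l * cos (Im (g t)))).
  { apply (is_derive_comp sin (fun x => Im (g x))); [apply is_derive_sin | exact H2]. }
  split.
  - eapply is_derive_eq; [apply (is_derive_Rmult (fun x => exp (Re (g x))) (fun x => cos (Im (g x)))); eassumption |].
    simpl; unfold Re, Im; ring.
  - eapply is_derive_eq; [apply (is_derive_Rmult (fun x => exp (Re (g x))) (fun x => sin (Im (g x)))); eassumption |].
    simpl; unfold Re, Im; ring.
Qed.

Lemma is_derive_cont_pt (f : R -> R) (x l : R) : is_derive f x l -> continuity_pt f x.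
Proof.
  intros H. apply continuity_pt_filterlim.
  apply (ex_derive_continuous (V := R_NormedModule)). eexists; eassumption.
Qed.

(** Multiplication by the conjugate of the increment D reduces this to the real mean value theorem
    for Re (conj D * g), whose increment is |D|^2 and whose derivative is at most |D| B. *)
Lemma mvt_cplx (g dg : R -> C) (a b B : R) : a <= b ->
  (forall t, a <= t <= b -> rder g t (dg t)) ->
  (forall t, a <= t <= b -> Cmod (dg t) <= B) ->
  Cmod (g b - g a)%C <= B * (b - a).
Proof.
  intros Hab Hd HB.
  set (D := (g b - g a)%C).
  destruct (Req_dec (Cmod D) 0) as [H0 | H0].
  { rewrite H0. apply Rmult_le_pos; [| lra].
    eapply Rle_trans; [apply Cmod_ge_0 | apply (HB a); lra]. }
  assert (HD : 0 < Cmod D) by (destruct (Cmod_ge_0 D); congruence).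
  assert (HF : forall t, a <= t <= b ->
     is_derive (fun t => Re (Cconj D * g t)%C) t (Re (Cconj D * dg t)%C)).
  { intros t Ht. apply (rder_scal (Cconj D) g t (dg t)). now apply Hd. }
  destruct (MVT_gen (fun t => Re (Cconj D * g t)%C) a b (fun t => Re (Cconj D * dg t)%C))
    as [c [Hc1 Hc2]].
  - intros x Hx. rewrite Rmin_left, Rmax_right in Hx by lra. apply HF; lra.
  - intros x Hx. rewrite Rmin_left, Rmax_right in Hx by lra.
    eapply is_derive_cont_pt, HF; lra.
  - rewrite Rmin_left, Rmax_right in Hc1 by lra.
    assert (E : Re (Cconj D * g b)%C - Re (Cconj D * g a)%C = Cmod D * Cmod D).
    { rewrite <- Re_minus. replace (Cconj D * g b - Cconj D * g a)%C with (D * Cconj D)%C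
        by (unfold D; ring).
      rewrite <- Cmod2_conj. simpl. ring. }
    rewrite E in Hc2.
    assert (Re (Cconj D * dg c)%C <= Cmod D * B).
    { eapply Rle_trans; [apply Rle_abs |]. eapply Rle_trans; [apply re_le_Cmod |].
      rewrite Cmod_mult, Cmod_conj. apply Rmult_le_compat_l; [lra | now apply HB]. }
    apply Rmult_le_reg_l with (Cmod D); [exact HD |].
    rewrite Hc2, <- Rmult_assoc. apply Rmult_le_compat_r; lra.
Qed.

(* Complex differentiability in the form in which it is used: the chain rule along every curve. *)
Definition cder (f : C -> C) (z l : C) : Prop :=
  forall g t d, g t = z -> rder g t d -> rder (fun x => f (g x)) t (l * d)%C.

Lemma cder_const c z : cder (fun _ => c) z 0%C.
Proof. intros g t d _ _. eapply rder_eq; [apply rder_const | ring]. Qed.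

Lemma cder_id z : cder (fun z => z) z 1%C.
Proof. intros g t d _ H. eapply rder_eq; [exact H | ring]. Qed.

Lemma cder_eq f z l l' : cder f z l -> l = l' -> cder f z l'.
Proof. intros H <-; exact H. Qed.

Lemma cder_plus f g z l m : cder f z l -> cder g z m -> cder (fun x => (f x + g x)%C) z (l + m)%C.
Proof.
  intros Hf Hg h t d E Hh. eapply rder_eq; [apply rder_plus; [apply Hf | apply Hg]; eassumption | ring].
Qed.

Lemma cder_mult f g z l m :
  cder f z l -> cder g z m -> cder (fun x => (f x * g x)%C) z (l * g z + f z * m)%C.
Proof.
  intros Hf Hg h t d E Hh.
  eapply rder_eq; [apply rder_mult; [apply Hf | apply Hg]; eassumption |]. simpl; rewrite E. ring.
Qed.

Lemma cder_scal c g z l : cder g z l -> cder (fun x => (c * g x)%C) z (c * l)%C.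
Proof.
  intros H. eapply cder_eq; [apply cder_mult; [apply cder_const | exact H] |]. simpl. ring.
Qed.

Lemma cder_inv f z l : cder f z l -> f z <> 0%C -> cder (fun x => (/ f x)%C) z (- l * (/ f z) * (/ f z))%C.
Proof.
  intros Hf Hz h t d E Hh.
  eapply rder_eq; [apply rder_inv; [apply Hf; eassumption | now rewrite E] |]. simpl; rewrite E. ring.
Qed.

Lemma cder_comp f g z l m : cder f (g z) l -> cder g z m -> cder (fun x => f (g x)) z (l * m)%C.
Proof.
  intros Hf Hg h t d E Hh.
  eapply rder_eq; [apply (Hf (fun x => g (h x)) t (m * d)%C); [now rewrite E | now apply Hg] |]. ring.
Qed.

Lemma is_derive_eps (f : R -> R) (x l : R) :
  is_derive f x l <->
  forall e, 0 < e -> exists d, 0 < d /\ forall y, Rabs (y - x) < d ->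
    Rabs (f y - f x - (y - x) * l) <= e * Rabs (y - x).
Proof.
  split.
  - intros [_ H] e He. specialize (H x (fun P HP => HP) (mkposreal e He)).
    destruct H as [d Hd]. exists d. split; [apply cond_pos |]. intros y Hy. apply (Hd y Hy).
  - intros H. split; [apply is_linear_scal_l |].
    intros y Hy. apply (is_filter_lim_locally_unique x y) in Hy. subst y.
    intros e. destruct (H e (cond_pos e)) as [d [Hd H']]. exists (mkposreal d Hd).
    intros y Hy. apply (H' y Hy).
Qed.

Lemma is_Cderive_eps (f : C -> C) (x l : C) :
  is_derive (K := C_AbsRing) (V := C_NormedModule) f x l <->
  forall e, 0 < e -> exists d, 0 < d /\ forall y, Cmod (y - x) < d ->
    Cmod (f y - f x - (y - x) * l) <= e * Cmod (y - x).
Proof.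
  split.
  - intros [_ H] e He. specialize (H x (fun P HP => HP) (mkposreal e He)).
    destruct H as [d Hd]. exists d. split; [apply cond_pos |]. intros y Hy.
    apply (Hd y Hy).
  - intros H. split; [apply is_linear_scal_l |].
    intros y Hy. apply (is_filter_lim_locally_unique (K := C_AbsRing) (V := AbsRing_NormedModule C_AbsRing) x y) in Hy. subst y.
    intros e. destruct (H e (cond_pos e)) as [d [Hd H']].
    exists (mkposreal d Hd). intros y Hy. apply (H' y Hy).
Qed.

Lemma rder_eps (g : R -> C) (t : R) (l : C) :
  rder g t l <->
  forall e, 0 < e -> exists d, 0 < d /\ forall y, Rabs (y - t) < d ->
    Cmod (g y - g t - RtoC (y - t) * l) <= e * Rabs (y - t).
Proof.
  assert (ER : forall y, Re (g y - g t - RtoC (y - t) * l)%C = Re (g y) - Re (g t) - (y - t) * Re l)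
    by (intros; simpl; unfold Re, Im; ring).
  assert (EI : forall y, Im (g y - g t - RtoC (y - t) * l)%C = Im (g y) - Im (g t) - (y - t) * Im l)
    by (intros; simpl; unfold Re, Im; ring).
  split.
  - intros [H1 H2] e He.
    apply is_derive_eps with (e := e / 2) in H1; [| lra].
    apply is_derive_eps with (e := e / 2) in H2; [| lra].
    destruct H1 as [d1 [Hd1 H1]], H2 as [d2 [Hd2 H2]].
    exists (Rmin d1 d2). split; [now apply Rmin_pos |]. intros y Hy.
    eapply Rle_trans; [apply Cmod_le_ReIm |]. rewrite ER, EI.
    assert (Rabs (y - t) < d1) by (eapply Rlt_le_trans; [exact Hy | apply Rmin_l]).
    assert (Rabs (y - t) < d2) by (eapply Rlt_le_trans; [exact Hy | apply Rmin_r]).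
    specialize (H1 y H). specialize (H2 y H0). lra.
  - intros H. split; apply is_derive_eps; intros e He; destruct (H e He) as [d [Hd Hy]];
      exists d; (split; [exact Hd |]); intros y Hyt; specialize (Hy y Hyt).
    + rewrite <- ER. eapply Rle_trans; [apply re_le_Cmod | exact Hy].
    + rewrite <- EI. eapply Rle_trans; [apply Im_le_Cmod | exact Hy].
Qed.

Lemma rder_comp g (h : R -> R) (t : R) (l : C) (m : R) :
  rder g (h t) l -> is_derive h t m -> rder (fun x => g (h x)) t (RtoC m * l)%C.
Proof.
  intros [H1 H2] H. split.
  - eapply is_derive_eq; [apply (is_derive_comp (fun x => Re (g x)) h); eassumption |].
    simpl. unfold scal, Re, Im. simpl. unfold mult. simpl. ring.
  - eapply is_derive_eq; [apply (is_derive_comp (fun x => Im (g x)) h); eassumption |].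
    simpl. unfold scal, Re, Im. simpl. unfold mult. simpl. ring.
Qed.

Lemma cder_of_is_derive (f : C -> C) (z l : C) :
  is_derive (K := C_AbsRing) (V := C_NormedModule) f z l -> cder f z l.
Proof.
  intros H g t d E Hg. subst z.
  apply rder_eps. intros e He.
  set (A := Cmod l). set (D := Cmod d).
  assert (HA : 0 <= A) by apply Cmod_ge_0. assert (HD : 0 <= D) by apply Cmod_ge_0.
  set (e1 := Rmin 1 (e / (2 * (A + 1)))). set (e2 := e / (2 * (D + 1))).
  assert (He1 : 0 < e1) by (apply Rmin_pos; [lra | apply Rdiv_lt_0_compat; lra]).
  assert (He2 : 0 < e2) by (apply Rdiv_lt_0_compat; lra).
  apply rder_eps with (e := e1) in Hg; [| exact He1].
  apply is_Cderive_eps with (e := e2) in H; [| exact He2].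
  destruct Hg as [d1 [Hd1 Hg]], H as [d2 [Hd2 Hf]].
  exists (Rmin d1 (d2 / (D + 1))). split; [apply Rmin_pos; [lra | apply Rdiv_lt_0_compat; lra] |].
  intros y Hy.
  assert (Hy1 : Rabs (y - t) < d1) by (eapply Rlt_le_trans; [exact Hy | apply Rmin_l]).
  assert (Hy2 : Rabs (y - t) < d2 / (D + 1)) by (eapply Rlt_le_trans; [exact Hy | apply Rmin_r]).
  specialize (Hg y Hy1).
  assert (Hp : 0 <= Rabs (y - t)) by apply Rabs_pos.
  assert (HG : Cmod (g y - g t) <= (D + 1) * Rabs (y - t)).
  { replace (g y - g t)%C with ((g y - g t - RtoC (y - t) * d) + RtoC (y - t) * d)%C by ring.
    eapply Rle_trans; [apply Cmod_triangle |]. rewrite Cmod_mult, Cmod_R.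
    assert (e1 <= 1) by apply Rmin_l. fold D. nra. }
  assert (Hs : (D + 1) * Rabs (y - t) < d2).
  { replace d2 with ((D + 1) * (d2 / (D + 1))) by (field; lra). apply Rmult_lt_compat_l; lra. }
  assert (HF := Hf (g y) (Rle_lt_trans _ _ _ HG Hs)).
  replace (f (g y) - f (g t) - RtoC (y - t) * (l * d))%C with
    ((f (g y) - f (g t) - (g y - g t) * l) + l * (g y - g t - RtoC (y - t) * d))%C by ring.
  eapply Rle_trans; [apply Cmod_triangle |]. rewrite Cmod_mult. fold A.
  assert (B1 : e2 * ((D + 1) * Rabs (y - t)) = e / 2 * Rabs (y - t)).
  { unfold e2. field. lra. }
  assert (B2 : A * e1 <= e / 2).
  { assert (e1 <= e / (2 * (A + 1))) by apply Rmin_r.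
    apply Rle_trans with (A * (e / (2 * (A + 1)))); [nra |].
    apply Rle_trans with ((A + 1) * (e / (2 * (A + 1)))).
    - apply Rmult_le_compat_r; [| lra]. left. apply Rdiv_lt_0_compat; lra.
    - right. field. lra. }
  assert (e2 * Cmod (g y - g t) <= e / 2 * Rabs (y - t)).
  { rewrite <- B1. apply Rmult_le_compat_l; lra. }
  assert (A * Cmod (g y - g t - RtoC (y - t) * d) <= e / 2 * Rabs (y - t)).
  { apply Rle_trans with (A * (e1 * Rabs (y - t))); [apply Rmult_le_compat_l; lra |]. nra. }
  lra.
Qed.

(** A quadratic Taylor remainder with a constant can be estimated under the integral sign; this is
    the form in which complex differentiability of transforms is obtained. *)
Lemma is_Cderive_quad (f : C -> C) (x l : C) (r K : R) : 0 < r -> 0 <= K ->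
  (forall y, Cmod (y - x) < r -> Cmod (f y - f x - (y - x) * l) <= K * Cmod (y - x) ^ 2) ->
  is_derive (K := C_AbsRing) (V := C_NormedModule) f x l.
Proof.
  intros Hr HK H. apply is_Cderive_eps. intros e He.
  exists (Rmin r (e / (K + 1))). split; [apply Rmin_pos; [lra | apply Rdiv_lt_0_compat; lra] |].
  intros y Hy.
  assert (H1 : Cmod (y - x) < r) by (eapply Rlt_le_trans; [exact Hy | apply Rmin_l]).
  assert (H2 : Cmod (y - x) < e / (K + 1)) by (eapply Rlt_le_trans; [exact Hy | apply Rmin_r]).
  eapply Rle_trans; [apply H, H1 |].
  assert (Hp := Cmod_ge_0 (y - x)).
  replace (K * Cmod (y - x) ^ 2) with ((K * Cmod (y - x)) * Cmod (y - x)) by ring.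
  apply Rmult_le_compat_r; [exact Hp |].
  apply Rle_trans with ((K + 1) * (e / (K + 1))); [nra | right; field; lra].
Qed.

(** The mean value inequality applied to [g1] and then to g(t) - t g1(0); it loses the factor 1/2 of
    the sharp remainder. *)
Lemma taylor01 (g g1 g2 : R -> C) (B : R) :
  (forall t, 0 <= t <= 1 -> rder g t (g1 t)) ->
  (forall t, 0 <= t <= 1 -> rder g1 t (g2 t)) ->
  (forall t, 0 <= t <= 1 -> Cmod (g2 t) <= B) ->
  Cmod (g 1 - g 0 - g1 0)%C <= B.
Proof.
  intros H1 H2 HB.
  assert (B0 : 0 <= B) by (eapply Rle_trans; [apply Cmod_ge_0 | apply (HB 0); lra]).
  assert (H := mvt_cplx (fun t => g t - RtoC t * g1 0)%C (fun t => g1 t - g1 0)%C 0 1 B).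
  replace (g 1 - g 0 - g1 0)%C with (g 1 - RtoC 1 * g1 0 - (g 0 - RtoC 0 * g1 0))%C by ring.
  replace B with (B * (1 - 0)) by ring. apply H; [lra | |].
  - intros t Ht. apply rder_minus; [now apply H1 |].
    eapply rder_eq; [apply rder_mult; [apply rder_RtoC, @is_derive_id | apply rder_const] |].
    simpl. unfold one; simpl. ring.
  - intros t Ht. eapply Rle_trans; [apply (mvt_cplx g1 g2 0 t B) |]; try lra.
    + intros; apply H2; lra.
    + intros; apply HB; lra.
    + nra.
Qed.

(** * Improper integrals over the real line *)

(** The common majorant of integrands on the line. Its integral is pi, rounded up to 4 in the bounds
    below; on v = 1 + iy it equals |v|^(-2). *)
Definition om (y : R) : R := / (1 + y ^ 2).

Definition dominated (f : R -> R) (K : R) : Prop :=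
  (forall y, continuous f y) /\ forall y, Rabs (f y) <= K * om y.

Definition int_n (f : R -> R) (n : nat) : R := RInt f (- INR n) (INR n).

(** A limit along symmetric integer intervals, total through the default value of [Lim_seq];
    [int_R_lim] makes it a genuine limit for dominated integrands. *)
Definition int_R (f : R -> R) : R := real (Lim_seq (int_n f)).

Lemma om_pos y : 0 < om y.
Proof. apply Rinv_0_lt_compat. nra. Qed.

Lemma om_cont y : continuous om y.
Proof.
  apply (ex_derive_continuous (V := R_NormedModule)). unfold om. auto_derive. nra.
Qed.

Lemma is_RInt_om a b : is_RInt om a b (atan b - atan a).
Proof.
  apply (is_RInt_derive atan om).
  - intros x _. eapply is_derive_eq; [apply is_derive_atan |]. unfold om, Rsqr. f_equal. ring.
  - intros; apply om_cont.
Qed.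

Lemma int_n_om_le n : int_n om n <= 4.
Proof.
  unfold int_n. rewrite (is_RInt_unique _ _ _ _ (is_RInt_om _ _)).
  rewrite atan_opp. assert (H := atan_bound (INR n)). assert (H' := PI_4). lra.
Qed.

Lemma ex_RInt_cont (f : R -> R) a b : (forall y, continuous f y) -> ex_RInt f a b.
Proof. intros H. apply (ex_RInt_continuous (V := R_CompleteNormedModule)). intros; apply H. Qed.

Lemma int_n_mono_interval (f : R -> R) n :
  (forall y, continuous f y) -> (forall y, 0 <= f y) -> int_n f n <= int_n f (S n).
Proof.
  intros Hc Hp. unfold int_n. assert (H : INR (S n) = INR n + 1) by apply S_INR.
  assert (Hn := pos_INR n).
  rewrite <- (RInt_Chasles f (- INR (S n)) (- INR n) (INR (S n))) by (apply ex_RInt_cont, Hc).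
  rewrite <- (RInt_Chasles f (- INR n) (INR n) (INR (S n))) by (apply ex_RInt_cont, Hc).
  assert (0 <= RInt f (- INR (S n)) (- INR n)).
  { apply RInt_ge_0; [lra | apply ex_RInt_cont, Hc | intros; apply Hp]. }
  assert (0 <= RInt f (INR n) (INR (S n))).
  { apply RInt_ge_0; [lra | apply ex_RInt_cont, Hc | intros; apply Hp]. }
  unfold plus in *; simpl in *. lra.
Qed.

Lemma int_n_plus f g n : (forall y, continuous f y) -> (forall y, continuous g y) ->
  int_n (fun y => f y + g y) n = int_n f n + int_n g n.
Proof. intros. apply (RInt_plus f g); now apply ex_RInt_cont. Qed.

Lemma int_n_scal c f n : (forall y, continuous f y) -> int_n (fun y => c * f y) n = c * int_n f n.
Proof. intros. apply (RInt_scal f); now apply ex_RInt_cont. Qed.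

Lemma int_n_ext f g n : (forall y, f y = g y) -> int_n f n = int_n g n.
Proof. intros. apply RInt_ext. intros; auto. Qed.

Lemma int_n_le f g n : (forall y, continuous f y) -> (forall y, continuous g y) ->
  (forall y, f y <= g y) -> int_n f n <= int_n g n.
Proof.
  intros. unfold int_n. assert (Hn := pos_INR n).
  apply RInt_le; [lra | now apply ex_RInt_cont | now apply ex_RInt_cont | auto].
Qed.

Lemma cont_scal (c : R) (f : R -> R) y : continuous f y -> continuous (fun y => c * f y) y.
Proof. intros. apply (continuous_mult (fun _ => c) f); [apply continuous_const | assumption]. Qed.

Lemma cont_plus (f g : R -> R) y :
  continuous f y -> continuous g y -> continuous (fun y => f y + g y) y.
Proof. intros. now apply (continuous_plus f g). Qed.

Lemma cont_mult (f g : R -> R) y :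
  continuous f y -> continuous g y -> continuous (fun y => f y * g y) y.
Proof. intros. now apply (continuous_mult f g). Qed.

Lemma int_n_abs_le f g n : (forall y, continuous f y) -> (forall y, continuous g y) ->
  (forall y, Rabs (f y) <= g y) -> Rabs (int_n f n) <= int_n g n.
Proof.
  intros Hf Hg H.
  assert (H' : forall y, - g y <= f y <= g y) by (intros; now apply Rabs_le_between).
  apply Rabs_le. split.
  - replace (- int_n g n) with (-1 * int_n g n) by ring. rewrite <- int_n_scal by assumption.
    apply int_n_le; [intros; now apply cont_scal | assumption | intros y; specialize (H' y); lra].
  - apply int_n_le; auto. apply H'.
Qed.

(** Both [f + K om] and [K om] are nonnegative, so their integrals over [-n, n] increase and are
    bounded; f is their difference. *)
Lemma int_R_lim f K : dominated f K -> is_lim_seq (int_n f) (int_R f).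
Proof.
  intros [Hc Hb].
  assert (Hc2 : forall y, continuous (fun y => K * om y) y) by (intros; apply cont_scal, om_cont).
  assert (HK : 0 <= K).
  { specialize (Hb 0). assert (H := om_pos 0). assert (0 <= Rabs (f 0)) by apply Rabs_pos. nra. }
  assert (A1 : ex_finite_lim_seq (int_n (fun y => f y + K * om y))).
  { apply ex_finite_lim_seq_incr with (2 * K * 4).
    - intros n. apply int_n_mono_interval; [intros; now apply cont_plus |].
      intros y. specialize (Hb y). apply Rabs_le_between in Hb. lra.
    - intros n. apply Rle_trans with (2 * K * int_n om n).
      + rewrite <- int_n_scal by apply om_cont. apply int_n_le.
        * intros; now apply cont_plus.
        * intros; apply cont_scal, om_cont.
        * intros y. specialize (Hb y). apply Rabs_le_between in Hb. lra.
      + apply Rmult_le_compat_l; [lra | apply int_n_om_le]. }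
  assert (A2 : ex_finite_lim_seq (int_n (fun y => K * om y))).
  { apply ex_finite_lim_seq_incr with (K * 4).
    - intros n. apply int_n_mono_interval; [assumption |].
      intros y. assert (H := om_pos y). nra.
    - intros n. rewrite int_n_scal by apply om_cont. apply Rmult_le_compat_l; [lra | apply int_n_om_le]. }
  destruct A1 as [l1 H1], A2 as [l2 H2].
  assert (H3 : is_lim_seq (int_n f) (l1 - l2)).
  { apply is_lim_seq_ext with (fun n => int_n (fun y => f y + K * om y) n - int_n (fun y => K * om y) n).
    - intros n. rewrite int_n_plus by assumption. ring.
    - now apply is_lim_seq_minus'. }
  unfold int_R. rewrite (is_lim_seq_unique _ _ H3). exact H3.
Qed.

Lemma int_R_unique f (l : R) : is_lim_seq (int_n f) l -> int_R f = l.
Proof. intros H. unfold int_R. now rewrite (is_lim_seq_unique _ _ H). Qed.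

Lemma int_R_ext f g : (forall y, f y = g y) -> int_R f = int_R g.
Proof. intros H. unfold int_R. f_equal. apply Lim_seq_ext. intros n. now apply int_n_ext. Qed.

Lemma int_R_plus f g K L : dominated f K -> dominated g L -> int_R (fun y => f y + g y) = int_R f + int_R g.
Proof.
  intros Hf Hg. apply int_R_unique.
  apply is_lim_seq_ext with (fun n => int_n f n + int_n g n).
  - intros n. symmetry. apply int_n_plus; [apply Hf | apply Hg].
  - apply is_lim_seq_plus'; eapply int_R_lim; eassumption.
Qed.

Lemma int_R_scal c f K : dominated f K -> int_R (fun y => c * f y) = c * int_R f.
Proof.
  intros Hf. apply int_R_unique.
  apply is_lim_seq_ext with (fun n => c * int_n f n).
  - intros n. symmetry. apply int_n_scal, Hf.
  - apply (is_lim_seq_scal_l (int_n f) c (int_R f)). eapply int_R_lim; eassumption.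
Qed.

Lemma is_lim_seq_abs_le (u : nat -> R) (l B : R) :
  is_lim_seq u l -> (forall n, Rabs (u n) <= B) -> Rabs l <= B.
Proof.
  intros Hu HB.
  apply (is_lim_seq_le (fun n => Rabs (u n)) (fun _ => B) (Rabs l) B); auto.
  - apply (is_lim_seq_abs u l), Hu.
  - apply is_lim_seq_const.
Qed.

Lemma int_R_abs_le f K B : dominated f K -> (forall n, Rabs (int_n f n) <= B) -> Rabs (int_R f) <= B.
Proof. intros Hf. apply is_lim_seq_abs_le. eapply int_R_lim; eassumption. Qed.

Lemma int_R_bound f K : dominated f K -> Rabs (int_R f) <= 4 * K.
Proof.
  intros Hf. eapply int_R_abs_le; [exact Hf |]. intros n.
  assert (HK : 0 <= K).
  { destruct Hf as [_ Hb]. specialize (Hb 0). assert (H := om_pos 0).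
    assert (0 <= Rabs (f 0)) by apply Rabs_pos. nra. }
  apply Rle_trans with (int_n (fun y => K * om y) n).
  - apply int_n_abs_le; [apply Hf | intros; apply cont_scal, om_cont | apply Hf].
  - rewrite int_n_scal by apply om_cont. assert (H := int_n_om_le n). nra.
Qed.

Definition cint_R (f : R -> C) : C := (int_R (fun y => Re (f y)), int_R (fun y => Im (f y))).

Definition cdominated (f : R -> C) (K : R) : Prop :=
  (forall y, ccont f y) /\ forall y, Cmod (f y) <= K * om y.

Lemma cdominated_re f K : cdominated f K -> dominated (fun y => Re (f y)) K.
Proof.
  intros [Hc Hb]; split; [intros; apply Hc |].
  intros; eapply Rle_trans; [apply re_le_Cmod | apply Hb].
Qed.

Lemma cdominated_im f K : cdominated f K -> dominated (fun y => Im (f y)) K.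
Proof.
  intros [Hc Hb]; split; [intros; apply Hc |].
  intros; eapply Rle_trans; [apply Im_le_Cmod | apply Hb].
Qed.

Lemma dominated_pos f K : dominated f K -> 0 <= K.
Proof.
  intros [_ Hb]. specialize (Hb 0). assert (H := om_pos 0).
  assert (0 <= Rabs (f 0)) by apply Rabs_pos. nra.
Qed.

Lemma cdominated_pos f K : cdominated f K -> 0 <= K.
Proof. intros H. eapply dominated_pos, cdominated_re, H. Qed.

Lemma dominated_plus f g K L : dominated f K -> dominated g L -> dominated (fun y => f y + g y) (K + L).
Proof.
  intros [H1 H2] [H3 H4]; split; [intros; now apply cont_plus |].
  intros y. eapply Rle_trans; [apply Rabs_triang |]. specialize (H2 y). specialize (H4 y). lra.
Qed.

Lemma dominated_scal c f K : dominated f K -> dominated (fun y => c * f y) (Rabs c * K).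
Proof.
  intros [H1 H2]; split; [intros; now apply cont_scal |].
  intros y. rewrite Rabs_mult, Rmult_assoc. apply Rmult_le_compat_l; [apply Rabs_pos | apply H2].
Qed.

Lemma cdominated_plus f g K L : cdominated f K -> cdominated g L -> cdominated (fun y => (f y + g y)%C) (K + L).
Proof.
  intros [H1 H2] [H3 H4]; split; [intros; now apply ccont_plus |].
  intros y. eapply Rle_trans; [apply Cmod_triangle |]. specialize (H2 y). specialize (H4 y). lra.
Qed.

Lemma cdominated_scal c f K : cdominated f K -> cdominated (fun y => (c * f y)%C) (Cmod c * K).
Proof.
  intros [H1 H2]; split; [intros; now apply ccont_scal |].
  intros y. rewrite Cmod_mult, Rmult_assoc. apply Rmult_le_compat_l; [apply Cmod_ge_0 | apply H2].
Qed.

Lemma cint_R_ext f g : (forall y, f y = g y) -> cint_R f = cint_R g.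
Proof. intros H. unfold cint_R. f_equal; apply int_R_ext; intros; now rewrite H. Qed.

Lemma cint_R_plus f g K L : cdominated f K -> cdominated g L -> cint_R (fun y => (f y + g y)%C) = (cint_R f + cint_R g)%C.
Proof.
  intros Hf Hg. apply C_ext; simpl; unfold cint_R; simpl.
  - apply (int_R_plus (fun y => Re (f y)) (fun y => Re (g y)) K L); now apply cdominated_re.
  - apply (int_R_plus (fun y => Im (f y)) (fun y => Im (g y)) K L); now apply cdominated_im.
Qed.

Lemma cint_R_scal c f K : cdominated f K -> cint_R (fun y => (c * f y)%C) = (c * cint_R f)%C.
Proof.
  intros Hf. assert (H1 := cdominated_re _ _ Hf). assert (H2 := cdominated_im _ _ Hf).
  apply C_ext; simpl; unfold cint_R; simpl.
  - rewrite (int_R_ext _ (fun y => Re c * Re (f y) + (- Im c) * Im (f y))).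
    2: { intros; unfold Re, Im; ring. }
    rewrite (int_R_plus _ _ _ _ (dominated_scal (Re c) _ _ H1) (dominated_scal (- Im c) _ _ H2)).
    rewrite (int_R_scal _ _ _ H1), (int_R_scal _ _ _ H2). unfold Re, Im; ring.
  - rewrite (int_R_ext _ (fun y => Re c * Im (f y) + Im c * Re (f y))).
    2: { intros; unfold Re, Im; ring. }
    rewrite (int_R_plus _ _ _ _ (dominated_scal (Re c) _ _ H2) (dominated_scal (Im c) _ _ H1)).
    rewrite (int_R_scal _ _ _ H1), (int_R_scal _ _ _ H2). unfold Re, Im; ring.
Qed.

Lemma cint_R_minus f g K L : cdominated f K -> cdominated g L -> cint_R (fun y => (f y - g y)%C) = (cint_R f - cint_R g)%C.
Proof.
  intros Hf Hg. rewrite (cint_R_ext _ (fun y => f y + - (1) * g y)%C) by (intros; ring).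
  rewrite (cint_R_plus _ _ _ _ Hf (cdominated_scal (- (1))%C _ _ Hg)), (cint_R_scal _ _ _ Hg). ring.
Qed.

Lemma cint_R_bound f K : cdominated f K -> Cmod (cint_R f) <= 8 * K.
Proof.
  intros Hf. eapply Rle_trans; [apply Cmod_le_ReIm |].
  assert (H1 := int_R_bound _ _ (cdominated_re _ _ Hf)). assert (H2 := int_R_bound _ _ (cdominated_im _ _ Hf)).
  unfold cint_R; simpl. unfold Re, Im in *. simpl in *. lra.
Qed.

(** Boundary terms at both ends at once: [e * e = 1] stands for e = 1 or e = -1. *)
Lemma om_lim (f : R -> R) K (e : R) : (forall y, Rabs (f y) <= K * om y) -> e * e = 1 ->
  is_lim_seq (fun n => f (e * INR n)) 0.
Proof.
  intros Hb He.
  assert (HK : 0 <= K).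
  { specialize (Hb 0). assert (H := om_pos 0). assert (0 <= Rabs (f 0)) by apply Rabs_pos. nra. }
  assert (H0 : is_lim_seq (fun n => K * / INR n) 0).
  { replace (Finite 0) with (Rbar_mult K 0) by (simpl; f_equal; ring).
    apply is_lim_seq_scal_l.
    replace (Finite 0) with (Rbar_inv p_infty) by reflexivity.
    apply is_lim_seq_inv; [apply is_lim_seq_INR | discriminate]. }
  apply is_lim_seq_abs_0.
  apply is_lim_seq_le_le_loc with (fun _ => 0) (fun n => K * / INR n); [| apply is_lim_seq_const | exact H0].
  exists 1%nat. intros n Hn. split; [apply Rabs_pos |].
  eapply Rle_trans; [apply Hb |]. apply Rmult_le_compat_l; [exact HK |].
  apply le_INR in Hn. simpl in Hn. unfold om. apply Rinv_le_contravar; [lra |].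
  replace ((e * INR n) ^ 2) with (e * e * (INR n * INR n)) by ring. rewrite He. nra.
Qed.

Lemma int_R_derive f df K L : dominated f K -> dominated df L -> (forall y, is_derive f y (df y)) -> int_R df = 0.
Proof.
  intros [_ Hf] [Hc _] Hd. apply int_R_unique.
  apply is_lim_seq_ext with (fun n => f (1 * INR n) - f (-1 * INR n)).
  - intros n. symmetry. unfold int_n. apply is_RInt_unique.
    rewrite Rmult_1_l. replace (-1 * INR n) with (- INR n) by ring.
    apply (is_RInt_derive (V := R_CompleteNormedModule) f df); auto.
  - replace (Finite 0) with (Finite (0 - 0)) by (f_equal; ring).
    apply is_lim_seq_minus'; apply om_lim with K; auto; ring.
Qed.

Lemma cint_R_derive f df K L : cdominated f K -> cdominated df L -> (forall y, rder f y (df y)) -> cint_R df = 0%C.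
Proof.
  intros Hf Hd H. unfold cint_R. apply C_ext; simpl.
  - eapply int_R_derive; [apply cdominated_re, Hf | apply cdominated_re, Hd | intros; apply H].
  - eapply int_R_derive; [apply cdominated_im, Hf | apply cdominated_im, Hd | intros; apply H].
Qed.

Lemma cint_R_quad f0 f1 g K0 K1 Kg K (d : R) :
  cdominated f0 K0 -> cdominated f1 K1 -> cdominated g Kg ->
  (forall y, Cmod (f1 y - f0 y - RtoC d * g y) <= K * d ^ 2 * om y) ->
  Cmod (cint_R f1 - cint_R f0 - RtoC d * cint_R g) <= 8 * K * d ^ 2.
Proof.
  intros H0 H1 Hg H.
  assert (A : cdominated (fun y => (f1 y + - (1) * f0 y) + - RtoC d * g y)%C (K * d ^ 2)).
  { split.
    - intros y. apply ccont_plus; [apply ccont_plus; [apply H1 |] |]; apply ccont_scal; [apply H0 | apply Hg].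
    - intros y. replace (_ + _)%C with (f1 y - f0 y - RtoC d * g y)%C by ring. apply H. }
  assert (B := cint_R_bound _ _ A).
  rewrite (cint_R_plus _ _ _ _ (cdominated_plus _ _ _ _ H1 (cdominated_scal (- (1))%C _ _ H0)) (cdominated_scal (- RtoC d)%C _ _ Hg)) in B.
  rewrite (cint_R_plus _ _ _ _ H1 (cdominated_scal (- (1))%C _ _ H0)) in B.
  rewrite (cint_R_scal _ _ _ H0), (cint_R_scal _ _ _ Hg) in B.
  replace (cint_R f1 - cint_R f0 - RtoC d * cint_R g)%C with (cint_R f1 + - (1) * cint_R f0 + - RtoC d * cint_R g)%C by ring.
  lra.
Qed.

(** Differentiation under the integral sign in quantitative form: a remainder O((s - t)^2 om y),
    uniform in y, integrates to a quadratic remainder. *)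
Lemma cint_R_param (f g : R -> R -> C) (t r Kg K : R) : 0 < r ->
  (forall s, Rabs (s - t) < r -> exists K0, cdominated (f s) K0) ->
  cdominated (g t) Kg ->
  (forall s y, Rabs (s - t) < r -> Cmod (f s y - f t y - RtoC (s - t) * g t y) <= K * (s - t) ^ 2 * om y) ->
  rder (fun s => cint_R (f s)) t (cint_R (g t)).
Proof.
  intros Hr Hd Hg H. apply rder_eps. intros e He.
  destruct (Hd t) as [K0 H0]. { rewrite Rminus_eq_0, Rabs_R0. exact Hr. }
  set (L := 8 * Rabs K + 1). assert (HL : 0 < L) by (assert (0 <= Rabs K) by apply Rabs_pos; unfold L; lra).
  exists (Rmin r (e / L)). split; [apply Rmin_pos; [lra | apply Rdiv_lt_0_compat; lra] |].
  intros s Hs.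
  assert (Hs1 : Rabs (s - t) < r) by (eapply Rlt_le_trans; [exact Hs | apply Rmin_l]).
  assert (Hs2 : Rabs (s - t) < e / L) by (eapply Rlt_le_trans; [exact Hs | apply Rmin_r]).
  destruct (Hd s Hs1) as [K1 H1].
  eapply Rle_trans; [apply (cint_R_quad _ _ _ _ _ _ K _ H0 H1 Hg); intros; now apply H |].
  assert (Hp := Rabs_pos (s - t)). rewrite <- (pow2_abs (s - t)).
  assert (K <= Rabs K) by apply Rle_abs.
  replace (8 * K * Rabs (s - t) ^ 2) with ((8 * K * Rabs (s - t)) * Rabs (s - t)) by ring.
  apply Rmult_le_compat_r; [exact Hp |].
  apply Rle_trans with (L * Rabs (s - t)); [unfold L; nra |].
  apply Rle_trans with (L * (e / L)); [apply Rmult_le_compat_l; lra | right; field; lra].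
Qed.

(** Cutting [a, c] into n equal steps bounds the total increment by K (c - a)^2 / n, which is
    arbitrarily small. *)
Lemma quad_const (J : R -> C) (a K : R) :
  (forall c d, a <= c -> 0 <= d -> Cmod (J (c + d) - J c) <= K * d ^ 2) ->
  forall c, a <= c -> J c = J a.
Proof.
  intros H c Hc.
  assert (HK : 0 <= K).
  { specialize (H a 1 (Rle_refl _) Rle_0_1). assert (H' := Cmod_ge_0 (J (a + 1) - J a)). nra. }
  assert (S : forall e n, 0 <= e -> Cmod (J (a + INR n * e) - J a) <= INR n * (K * e ^ 2)).
  { intros e n He. induction n as [|n IH].
    - simpl. replace (a + 0 * e) with a by ring. replace (J a - J a)%C with (RtoC 0) by ring.
      rewrite Cmod_0. lra.
    - rewrite S_INR. replace (a + (INR n + 1) * e) with (a + INR n * e + e) by ring.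
      set (b := a + INR n * e) in *.
      replace (J (b + e)%R - J a)%C with ((J (b + e)%R - J b) + (J b - J a))%C by ring.
      eapply Rle_trans; [apply Cmod_triangle |].
      assert (Hn := pos_INR n).
      assert (Cmod (J (b + e)%R - J b) <= K * e ^ 2) by (apply H; unfold b; nra). lra. }
  assert (E : Cmod (J c - J a) <= 0).
  { apply le_epsilon. intros e He. rewrite Rplus_0_l.
    set (Q := K * (c - a) ^ 2).
    destruct (archimed_cor1 (e / (Q + 1))) as [n [Hn1 Hn2]].
    { apply Rdiv_lt_0_compat; [lra |]. unfold Q. assert (0 <= (c - a) ^ 2) by apply pow2_ge_0. nra. }
    assert (HQ : 0 <= Q). { unfold Q. assert (0 <= (c - a) ^ 2) by apply pow2_ge_0. nra. }
    apply lt_INR in Hn2. simpl in Hn2.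
    specialize (S ((c - a) / INR n) n). replace (a + INR n * ((c - a) / INR n)) with c in S by (field; lra).
    eapply Rle_trans; [apply S; apply Rmult_le_pos; [lra | left; apply Rinv_0_lt_compat; lra] |].
    replace (INR n * (K * ((c - a) / INR n) ^ 2)) with (Q * / INR n) by (unfold Q; field; lra).
    apply Rle_trans with ((Q + 1) * (e / (Q + 1))); [| right; field; lra].
    apply Rmult_le_compat; try lra. left; apply Rinv_0_lt_compat; lra. }
  assert (E2 := Cmod_ge_0 (J c - J a)).
  assert (E3 : (J c - J a)%C = 0%C) by (apply Cmod_eq_0; lra).
  replace (J c) with (J c - J a + J a)%C by ring. rewrite E3. ring.
Qed.

(** * Cauchy and Denjoy-Carleman theorems *)

(** One weight w controls f, f' and f'' on the closed half-plane. The bound on f'' makes the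
    increments between neighbouring vertical lines quadratic. *)
Definition half_plane_C2 (w : C -> R) (f : C -> C) : Prop :=
  exists f1 f2 K, forall v, 1 <= Re v ->
    cder f v (f1 v) /\ cder f1 v (f2 v) /\
    Cmod (f v) <= K * w v /\ Cmod (f1 v) <= K * w v /\ Cmod (f2 v) <= K * w v.

Lemma half_plane_C2_mult_gen w1 w2 f g :
  (forall v, 1 <= Re v -> 0 <= w1 v) -> (forall v, 1 <= Re v -> 0 <= w2 v) ->
  half_plane_C2 w1 f -> half_plane_C2 w2 g -> half_plane_C2 (fun v => w1 v * w2 v) (fun v => (f v * g v)%C).
Proof.
  intros Hw1 Hw2 [f1 [f2 [K Hf]]] [g1 [g2 [L Hg]]].
  exists (fun v => (f1 v * g v + f v * g1 v)%C),
   (fun v => ((f2 v * g v + f1 v * g1 v) + (f1 v * g1 v + f v * g2 v))%C), (4 * K * L).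
  intros v Hv. specialize (Hw1 v Hv). specialize (Hw2 v Hv).
  destruct (Hf v Hv) as [F1 [F2 [F3 [F4 F5]]]]. destruct (Hg v Hv) as [G1 [G2 [G3 [G4 G5]]]].
  assert (HK : 0 <= K * w1 v) by (eapply Rle_trans; [apply Cmod_ge_0 | exact F3]).
  assert (HL : 0 <= L * w2 v) by (eapply Rle_trans; [apply Cmod_ge_0 | exact G3]).
  assert (P : forall a b : C, Cmod a <= K * w1 v -> Cmod b <= L * w2 v -> Cmod (a * b) <= K * w1 v * (L * w2 v)).
  { intros a b Ha Hb. rewrite Cmod_mult. apply Rmult_le_compat; auto using Cmod_ge_0. }
  assert (HP : 0 <= K * w1 v * (L * w2 v)) by now apply Rmult_le_pos.
  split; [| split; [| split; [| split]]].
  - now apply cder_mult.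
  - apply cder_plus; now apply cder_mult.
  - assert (Q := P _ _ F3 G3). lra.
  - eapply Rle_trans; [apply Cmod_triangle |].
    assert (Q1 := P _ _ F4 G3). assert (Q2 := P _ _ F3 G4). lra.
  - eapply Rle_trans; [apply Cmod_triangle |].
    eapply Rle_trans; [apply Rplus_le_compat; apply Cmod_triangle |].
    assert (Q1 := P _ _ F5 G3). assert (Q2 := P _ _ F4 G4). assert (Q3 := P _ _ F3 G5). lra.
Qed.

Lemma half_plane_C2_le w1 w2 f : (forall v, 1 <= Re v -> 0 <= w1 v <= w2 v) -> half_plane_C2 w1 f -> half_plane_C2 w2 f.
Proof.
  intros Hw [f1 [f2 [K Hf]]]. exists f1, f2, (Rabs K). intros v Hv.
  destruct (Hf v Hv) as [F1 [F2 [F3 [F4 F5]]]]. specialize (Hw v Hv).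
  assert (W : forall x, x <= K * w1 v -> x <= Rabs K * w2 v).
  { intros x Hx. assert (Q := Rle_abs K). assert (Q2 := Rabs_pos K). nra. }
  split; [exact F1 | split; [exact F2 | split; [| split]]]; now apply W.
Qed.

Lemma half_plane_C2_mult w f g : (forall v, 1 <= Re v -> 0 <= w v) ->
  half_plane_C2 (fun _ => 1) f -> half_plane_C2 w g -> half_plane_C2 w (fun v => (f v * g v)%C).
Proof.
  intros Hw Hf Hg. apply half_plane_C2_le with (fun v => 1 * w v).
  - intros v Hv. specialize (Hw v Hv). lra.
  - apply (half_plane_C2_mult_gen (fun _ => 1) w); auto. intros; lra.
Qed.

(** Of the three powers of |v|, one is at least c and gives decay as the line moves to the right;
    the other two give |v|^2 = c^2 + y^2 >= 1 + y^2. *)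
Lemma Cmod_cube_om c y : 1 <= c -> / Cmod (c, y) ^ 3 <= / c * om y.
Proof.
  intros Hc. unfold om. rewrite <- Rinv_mult.
  assert (H2 : Cmod (c, y) ^ 2 = c ^ 2 + y ^ 2) by apply Cmod2_alt.
  assert (H1 : c <= Cmod (c, y)).
  { eapply Rle_trans; [apply Rle_abs |]. apply (re_le_Cmod (c, y)). }
  apply Rinv_le_contravar; [nra |].
  replace (Cmod (c, y) ^ 3) with (Cmod (c, y) * Cmod (c, y) ^ 2) by ring. rewrite H2. nra.
Qed.

Lemma rder_line (a b : C) (t : R) : rder (fun t => (a + RtoC t * b)%C) t b.
Proof.
  eapply rder_eq.
  - apply rder_plus; [apply rder_const |].
    apply rder_mult; [apply rder_RtoC, @is_derive_id | apply rder_const].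
  - simpl. unfold one; simpl. ring.
Qed.

Lemma rder_vert (c y : R) : rder (fun y => (c, y) : C) y Ci.
Proof. split; simpl; [apply @is_derive_const | apply @is_derive_id]. Qed.

(* Cauchy: the integral over [Re v = c] does not depend on [c] and tends to 0. *)
Lemma cauchy_line f : half_plane_C2 (fun v => / Cmod v ^ 3) f -> cint_R (fun y => f (1, y)) = 0%C.
Proof.
  intros [f1 [f2 [K Hf]]].
  assert (HK : 0 <= K).
  { destruct (Hf (RtoC 1)) as [_ [_ [H _]]]; [simpl; lra |]. rewrite Cmod_1 in H.
    assert (H' := Cmod_ge_0 (f (RtoC 1))). lra. }
  assert (W : forall c y, 1 <= c -> K * / Cmod (c, y) ^ 3 <= K / c * om y).
  { intros c y Hc. unfold Rdiv. rewrite Rmult_assoc.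
    apply Rmult_le_compat_l; [exact HK | now apply Cmod_cube_om]. }
  assert (Wc : forall c, 1 <= c -> K / c <= K).
  { intros c Hc. unfold Rdiv. rewrite <- (Rmult_1_r K) at 2. apply Rmult_le_compat_l; [exact HK |].
    rewrite <- Rinv_1. apply Rinv_le_contravar; lra. }
  assert (D0 : forall c, 1 <= c -> cdominated (fun y => f (c, y)) (K / c)).
  { intros c Hc. split.
    - intros y. eapply rder_cont. apply (proj1 (Hf (c, y) Hc) (fun y => (c, y)) y Ci eq_refl), rder_vert.
    - intros y. eapply Rle_trans; [apply (Hf (c, y) Hc) | now apply W]. }
  assert (D1 : forall c, 1 <= c -> cdominated (fun y => f1 (c, y)) (K / c)).
  { intros c Hc. split.
    - intros y. eapply rder_cont. apply (proj1 (proj2 (Hf (c, y) Hc)) (fun y => (c, y)) y Ci eq_refl), rder_vert.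
    - intros y. eapply Rle_trans; [apply (Hf (c, y) Hc) | now apply W]. }
  (* [Ci * f1 (c, y)] is the y-derivative of f(c, y), so its integral over the line vanishes. *)
  assert (I1 : forall c, 1 <= c -> cint_R (fun y => f1 (c, y)) = 0%C).
  { intros c Hc. assert (E : (Ci * cint_R (fun y => f1 (c, y)))%C = 0%C).
    { rewrite <- (cint_R_scal _ _ _ (D1 c Hc)).
      eapply cint_R_derive; [exact (D0 c Hc) | apply cdominated_scal, (D1 c Hc) |].
      intros y. eapply rder_eq; [apply (proj1 (Hf (c, y) Hc) (fun y => (c, y)) y Ci eq_refl), rder_vert | ring]. }
    replace (cint_R (fun y => f1 (c, y))) with (- Ci * (Ci * cint_R (fun y => f1 (c, y))))%C.
    - rewrite E. ring.
    - rewrite Cmult_assoc. replace (- Ci * Ci)%C with (RtoC 1); [ring |].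
      apply C_ext; simpl; ring. }
  set (J := fun c => cint_R (fun y => f (c, y))).
  assert (HJ : forall c, 1 <= c -> J c = J 1).
  { apply quad_const with (8 * K). intros c d Hc Hd. unfold J.
    assert (B := cint_R_quad _ _ _ _ _ _ K d (D0 c Hc) (D0 (c + d) ltac:(lra)) (D1 c Hc)).
    rewrite (I1 c Hc) in B.
    replace (cint_R (fun y => f ((c + d)%R, y)) - cint_R (fun y => f (c, y)))%C with
      (cint_R (fun y => f ((c + d)%R, y)) - cint_R (fun y => f (c, y)) - RtoC d * 0)%C by ring.
    apply B. intros y. clear B.
    assert (T := taylor01 (fun t => f ((c, y) + RtoC t * RtoC d)%C)
      (fun t => f1 ((c, y) + RtoC t * RtoC d)%C * RtoC d)%C
      (fun t => f2 ((c, y) + RtoC t * RtoC d)%C * RtoC d * RtoC d)%C (K * d ^ 2 * om y)).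
    assert (Hre : forall t, 0 <= t <= 1 -> ((c, y) + RtoC t * RtoC d)%C = (c + t * d, y)).
    { intros t Ht. apply C_ext; simpl; ring. }
    cbv beta in T. rewrite (Hre 1), (Hre 0) in T by lra.
    replace (c + 1 * d) with (c + d) in T by ring. replace (c + 0 * d) with c in T by ring.
    replace (RtoC d * f1 (c, y))%C with (f1 (c, y) * RtoC d)%C by ring.
    apply T.
    - intros t Ht.
      assert (Hv : 1 <= Re ((c, y) + RtoC t * RtoC d)%C) by (rewrite Hre by lra; simpl; nra).
      apply (proj1 (Hf _ Hv) (fun t => (c, y) + RtoC t * RtoC d)%C t (RtoC d) eq_refl), rder_line.
    - intros t Ht.
      assert (Hv : 1 <= Re ((c, y) + RtoC t * RtoC d)%C) by (rewrite Hre by lra; simpl; nra).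
      eapply rder_eq; [apply rder_mult; [| apply rder_const] |].
      + apply (proj1 (proj2 (Hf _ Hv)) (fun t => (c, y) + RtoC t * RtoC d)%C t (RtoC d) eq_refl), rder_line.
      + simpl. ring.
    - intros t Ht. rewrite !Cmod_mult, Cmod_R, (Rabs_right d) by lra. rewrite (Hre t Ht).
      assert (Hc' : 1 <= c + t * d) by nra.
      replace (K * d ^ 2 * om y) with (K * om y * d * d) by ring.
      apply Rmult_le_compat_r; [lra |]. apply Rmult_le_compat_r; [lra |].
      eapply Rle_trans; [apply (Hf (c + t * d, y) Hc') |].
      eapply Rle_trans; [apply (W _ _ Hc') |].
      apply Rmult_le_compat_r; [left; apply om_pos | now apply Wc]. }
  assert (E : Cmod (J 1) <= 0).
  { apply le_epsilon. intros e He. rewrite Rplus_0_l.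
    (* The integral over Re v = c is at most 8 K / c, hence at most e for this abscissa. *)
    set (c := 1 + 8 * K / e). assert (Hp : 0 <= 8 * K / e) by (apply Rmult_le_pos; [lra | left; now apply Rinv_0_lt_compat]).
    assert (Hc : 1 <= c) by (unfold c; lra).
    rewrite <- (HJ c Hc). eapply Rle_trans; [apply (cint_R_bound _ _ (D0 c Hc)) |].
    apply Rmult_le_reg_r with c; [lra |]. replace (8 * (K / c) * c) with (8 * K) by (field; lra).
    unfold c. replace (e * (1 + 8 * K / e)) with (e + 8 * K) by (field; lra). lra. }
  apply Cmod_eq_0. assert (H := Cmod_ge_0 (J 1)). unfold J in *. lra.
Qed.

(** U - u and U + u are both nondecreasing; [s * s = 1] in the proof covers the two signs. *)
Lemma growth (u U du dU : R -> R) (a b : R) : a <= b ->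
  (forall t, a <= t <= b -> is_derive u t (du t)) -> (forall t, a <= t <= b -> is_derive U t (dU t)) ->
  (forall t, a <= t <= b -> Rabs (du t) <= dU t) -> Rabs (u a) <= U a -> Rabs (u b) <= U b.
Proof.
  intros Hab Hu HU Hd Ha.
  assert (M : forall s, s * s = 1 -> U a - s * u a <= U b - s * u b).
  { intros s Hs.
    assert (HD : forall t, a <= t <= b -> is_derive (fun t => U t - s * u t) t (dU t - s * du t)).
    { intros t Ht. apply (is_derive_Rminus U (fun t => s * u t)); [now apply HU |].
      now apply (is_derive_scal u), Hu. }
    destruct (MVT_gen (fun t => U t - s * u t) a b (fun t => dU t - s * du t)) as [c [Hc1 Hc2]].
    - rewrite Rmin_left, Rmax_right by lra. intros x Hx. apply HD; lra.
    - rewrite Rmin_left, Rmax_right by lra. intros x Hx. eapply is_derive_cont_pt, HD; lra.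
    - rewrite Rmin_left, Rmax_right in Hc1 by lra.
      specialize (Hd c Hc1).
      assert (s * du c <= dU c).
      { eapply Rle_trans; [apply Rle_abs |]. rewrite Rabs_mult.
        replace (Rabs s) with 1; [lra |].
        assert (Hs2 := Rabs_mult s s). rewrite Hs, Rabs_R1 in Hs2.
        assert (0 <= Rabs s) by apply Rabs_pos. nra. }
      nra. }
  assert (M1 := M 1 ltac:(ring)). assert (M2 := M (-1) ltac:(ring)).
  apply Rabs_le_between in Ha. apply Rabs_le. lra.
Qed.

(** * Bang's argument for the operator x'' + x'/t *)

Section Bang.

Variables (x w : nat -> R -> R).
(** With w_p = t x_p', the two relations say (t x_p')' = t x_(p+1). At t = 0 the quotient is 0 by
    the convention on division, so the first one reads x_p'(0) = 0. *)
Hypothesis x_derive : forall p t, 0 <= t -> is_derive (x p) t (w p t / t).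
Hypothesis w_derive : forall p t, 0 <= t -> is_derive (w p) t (t * x (S p) t).

(** Downward induction from p = P, with d = P - p. A bound on x_(p+1) integrates to one on w_p, and
    that one to a bound on x_p. Since [be p], [ga p], [be (S p)] grow by a factor of at most a at
    each passage, both integrations are covered by the common factor exp (a (t - t0)). *)
Lemma bang_step (be ga : nat -> R) (a : R) (P : nat) (t0 t1 : R) :
  0 <= t0 <= t1 -> (forall p, 0 <= be p) -> (forall p, 0 <= ga p) ->
  (forall p, (p < P)%nat -> ga p <= a * be p) ->
  (forall p, (p < P)%nat -> be (S p) <= a * ga p) ->
  0 <= a ->
  (forall p, (p < P)%nat -> Rabs (x p t0) <= be p /\ Rabs (w p t0) <= t0 * ga p) ->
  (forall t, t0 <= t <= t1 -> Rabs (x P t) <= be P) ->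
  forall d p, (p + d = P)%nat -> forall t, t0 <= t <= t1 ->
    Rabs (x p t) <= be p * exp (a * (t - t0)) /\
    ((p < P)%nat -> Rabs (w p t) <= t * (ga p * exp (a * (t - t0)))).
Proof.
  intros Ht01 Hbe Hga H1 H2 Ha H0 HP.
  assert (E1 : forall t, t0 <= t -> 1 <= exp (a * (t - t0))).
  { intros t Ht. rewrite <- exp_0. destruct (Req_dec (a * (t - t0)) 0) as [-> | Hn];
     [right; reflexivity | left; apply exp_increasing; assert (0 <= a * (t - t0)) by (apply Rmult_le_pos; lra); lra]. }
  assert (DE : forall c t : R, is_derive (fun t : R => c * exp (a * (t - t0))) t (c * a * exp (a * (t - t0)))).
  { intros c t. auto_derive; [exact I |]. unfold Rminus; ring. }
  induction d as [|d IH]; intros p Hp t Ht.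
  - replace p with P by lia. split; [| lia].
    specialize (HP t Ht). specialize (E1 t (proj1 Ht)). specialize (Hbe P). nra.
  - assert (Hlt : (p < P)%nat) by lia.
    assert (IHS : forall s, t0 <= s <= t1 -> Rabs (x (S p) s) <= be (S p) * exp (a * (s - t0))).
    { intros s Hs. apply IH; [lia | exact Hs]. }
    assert (HW : forall t, t0 <= t <= t1 -> Rabs (w p t) <= t * (ga p * exp (a * (t - t0)))).
    { clear t Ht. intros t Ht.
      apply (growth (w p) (fun t => t * (ga p * exp (a * (t - t0)))) (fun t => t * x (S p) t)
        (fun t => 1 * (ga p * exp (a * (t - t0))) + t * (ga p * a * exp (a * (t - t0)))) t0 t); [lra | | | |].
      - intros s Hs. apply w_derive; lra.
      - intros s Hs. apply (is_derive_Rmult (fun t => t) (fun t => ga p * exp (a * (t - t0)))); [apply @is_derive_id | apply DE].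
      - intros s Hs. rewrite Rabs_mult, (Rabs_right s) by lra.
        specialize (IHS s ltac:(lra)). specialize (H2 p Hlt). specialize (Hga p).
        assert (G := E1 s ltac:(lra)).
        assert (s * Rabs (x (S p) s) <= s * (ga p * a * exp (a * (s - t0)))).
        { apply Rmult_le_compat_l; [lra |]. eapply Rle_trans; [exact IHS |].
          apply Rmult_le_compat_r; lra. }
        nra.
      - rewrite Rminus_eq_0, Rmult_0_r, exp_0, Rmult_1_r. now apply H0. }
    split; [| intros; now apply HW].
    apply (growth (x p) (fun t => be p * exp (a * (t - t0))) (fun t => w p t / t)
       (fun t => be p * a * exp (a * (t - t0))) t0 t); [lra | | | |].
    + intros s Hs. apply x_derive; lra.
    + intros s Hs. apply DE.
    + intros s Hs. specialize (HW s ltac:(lra)).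
      assert (G := E1 s ltac:(lra)). specialize (H1 p Hlt). specialize (Hbe p). specialize (Hga p).
      assert (B : Rabs (w p s / s) <= ga p * exp (a * (s - t0))).
      (* At s = 0 the bound just proved forces w_p(0) = 0, and the quotient is 0 as well. *)
      { destruct (Req_dec s 0) as [-> | Hs0].
        - assert (w p 0 = 0).
          { rewrite Rmult_0_l in HW. destruct (Req_dec (w p 0) 0); [assumption |].
            assert (0 < Rabs (w p 0)) by now apply Rabs_pos_lt. lra. }
          rewrite H. unfold Rdiv. rewrite Rmult_0_l, Rabs_R0. nra.
        - unfold Rdiv. rewrite Rabs_mult, Rabs_inv, (Rabs_right s) by lra.
          apply Rmult_le_reg_r with s; [lra |]. field_simplify; [| lra]. lra. }
      eapply Rle_trans; [exact B |]. apply Rmult_le_compat_r; lra.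
    + rewrite Rminus_eq_0, Rmult_0_r, exp_0, Rmult_1_r. now apply H0.
Qed.

End Bang.

(* Bang's argument: the bounds [e^(-2P)] for the indices below [P] at time [t0] become the bounds
   [e^(-2(P-1))] after the time [tau (P-1)], and the times [tau] have a divergent sum. *)
Lemma bang (x w : nat -> R -> R) (Q : nat -> R) (T : R) :
  (forall p t, 0 <= t -> is_derive (x p) t (w p t / t)) ->
  (forall p t, 0 <= t -> is_derive (w p) t (t * x (S p) t)) ->
  (forall p, x p 0 = 0) -> (forall p, w p 0 = 0) ->
  (forall p, 0 < Q p) -> (forall p, Q (S p) / Q p <= Q (S (S p)) / Q (S p)) ->
  (forall p t, 0 <= t <= T -> Rabs (x p t) <= Q p) ->
  is_lim_seq (sum_n (fun p => / sqrt (Q (S p) / Q p))) p_infty ->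
  forall t, 0 <= t <= T -> x 0%nat t = 0.
Proof.
  intros Dx Dw x0 w0 HQ Hlc HxQ Hdiv.
  set (E := exp 1). assert (HE : 2 <= E) by (unfold E; assert (H := exp_ineq1 1); lra).
  set (q := fun p => Q (S p) / Q p).
  assert (Hq : forall p, 0 < q p) by (intros; apply Rdiv_lt_0_compat; apply HQ).
  assert (Hqm : forall p r, (p <= r)%nat -> q p <= q r).
  { intros p r H. induction H; [lra |]. eapply Rle_trans; [exact IHle | apply Hlc]. }
  assert (Hsq : forall p, 0 < sqrt (q p)) by (intros; apply sqrt_lt_R0, Hq).
  (* With a = E sqrt (q P), this duration satisfies a * tau P = 2. The growth over it is at most
     e^2, exactly the loss in passing from E^(-2(P+1)) to E^(-2P). *)
  set (tau := fun p => 2 / (E * sqrt (q p))).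
  assert (Htau : forall p, 0 < tau p).
  { intros p. apply Rdiv_lt_0_compat; [lra |]. apply Rmult_lt_0_compat; [lra | apply Hsq]. }
  set (sg := fix sg n := match n with O => 0 | S m => sg m + tau m end).
  assert (Hsg : forall m d, sg m <= sg (m + d)%nat).
  { intros m d. induction d as [|d IH]; [rewrite Nat.add_0_r; lra |].
    rewrite Nat.add_succ_r. simpl. assert (H := Htau (m + d)%nat). lra. }
  (* [sg (P + d) - sg P] is the sum of the durations [tau] from P to P + d - 1. The bound on w_p / t
     is the geometric mean of those on x_p and x_(p+1), because Q (S p) = q p * Q p. *)
  assert (CL : forall d P, forall t, 0 <= t <= T -> t <= sg (P + d)%nat - sg P ->
     forall p, (p < P)%nat ->
       Rabs (x p t) <= / E ^ (2 * P) * (E ^ (2 * p) * Q p) /\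
       Rabs (w p t) <= t * (/ E ^ (2 * P) * (E ^ (2 * p + 1) * (sqrt (q p) * Q p)))).
  { assert (Hpos : forall P p, 0 <= / E ^ (2 * P) * (E ^ (2 * p) * Q p)).
    { intros. apply Rmult_le_pos; [left; apply Rinv_0_lt_compat, pow_lt; lra |].
      apply Rmult_le_pos; [apply pow_le; lra | left; apply HQ]. }
    assert (Hpos2 : forall P p, 0 <= / E ^ (2 * P) * (E ^ (2 * p + 1) * (sqrt (q p) * Q p))).
    { intros. apply Rmult_le_pos; [left; apply Rinv_0_lt_compat, pow_lt; lra |].
      apply Rmult_le_pos; [apply pow_le; lra |]. apply Rmult_le_pos; left; [apply Hsq | apply HQ]. }
    assert (Hshift : forall P, / E ^ (2 * P) = / E ^ (2 * S P) * (E * E)).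
    { intros P. replace (2 * S P)%nat with (S (S (2 * P))) by lia. simpl. field.
      split; [apply pow_nonzero; lra | lra]. }
    assert (HEE : 1 <= E * E) by nra.
    induction d as [|d IH]; intros P t Ht Hts p Hp.
    - rewrite Nat.add_0_r in Hts. replace t with 0 by lra. rewrite x0, w0, Rabs_R0.
      split; [apply Hpos | lra].
    - assert (Hd : (P + S d = S P + d)%nat) by lia. rewrite Hd in Hts.
      assert (Hsg1 := Hsg (S P) d).
      (* Up to [t1] the induction hypothesis for S P applies; the remaining time is at most
         [tau P]. *)
      set (t1 := Rmin t (sg (S P + d)%nat - sg (S P))).
      assert (Ht1 : 0 <= t1) by (apply Rmin_glb; lra).
      assert (Ht1t : t1 <= t) by apply Rmin_l.
      assert (Ht2 : t1 <= sg (S P + d)%nat - sg (S P)) by apply Rmin_r.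
      assert (Ht3 : t - t1 <= tau P).
      { assert (HtP := Htau P). unfold t1, Rmin. destruct (Rle_dec _ _); simpl in *; lra. }
      set (a := E * sqrt (q P)).
      assert (Ha : 0 < a) by (apply Rmult_lt_0_compat; [lra | apply Hsq]).
      assert (ST := bang_step x w Dx Dw
        (fun p => / E ^ (2 * S P) * (E ^ (2 * p) * Q p))
        (fun p => / E ^ (2 * S P) * (E ^ (2 * p + 1) * (sqrt (q p) * Q p))) a (S P) t1 t).
      destruct (ST (conj Ht1 Ht1t) (Hpos _) (Hpos2 _)) with (d := (S P - p)%nat) (p := p) (t := t)
        as [S1 S2]; clear ST.
      + intros r Hr.
        assert (sqrt (q r) <= sqrt (q P)) by (apply sqrt_le_1_alt, Hqm; lia).
        replace (2 * r + 1)%nat with (Datatypes.S (2 * r)) by lia. rewrite <- tech_pow_Rmult.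
        unfold a. replace (E * sqrt (q P) * (/ E ^ (2 * Datatypes.S P) * (E ^ (2 * r) * Q r)))
          with (/ E ^ (2 * Datatypes.S P) * (E ^ (2 * r) * Q r) * (E * sqrt (q P))) by ring.
        replace (/ E ^ (2 * Datatypes.S P) * (E * E ^ (2 * r) * (sqrt (q r) * Q r)))
          with (/ E ^ (2 * Datatypes.S P) * (E ^ (2 * r) * Q r) * (E * sqrt (q r))) by ring.
        apply Rmult_le_compat_l; [apply Hpos |]. apply Rmult_le_compat_l; lra.
      + intros r Hr.
        assert (sqrt (q r) <= sqrt (q P)) by (apply sqrt_le_1_alt, Hqm; lia).
        replace (2 * Datatypes.S r)%nat with (Datatypes.S (2 * r + 1)) by lia. rewrite <- tech_pow_Rmult.
        assert (EQ : Q (Datatypes.S r) = sqrt (q r) * sqrt (q r) * Q r).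
        { rewrite sqrt_sqrt by (left; apply Hq). unfold q. field. assert (H' := HQ r). lra. }
        rewrite EQ.
        replace (/ E ^ (2 * Datatypes.S P) * (E * E ^ (2 * r + 1) * (sqrt (q r) * sqrt (q r) * Q r)))
          with (/ E ^ (2 * Datatypes.S P) * (E ^ (2 * r + 1) * (sqrt (q r) * Q r)) * (E * sqrt (q r))) by ring.
        unfold a. rewrite (Rmult_comm (E * sqrt (q P))).
        apply Rmult_le_compat_l; [apply Hpos2 |]. apply Rmult_le_compat_l; lra.
      + lra.
      + intros r Hr. apply IH; [lra | lra | exact Hr].
      + intros s Hs. rewrite <- Rmult_assoc, Rinv_l, Rmult_1_l by (apply pow_nonzero; lra).
        apply HxQ; lra.
      + lia.
      + lra.
      + assert (EX : exp (a * (t - t1)) <= E * E).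
        { unfold E. rewrite <- exp_plus. destruct (Rle_lt_or_eq_dec (a * (t - t1)) (1 + 1)) as [Hl | ->].
          - replace (1 + 1) with (a * tau P).
            + apply Rmult_le_compat_l; lra.
            + unfold a, tau. field. split; [assert (Hs := Hsq P); lra | lra].
          - left. now apply exp_increasing.
          - right; reflexivity. }
        specialize (S2 ltac:(lia)). rewrite (Hshift P). split.
        * eapply Rle_trans; [exact S1 |].
          replace (/ E ^ (2 * S P) * (E * E) * (E ^ (2 * p) * Q p)) with
            (/ E ^ (2 * S P) * (E ^ (2 * p) * Q p) * (E * E)) by ring.
          apply Rmult_le_compat_l; [apply Hpos | exact EX].
        * eapply Rle_trans; [exact S2 |]. apply Rmult_le_compat_l; [lra |].
          replace (/ E ^ (2 * S P) * (E * E) * (E ^ (2 * p + 1) * (sqrt (q p) * Q p))) with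
            (/ E ^ (2 * S P) * (E ^ (2 * p + 1) * (sqrt (q p) * Q p)) * (E * E)) by ring.
          apply Rmult_le_compat_l; [apply Hpos2 | exact EX]. }
  assert (Hsgsum : forall n, sg (S n) = 2 / E * sum_n (fun p => / sqrt (Q (S p) / Q p)) n).
  { induction n as [|n IH].
    - rewrite sum_O. simpl. unfold tau, q. field. split; [| lra].
      assert (H := Hsq 0%nat). unfold q in H. lra.
    - rewrite sum_Sn. change (sg (S (S n))) with (sg (S n) + tau (S n)). rewrite IH.
      unfold plus; simpl. unfold tau, q. field. split; [| lra].
      assert (H := Hsq (S n)). unfold q in H. lra. }
  intros t Ht.
  (* By divergence the durations from S k on add up to more than T, so the bound with P = S k holds
     on all of [0, T], for every k. *)
  assert (B : forall k, Rabs (x 0%nat t) * E ^ (2 * S k) <= Q 0%nat).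
  { intros k. apply is_lim_seq_spec in Hdiv.
    destruct (Hdiv (E / 2 * (T + sg (S k)))) as [N HN].
    assert (H1 : T + sg (S k) < sg (S (Nat.max N k))).
    { rewrite (Hsgsum (Nat.max N k)). specialize (HN (Nat.max N k) ltac:(lia)).
      apply Rmult_lt_compat_l with (r := 2 / E) in HN; [| apply Rdiv_lt_0_compat; lra].
      eapply Rle_lt_trans; [| exact HN]. right. field. lra. }
    destruct (CL (Nat.max N k - k)%nat (S k) t Ht) with (p := 0%nat) as [H2 _].
    - replace (S k + (Nat.max N k - k))%nat with (S (Nat.max N k)) by lia. lra.
    - lia.
    - apply Rmult_le_compat_r with (r := E ^ (2 * S k)) in H2; [| apply pow_le; lra].
      eapply Rle_trans; [exact H2 |]. right. rewrite Nat.mul_0_r. field. apply pow_nonzero; lra. }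
  destruct (Req_dec (x 0%nat t) 0) as [H0 | H0]; [exact H0 | exfalso].
  assert (Hx : 0 < Rabs (x 0%nat t)) by now apply Rabs_pos_lt.
  destruct (INR_unbounded (Q 0%nat / Rabs (x 0%nat t))) as [k Hk].
  specialize (B k).
  assert (INR k <= E ^ (2 * S k)).
  { replace E with (1 + (E - 1)) by ring.
    apply Rle_trans with (1 + INR (2 * S k) * (E - 1)); [| apply poly; lra].
    assert (INR k <= INR (2 * S k)) by (apply le_INR; lia). assert (H' := pos_INR (2 * S k)). nra. }
  apply Rmult_lt_compat_r with (r := Rabs (x 0%nat t)) in Hk; [| exact Hx].
  replace (Q 0%nat / Rabs (x 0%nat t) * Rabs (x 0%nat t)) with (Q 0%nat) in Hk by (field; lra).
  nra.
Qed.

(** * Concentrating kernels *)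

(** Near y0 the integrand is at least [al * k], of mass at least [al * A]. Farther away H may be
    negative, but there H k >= - K B om, which costs at most 4 K B. The estimate serves for the
    Poisson kernel and for powers of a Gumbel kernel. *)
Lemma concentration (H k : R -> R) (K L y0 d al A B : R) :
  dominated H K -> dominated (fun y => H y * k y) L -> (forall y, continuous k y) -> (forall y, 0 <= k y) ->
  0 < d -> 0 <= al -> 0 <= B -> (forall y, Rabs (y - y0) <= d -> al <= H y) ->
  (forall y, d <= Rabs (y - y0) -> k y <= B) ->
  A <= RInt k (y0 - d) (y0 + d) ->
  al * A - 4 * K * B <= int_R (fun y => H y * k y).
Proof.
  intros DH DHk Ck Pk Hd Hal HB Hnear Hfar HA.
  assert (HK := dominated_pos _ _ DH).
  assert (L1 := int_R_lim _ _ DHk).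
  apply (is_lim_seq_le_loc (fun _ => al * A - 4 * K * B) (int_n (fun y => H y * k y))
    (al * A - 4 * K * B) (int_R (fun y => H y * k y))); [| apply is_lim_seq_const | exact L1].
  destruct (INR_unbounded (Rabs y0 + d)) as [N HN].
  exists N. intros n Hn. apply le_INR in Hn.
  assert (Hy0 := Rle_abs y0). assert (Hy1 := Rle_abs (- y0)). rewrite Rabs_Ropp in Hy1.
  set (P := fun y => H y * k y + (K * B) * om y).
  assert (CP : forall y, continuous P y).
  { intros. apply cont_plus; [apply DHk | apply cont_scal, om_cont]. }
  assert (HP : forall y, al * k y <= P y \/ (d <= Rabs (y - y0) /\ 0 <= P y)).
  { intros y. assert (Hom := om_pos y). specialize (Pk y).
    destruct (Rle_dec d (Rabs (y - y0))) as [Hfy | Hny].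
    - right. split; [exact Hfy |]. unfold P. specialize (Hfar y Hfy).
      destruct DH as [_ Hb]. specialize (Hb y). apply Rabs_le_between in Hb.
      assert (K * om y * k y <= K * om y * B) by (apply Rmult_le_compat_l; nra). nra.
    - left. unfold P. specialize (Hnear y ltac:(lra)).
      assert (0 <= K * B * om y) by (apply Rmult_le_pos; nra). nra. }
  assert (HP0 : forall y, 0 <= P y).
  { intros y. destruct (HP y) as [Q | [_ Q]]; [| exact Q]. specialize (Pk y). nra. }
  assert (E : int_n P n = int_n (fun y => H y * k y) n + K * B * int_n om n).
  { unfold P. rewrite int_n_plus; [| apply DHk | intros; apply cont_scal, om_cont].
    now rewrite int_n_scal by apply om_cont. }
  assert (G : al * A <= int_n P n).
  { unfold int_n.
    rewrite <- (RInt_Chasles P (- INR n) (y0 - d) (INR n)) by (apply ex_RInt_cont, CP).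
    rewrite <- (RInt_Chasles P (y0 - d) (y0 + d) (INR n)) by (apply ex_RInt_cont, CP).
    assert (0 <= RInt P (- INR n) (y0 - d)).
    { apply RInt_ge_0; [lra | apply ex_RInt_cont, CP | intros; apply HP0]. }
    assert (0 <= RInt P (y0 + d) (INR n)).
    { apply RInt_ge_0; [lra | apply ex_RInt_cont, CP | intros; apply HP0]. }
    assert (al * A <= RInt P (y0 - d) (y0 + d)).
    { apply Rle_trans with (al * RInt k (y0 - d) (y0 + d)); [now apply Rmult_le_compat_l |].
      rewrite <- (RInt_scal k) by (apply ex_RInt_cont, Ck).
      apply RInt_le; [lra | | apply ex_RInt_cont, CP |].
      - apply ex_RInt_cont. intros. now apply cont_scal.
      - intros y Hy. destruct (HP y) as [Q | [Q _]]; [exact Q |].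
        exfalso. assert (Rabs (y - y0) < d) by (apply Rabs_lt_between; lra). lra. }
    unfold plus in *; simpl in *. lra. }
  assert (Hom := int_n_om_le n). assert (0 <= K * B) by now apply Rmult_le_pos. nra.
Qed.

Lemma continuous_eps (f : R -> R) (x : R) :
  continuous f x <->
  forall e, 0 < e -> exists d, 0 < d /\ forall y, Rabs (y - x) < d -> Rabs (f y - f x) < e.
Proof.
  split.
  - intros H e He. destruct (H (fun z => Rabs (z - f x) < e)) as [d Hd].
    + exists (mkposreal e He). intros z Hz. exact Hz.
    + exists d. split; [apply cond_pos |]. intros y Hy. apply Hd. exact Hy.
  - intros H P [e HP]. destruct (H e (cond_pos e)) as [d [Hd Hy]].
    exists (mkposreal d Hd). intros y B. apply HP. apply (Hy y). exact B.
Qed.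

Lemma poisson_cont e y0 y : 0 < e -> continuous (fun y => e / (e ^ 2 + (y - y0) ^ 2)) y.
Proof.
  intros He. apply (ex_derive_continuous (V := R_NormedModule)). auto_derive. apply Rgt_not_eq. assert (0 < e ^ 2) by now apply pow_lt. assert (Hq := pow2_ge_0 (y - y0)). simpl in *. unfold Rminus in *. lra.
Qed.

Lemma poisson_bound e u : 0 < e -> 0 < e / (e ^ 2 + u ^ 2) <= / e.
Proof.
  intros He. assert (H1 : 0 < e ^ 2) by now apply pow_lt. assert (H2 := pow2_ge_0 u).
  split; [apply Rdiv_lt_0_compat; lra |].
  replace (/ e) with (e / e ^ 2) by (field; lra).
  apply Rmult_le_compat_l; [lra |]. apply Rinv_le_contravar; lra.
Qed.

Lemma poisson_unique (H : R -> R) (K y0 : R) : dominated H K ->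
  (forall e, 0 < e -> int_R (fun y => H y * (e / (e ^ 2 + (y - y0) ^ 2))) = 0) -> H y0 = 0.
Proof.
  assert (W : forall H, dominated H K ->
    (forall e, 0 < e -> int_R (fun y => H y * (e / (e ^ 2 + (y - y0) ^ 2))) = 0) -> H y0 <= 0).
  { clear H. intros H DH HI. apply Rnot_lt_le. intros Hpos.
    destruct (proj1 (continuous_eps H y0) (proj1 DH y0) (H y0 / 2) ltac:(lra)) as [d0 [Hd0 Hc]].
    set (d := d0 / 2). assert (Hd : 0 < d) by (unfold d; lra).
    assert (Hnear : forall y, Rabs (y - y0) <= d -> H y0 / 2 <= H y).
    { intros y Hy. assert (Q := Hc y ltac:(unfold d in Hy; lra)).
      apply Rabs_lt_between in Q. lra. }
    assert (HK := dominated_pos _ _ DH).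
    (* e <= d gives the kernel the mass 2 atan (d / e) >= pi / 2 >= 1 on the near interval. The
       other bound keeps the far part at most H(y0) / 4, against H(y0) / 2 for the near part. *)
    set (e := Rmin d (H y0 * d ^ 2 / (16 * (K + 1)))).
    assert (He : 0 < e).
    { apply Rmin_pos; [exact Hd |]. apply Rdiv_lt_0_compat; [| lra].
      apply Rmult_lt_0_compat; [lra | now apply pow_lt]. }
    assert (Hed : e <= d) by apply Rmin_l.
    assert (C := concentration H (fun y => e / (e ^ 2 + (y - y0) ^ 2)) K (K / e) y0 d (H y0 / 2) 1 (e / d ^ 2)).
    cbv beta in C. rewrite (HI e He) in C.
    assert (F : H y0 / 2 * 1 - 4 * K * (e / d ^ 2) <= 0).
    { apply C; clear C.
      - exact DH.
      - split.
        + intros. apply cont_mult; [apply DH | now apply poisson_cont].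
        + intros y. rewrite Rabs_mult.
          replace (K / e * om y) with (K * om y * / e) by (unfold Rdiv; ring).
          apply Rmult_le_compat; [apply Rabs_pos | apply Rabs_pos | apply DH |].
          assert (Q := poisson_bound e (y - y0) He). rewrite Rabs_right; lra.
      - intros. now apply poisson_cont.
      - intros. left. now apply poisson_bound.
      - exact Hd.
      - lra.
      - apply Rmult_le_pos; [lra | left; apply Rinv_0_lt_compat; nra].
      - exact Hnear.
      - intros y Hy. apply Rmult_le_compat_l; [lra |]. apply Rinv_le_contravar; [nra |].
        rewrite <- (pow2_abs (y - y0)). assert (0 < e ^ 2) by now apply pow_lt. nra.
      - rewrite (is_RInt_unique _ _ _ (atan ((y0 + d - y0) / e) - atan ((y0 - d - y0) / e))).
        + replace ((y0 - d - y0) / e) with (- (d / e)) by (field; lra).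
          replace ((y0 + d - y0) / e) with (d / e) by (field; lra). rewrite atan_opp.
          assert (atan 1 <= atan (d / e)).
          { assert (H1 : 1 <= d / e).
            { apply Rmult_le_reg_r with e; [lra |]. field_simplify; lra. }
            destruct H1 as [H1 | <-]; [left; now apply atan_increasing | right; reflexivity]. }
          rewrite atan_1 in H0. assert (P2 := PI2_1). lra.
        + apply (is_RInt_derive (V := R_CompleteNormedModule) (fun y => atan ((y - y0) / e))).
          * intros y _. auto_derive; [exact I |]. unfold Rsqr, Rdiv. field. assert (0 < e ^ 2) by now apply pow_lt. assert (Q := pow2_ge_0 (y - y0)). split; [| lra]. apply Rgt_not_eq; lra.
          * intros; now apply poisson_cont. }
    assert (F2 : e <= H y0 * d ^ 2 / (16 * (K + 1))) by apply Rmin_r.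
    assert (F3 : 4 * K * (e / d ^ 2) <= H y0 / 4).
    { apply Rmult_le_compat_r with (r := 16 * (K + 1)) in F2; [| lra].
      replace (H y0 * d ^ 2 / (16 * (K + 1)) * (16 * (K + 1))) with (H y0 * d ^ 2) in F2 by (field; lra).
      apply Rmult_le_reg_r with (d ^ 2); [nra |].
      replace (4 * K * (e / d ^ 2) * d ^ 2) with (4 * K * e) by (field; lra). nra. }
    lra. }
  intros DH HI. apply Rle_antisym; [now apply W |].
  assert (DN := dominated_scal (-1) _ _ DH). rewrite Rabs_left in DN by lra.
  replace (- -1 * K) with K in DN by ring.
  assert (Q : -1 * H y0 <= 0).
  { apply (W (fun y => -1 * H y) DN). intros e He.
    rewrite <- (Rmult_0_r (-1)), <- (HI e He).
    destruct DH as [DC DB].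
    rewrite (int_R_ext _ (fun y => -1 * (H y * (e / (e ^ 2 + (y - y0) ^ 2))))) by (intros; ring).
    apply int_R_scal with (K / e). split.
    + intros. apply cont_mult; [apply DC | now apply poisson_cont].
    + intros y. rewrite Rabs_mult.
      replace (K / e * om y) with (K * om y * / e) by (unfold Rdiv; ring).
      apply Rmult_le_compat; [apply Rabs_pos | apply Rabs_pos | apply DB |].
      assert (Q := poisson_bound e (y - y0) He). rewrite Rabs_right; lra. }
  lra.
Qed.

Lemma ext_value_eps (g : C -> C) (v : C) :
  ext_value_at0 g v <->
  forall e, 0 < e -> exists d, 0 < d /\ forall z, HH z -> Cmod z < d -> Cmod (g z - v) < e.
Proof.
  split.
  - intros H e He.
    destruct (H (fun w => Cmod (w - v) < e)) as [d Hd].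
    (* Balls of the product structure on C are squares, hence the halved radius. *)
    + exists (mkposreal (e / 2) ltac:(lra)). intros z [B1 B2].
      change (Rabs (Re (z - v)) < e / 2) in B1. change (Rabs (Im (z - v)) < e / 2) in B2.
      eapply Rle_lt_trans; [apply Cmod_le_ReIm |]. lra.
    + exists d. split; [apply cond_pos |]. intros z Hz Hzd. apply Hd; [| exact Hz].
      replace z with (z - 0)%C in Hzd by ring. split.
      * eapply Rle_lt_trans; [apply (re_le_Cmod (z - 0)) | exact Hzd].
      * eapply Rle_lt_trans; [apply (Im_le_Cmod (z - 0)) | exact Hzd].
  - intros H P [e HP]. destruct (H e (cond_pos e)) as [d [Hd Hz]].
    assert (Hd2 : 0 < d / 2) by lra.
    exists (mkposreal (d / 2) Hd2). intros z [B1 B2] HHz. apply HP.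
    change (Rabs (Re (z - 0)) < d / 2) in B1. change (Rabs (Im (z - 0)) < d / 2) in B2.
    assert (Q : Cmod (g z - v) < e).
    { apply Hz; [exact HHz |]. replace z with (z - 0)%C by ring.
      eapply Rle_lt_trans; [apply Cmod_le_ReIm |]. lra. }
    split.
    + eapply Rle_lt_trans; [apply (re_le_Cmod (g z - v)) | exact Q].
    + eapply Rle_lt_trans; [apply (Im_le_Cmod (g z - v)) | exact Q].
Qed.

(** * Flat functions on the half-plane *)

Lemma Re1_nz (v : C) : 0 < Re v -> v <> 0%C.
Proof. intros H ->. simpl in H. lra. Qed.

Lemma Cmod_ge_Re (v : C) : Re v <= Cmod v.
Proof. eapply Rle_trans; [apply Rle_abs | apply re_le_Cmod]. Qed.

Lemma HH_inv (v : C) : 0 < Re v -> HH (Ci * / v)%C.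
Proof.
  intros H. assert (Hz := Cnz_sq v (Re1_nz v H)). unfold HH, Ci, Cinv. simpl. unfold Re, Im in *.
  replace (0 * (- snd v / (fst v * (fst v * 1) + snd v * (snd v * 1))) +
     1 * (fst v / (fst v * (fst v * 1) + snd v * (snd v * 1))))
    with (fst v / (fst v ^ 2 + snd v ^ 2)) by (simpl; ring).
  now apply Rdiv_lt_0_compat.
Qed.

Lemma Cmod_Ci_inv (v : C) : 0 < Re v -> Cmod (Ci * / v) = / Cmod v.
Proof.
  intros H. rewrite Cmod_mult, Cmod_Ci, Cmod_inv by now apply Re1_nz. ring.
Qed.

Lemma Cmod_1_ge c y : 1 <= c -> 1 <= Cmod (c, y).
Proof. intros H. assert (Q := Cmod_ge_Re (c, y)). simpl in Q. lra. Qed.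

Lemma Cmod_1_sq y : om y = / Cmod (1, y) ^ 2.
Proof. unfold om. rewrite (Cmod2_alt (1, y)). simpl. f_equal. ring. Qed.

Lemma inv_cube_le_om y : / Cmod (1, y) ^ 3 <= om y.
Proof. assert (H := Cmod_cube_om 1 y (Rle_refl _)). lra. Qed.

Lemma cint_R_exp_param (z A : R -> C) (s K Kg : R) :
  (forall r, exists K0, cdominated (fun y => cexp (RtoC r * z y) * A y)%C K0) ->
  cdominated (fun y => cexp (RtoC s * z y) * (z y * A y))%C Kg ->
  (forall r y, Rabs (r - s) < 1 -> exp (r * Re (z y)) * (Cmod (z y) ^ 2 * Cmod (A y)) <= K * om y) ->
  rder (fun r => cint_R (fun y => cexp (RtoC r * z y) * A y)%C) s
    (cint_R (fun y => cexp (RtoC s * z y) * (z y * A y))%C).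
Proof.
  intros H0 Hg H.
  apply (cint_R_param (fun r y => cexp (RtoC r * z y) * A y)%C
     (fun r y => cexp (RtoC r * z y) * (z y * A y))%C s 1 Kg K); [lra | intros; apply H0 | exact Hg |].
  intros r y Hr.
  assert (T := taylor01 (fun t => cexp (RtoC (s + t * (r - s)) * z y) * A y)%C
      (fun t => RtoC (r - s) * z y * cexp (RtoC (s + t * (r - s)) * z y) * A y)%C
      (fun t => RtoC (r - s) * z y * (RtoC (r - s) * z y) * cexp (RtoC (s + t * (r - s)) * z y) * A y)%C
      (K * (r - s) ^ 2 * om y)).
  cbv beta in T. replace (s + 1 * (r - s)) with r in T by ring.
  replace (s + 0 * (r - s)) with s in T by ring.
  replace (RtoC (r - s) * (cexp (RtoC s * z y) * (z y * A y)))%C with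
      (RtoC (r - s) * z y * cexp (RtoC s * z y) * A y)%C by ring.
  assert (DE : forall t, rder (fun t => cexp (RtoC (s + t * (r - s)) * z y)%C) t
      (RtoC (r - s) * z y * cexp (RtoC (s + t * (r - s)) * z y))%C).
  { intros t. apply rder_cexp.
    eapply rder_eq; [apply rder_mult; [apply (rder_RtoC (fun t => s + t * (r - s)) t (r - s)) | apply rder_const] |].
    - auto_derive; [exact I | ring].
    - cbv beta. ring. }
  apply T.
  - intros t _. eapply rder_eq; [apply rder_mult; [apply DE | apply rder_const] |]. cbv beta; ring.
  - intros t _. eapply rder_eq.
    + apply rder_mult; [apply rder_mult; [apply rder_const | apply DE] | apply rder_const].
    + cbv beta; ring.
  - intros t Ht.
    assert (Hst : Rabs (s + t * (r - s) - s) < 1).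
    { replace (s + t * (r - s) - s) with (t * (r - s)) by ring. rewrite Rabs_mult, (Rabs_right t) by lra.
      assert (Q := Rabs_pos (r - s)). nra. }
    specialize (H _ y Hst).
    rewrite !Cmod_mult, Cmod_cexp, Cmod_R.
    replace (Re (RtoC (s + t * (r - s)) * z y)) with ((s + t * (r - s)) * Re (z y)) by (simpl; unfold Re; ring).
    rewrite <- (pow2_abs (r - s)).
    replace (K * Rabs (r - s) ^ 2 * om y) with (Rabs (r - s) ^ 2 * (K * om y)) by ring.
    eapply Rle_trans; [| apply Rmult_le_compat_l; [apply pow2_ge_0 | exact H]]. right. ring.
Qed.

Section Flat.

Variables (F : nat -> C -> C) (Q0 : nat -> R).
Hypothesis F_derive : forall p z, HH z ->
  is_derive (K := C_AbsRing) (V := C_NormedModule) (F p) z (F (S p) z).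
Hypothesis F_bound : forall p z, HH z -> Cmod (F p z) <= Q0 p.
Hypothesis F_flat : forall p, ext_value_at0 (F p) 0%C.

Lemma HH_scal (t : R) (z : C) : 0 < t -> HH z -> HH (RtoC t * z)%C.
Proof. unfold HH. intros Ht Hz. simpl. unfold Im in *. nra. Qed.

(** Integrate the next derivative along the ray from t0 z to z, with t0 so small that flatness makes
    F_p(t0 z) negligible; the constant K is not enlarged. *)
Lemma flat_step j K p : (forall z, HH z -> Cmod (F (S p) z) <= K * Cmod z ^ j) ->
  forall z, HH z -> Cmod (F p z) <= K * Cmod z ^ S j.
Proof.
  intros HK z Hz.
  assert (Hz0 : 0 < Cmod z) by (apply Cmod_gt_0; intros ->; unfold HH in Hz; simpl in Hz; lra).
  assert (HK0 : 0 <= K * Cmod z ^ S j).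
  { simpl. replace (K * (Cmod z * Cmod z ^ j)) with (K * Cmod z ^ j * Cmod z) by ring.
    apply Rmult_le_pos; [| lra]. eapply Rle_trans; [apply Cmod_ge_0 | now apply HK]. }
  apply le_epsilon. intros e He.
  destruct (proj1 (ext_value_eps _ _) (F_flat p) e He) as [d [Hd Hf]].
  set (t0 := Rmin (1 / 2) (d / (2 * Cmod z))).
  assert (Ht0 : 0 < t0) by (apply Rmin_pos; [lra | apply Rdiv_lt_0_compat; lra]).
  assert (Ht1 : t0 <= 1 / 2) by apply Rmin_l.
  assert (Ht2 : t0 * Cmod z < d).
  { assert (t0 <= d / (2 * Cmod z)) by apply Rmin_r.
    apply Rle_lt_trans with (d / (2 * Cmod z) * Cmod z); [apply Rmult_le_compat_r; lra |].
    replace (d / (2 * Cmod z) * Cmod z) with (d / 2) by (field; lra). lra. }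
  assert (B := mvt_cplx (fun t => F p (RtoC t * z)%C) (fun t => F (S p) (RtoC t * z) * z)%C t0 1
    (K * Cmod z ^ S j)).
  cbv beta in B. rewrite Cmult_1_l in B.
  assert (B1 : Cmod (F p z - F p (RtoC t0 * z)) <= K * Cmod z ^ S j * (1 - t0)).
  { apply B; [lra | |].
    - intros t Ht.
      assert (Hd' := cder_of_is_derive _ _ _ (F_derive p (RtoC t * z)%C (HH_scal t z ltac:(lra) Hz))).
      apply (Hd' (fun t => RtoC t * z)%C t z eq_refl).
      apply rder_ext with (fun t => 0 + RtoC t * z)%C; [intros; ring | apply rder_line].
    - intros t Ht. rewrite Cmod_mult. simpl.
      replace (K * (Cmod z * Cmod z ^ j)) with (K * Cmod z ^ j * Cmod z) by ring.
      apply Rmult_le_compat_r; [lra |].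
      assert (H1 := HK _ (HH_scal t z ltac:(lra) Hz)).
      eapply Rle_trans; [exact H1 |].
      assert (HK' : 0 <= K).
      { assert (P1 : 0 < Cmod z ^ j) by now apply pow_lt.
        assert (P2 := HK z Hz). assert (P3 := Cmod_ge_0 (F (S p) z)). nra. }
      apply Rmult_le_compat_l; [exact HK' |].
      apply pow_incr. split; [apply Cmod_ge_0 |].
      rewrite Cmod_mult, Cmod_R, Rabs_right by lra. nra. }
  assert (B2 : Cmod (F p (RtoC t0 * z)) <= e).
  { left. replace (F p (RtoC t0 * z)) with (F p (RtoC t0 * z) - 0)%C by ring.
    apply Hf; [now apply HH_scal |]. rewrite Cmod_mult, Cmod_R, Rabs_right by lra. exact Ht2. }
  replace (F p z) with ((F p z - F p (RtoC t0 * z)) + F p (RtoC t0 * z))%C by ring.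
  eapply Rle_trans; [apply Cmod_triangle |]. nra.
Qed.

(** Decay of every order at 0, hence in v after z = i/v. The constant is left unspecified and serves
    convergence only; the quantitative estimate is [flat_one]. *)
Lemma flat_order j : forall p, exists K, 0 <= K /\ forall z, HH z -> Cmod (F p z) <= K * Cmod z ^ j.
Proof.
  induction j as [|j IH]; intros p.
  - exists (Rabs (Q0 p)). split; [apply Rabs_pos |]. intros z Hz. simpl. rewrite Rmult_1_r.
    eapply Rle_trans; [now apply F_bound | apply Rle_abs].
  - destruct (IH (S p)) as [K [HK H]]. exists K. split; [exact HK |]. now apply flat_step.
Qed.

(** The first-order gain keeps the constant of the next derivative; it is the source of the index p
    + 1 in the bound on V_p. *)
Lemma flat_one p z : HH z -> Cmod (F p z) <= Q0 (S p) * Cmod z.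
Proof.
  intros Hz. rewrite <- (pow_1 (Cmod z)). apply (flat_step 0); [| exact Hz].
  intros w Hw. simpl. rewrite Rmult_1_r. now apply F_bound.
Qed.

Lemma flat_inv j p : exists K, 0 <= K /\
  forall v, 1 <= Re v -> Cmod (F p (Ci * / v)) <= K * / Cmod v ^ j.
Proof.
  destruct (flat_order j p) as [K [HK H]]. exists K. split; [exact HK |]. intros v Hv.
  eapply Rle_trans; [apply H, HH_inv; lra |].
  rewrite Cmod_Ci_inv by lra. rewrite pow_inv. lra.
Qed.

Lemma cder_Finv p v : 0 < Re v ->
  cder (fun v => F p (Ci * / v)%C) v (F (S p) (Ci * / v) * (Ci * (- (1) * / v * / v)))%C.
Proof.
  intros Hv.
  apply (cder_comp (F p) (fun v => Ci * / v)%C).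
  - apply cder_of_is_derive, F_derive, HH_inv, Hv.
  - apply cder_scal. apply (cder_inv (fun v => v)); [apply cder_id | now apply Re1_nz].
Qed.

Lemma Cinv_le_1 v : 1 <= Re v -> Cmod (/ v) <= 1.
Proof.
  intros Hv. assert (H := Cmod_ge_Re v). rewrite Cmod_inv by (apply Re1_nz; lra).
  rewrite <- Rinv_1. apply Rinv_le_contravar; lra.
Qed.

(** Flatness of order 3 for F_p, F_(p+1) and F_(p+2) supplies the cubic decay required by
    [cauchy_line]; the powers of 1/v from differentiating i/v are at most 1 in modulus. *)
Lemma half_plane_C2_Finv p : half_plane_C2 (fun v => / Cmod v ^ 3) (fun v => F p (Ci * / v)%C).
Proof.
  destruct (flat_inv 3 p) as [K0 [P0 H0]]. destruct (flat_inv 3 (S p)) as [K1 [P1 H1]].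
  destruct (flat_inv 3 (S (S p))) as [K2 [P2 H2]].
  exists (fun v => F (S p) (Ci * / v) * (Ci * (- (1) * / v * / v)))%C,
    (fun v => (F (S (S p)) (Ci * / v) * (Ci * (- (1) * / v * / v))) * (Ci * (- (1) * / v * / v)) +
      F (S p) (Ci * / v) * (2 * Ci * / v * / v * / v))%C, (K0 + 2 * K1 + K2).
  intros v Hv.
  assert (Hw : 0 < / Cmod v ^ 3).
  { apply Rinv_0_lt_compat, pow_lt. assert (H := Cmod_ge_Re v). lra. }
  specialize (H0 v Hv). specialize (H1 v Hv). specialize (H2 v Hv).
  assert (Hi := Cinv_le_1 v Hv). assert (Hi0 := Cmod_ge_0 (/ v)).
  assert (I2 : Cmod (Ci * (- (1) * / v * / v)) <= 1).
  { rewrite !Cmod_mult, Cmod_Ci, Cmod_m1. nra. }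
  assert (I3 : Cmod (2 * Ci * / v * / v * / v) <= 2).
  { rewrite !Cmod_mult, Cmod_Ci. rewrite Cmod_R, Rabs_right by lra.
    assert (0 <= Cmod (/ v) * Cmod (/ v) <= 1) by nra.
    assert (0 <= Cmod (/ v) * Cmod (/ v) * Cmod (/ v) <= 1) by nra. lra. }
  assert (M1 : Cmod (F (S p) (Ci * / v) * (Ci * (- (1) * / v * / v))) <= K1 * / Cmod v ^ 3).
  { rewrite Cmod_mult. assert (H := Cmod_ge_0 (F (S p) (Ci * / v))).
    assert (H' := Cmod_ge_0 (Ci * (- (1) * / v * / v))). nra. }
  split; [| split; [| split; [| split]]].
  - apply cder_Finv; lra.
  - assert (Hv0 : v <> 0%C) by (apply Re1_nz; lra).
    assert (Di : cder (fun v => / v)%C v (- (1) * / v * / v)%C).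
    { apply (cder_inv (fun v => v)); [apply cder_id | exact Hv0]. }
    eapply cder_eq; [apply cder_mult; [apply cder_Finv; lra |] |].
    + apply cder_scal. apply cder_mult; [apply cder_scal; exact Di | exact Di].
    + cbv beta. ring.
  - nra.
  - nra.
  - eapply Rle_trans; [apply Cmod_triangle |].
    rewrite (Cmod_mult (F (S (S p)) (Ci * / v) * _)).
    assert (M2 : Cmod (F (S (S p)) (Ci * / v) * (Ci * (- (1) * / v * / v))) <= K2 * / Cmod v ^ 3).
    { rewrite Cmod_mult. assert (H := Cmod_ge_0 (F (S (S p)) (Ci * / v))).
      assert (H' := Cmod_ge_0 (Ci * (- (1) * / v * / v))). nra. }
    assert (M3 : Cmod (F (S p) (Ci * / v) * (2 * Ci * / v * / v * / v)) <= K1 * / Cmod v ^ 3 * 2).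
    { rewrite Cmod_mult. apply Rmult_le_compat; auto using Cmod_ge_0. }
    assert (H := Cmod_ge_0 (F (S (S p)) (Ci * / v) * (Ci * (- (1) * / v * / v)))).
    assert (H' := Cmod_ge_0 (Ci * (- (1) * / v * / v))). nra.
Qed.

Lemma half_plane_C2_inv : half_plane_C2 (fun _ => 1) (fun v => / v)%C.
Proof.
  exists (fun v => - (1) * / v * / v)%C, (fun v => 2 * / v * / v * / v)%C, 2.
  intros v Hv. assert (Hv0 : v <> 0%C) by (apply Re1_nz; lra).
  assert (Di : cder (fun v => / v)%C v (- (1) * / v * / v)%C).
  { apply (cder_inv (fun v => v)); [apply cder_id | exact Hv0]. }
  assert (Hi := Cinv_le_1 v Hv). assert (Hi0 := Cmod_ge_0 (/ v)).
  split; [exact Di | split; [| split; [| split]]].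
  - eapply cder_eq; [apply cder_mult; [apply cder_scal; exact Di | exact Di] |]. cbv beta. ring.
  - lra.
  - rewrite !Cmod_mult, Cmod_m1. nra.
  - rewrite !Cmod_mult, Cmod_R, Rabs_right by lra.
    assert (0 <= Cmod (/ v) * Cmod (/ v) <= 1) by nra.
    assert (0 <= Cmod (/ v) * Cmod (/ v) * Cmod (/ v) <= 1) by nra. lra.
Qed.

(** * The integrals V_p and their Bessel relation *)

Definition bromwich_term (k p : nat) (s y : R) : C :=
  (cexp (RtoC s * (1, y)) * (/ (1, y)) ^ k * F p (Ci * / (1, y)))%C.

(** The measure is dy, without the factor 1/(2 pi) of an inverse Laplace transform. Differentiation
    in s lowers k by one: k = 1 is V_p, k = 0 is its derivative, and k = 2 at index p + 1 is s V_p'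
    up to the factor i. *)
Definition bromwich (k p : nat) (s : R) : C := cint_R (bromwich_term k p s).

Lemma rder_vpow k y : rder (fun y => ((/ (1, y)) ^ k)%C) y (- RtoC (INR k) * Ci * (/ (1, y)) ^ S k)%C.
Proof.
  assert (Hz : ((1, y) : C) <> 0%C) by (apply Re1_nz; simpl; lra).
  assert (Di := rder_inv _ _ _ (rder_vert 1 y) Hz).
  induction k as [|k IH].
  - simpl. eapply rder_eq; [apply rder_const |]. ring.
  - eapply rder_eq.
    + apply (rder_mult (fun y => / (1, y))%C (fun y => (/ (1, y)) ^ k)%C); [exact Di | exact IH].
    + rewrite S_INR, RtoC_plus, !Cpow_S. ring.
Qed.

Lemma bromwich_term_derive k p s y :
  rder (bromwich_term k p s) y (Ci * (RtoC s * bromwich_term k p s y - RtoC (INR k) * bromwich_term (S k) p s y) + bromwich_term (S (S k)) (S p) s y)%C.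
Proof.
  assert (D1 : rder (fun y => cexp (RtoC s * (1, y))%C) y (RtoC s * Ci * cexp (RtoC s * (1, y)))%C).
  { apply rder_cexp, rder_scal, rder_vert. }
  assert (D3 : rder (fun y => F p (Ci * / (1, y))%C) y
     (F (S p) (Ci * / (1, y)) * (Ci * (- (1) * / (1, y) * / (1, y))) * Ci)%C).
  { apply (cder_Finv p (1, y) ltac:(simpl; lra) (fun y => (1, y)) y Ci eq_refl), rder_vert. }
  unfold bromwich_term. eapply rder_eq; [apply rder_mult; [apply rder_mult; [exact D1 | apply rder_vpow] | exact D3] |].
  cbv beta. rewrite !Cpow_S.
  replace (F (S p) (Ci * / (1, y)) * (Ci * (- (1) * / (1, y) * / (1, y))) * Ci)%C with
    (F (S p) (Ci * / (1, y)) * (- (Ci * Ci)) * (/ (1, y) * / (1, y)))%C by ring.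
  replace (- (Ci * Ci))%C with (RtoC 1) by (apply C_ext; simpl; ring). ring.
Qed.

Lemma Cmod_bromwich_term k p s y : Cmod (bromwich_term k p s y) = exp s * (/ Cmod (1, y)) ^ k * Cmod (F p (Ci * / (1, y))).
Proof.
  unfold bromwich_term. rewrite !Cmod_mult, Cmod_cexp, Cmod_pow, Cmod_inv by (apply Re1_nz; simpl; lra).
  f_equal. f_equal. f_equal. simpl. ring.
Qed.

Lemma inv_pow_le_1 k y : 0 <= (/ Cmod (1, y)) ^ k <= 1.
Proof.
  assert (H := Cmod_1_ge 1 y (Rle_refl _)).
  assert (0 <= / Cmod (1, y) <= 1).
  { split; [left; apply Rinv_0_lt_compat; lra |]. apply Rle_trans with (/ 1); [apply Rinv_le_contravar; lra | lra]. }
  split; [now apply pow_le |].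
  assert (Q := pow_incr (/ Cmod (1, y)) 1 k H0). now rewrite pow1 in Q.
Qed.

Lemma cdominated_bromwich_term k p s : exists K, cdominated (bromwich_term k p s) K.
Proof.
  destruct (flat_inv 2 p) as [K [HK H]]. exists (exp s * K). split.
  - intros y. eapply rder_cont, bromwich_term_derive.
  - intros y. rewrite Cmod_bromwich_term, !Rmult_assoc, Cmod_1_sq.
    apply Rmult_le_compat_l; [left; apply exp_pos |].
    assert (H1 := inv_pow_le_1 k y). specialize (H (1, y) ltac:(simpl; lra)).
    assert (H2 := Cmod_ge_0 (F p (Ci * / (1, y)))). nra.
Qed.

Lemma bromwich_term_mul k p s y : ((1, y) * bromwich_term (S k) p s y)%C = bromwich_term k p s y.
Proof.
  assert (Hz : ((1, y) : C) <> 0%C) by (apply Re1_nz; simpl; lra).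
  unfold bromwich_term. rewrite Cpow_S.
  transitivity (((1, y) * / (1, y)) * (cexp (RtoC s * (1, y)) * (/ (1, y)) ^ k * F p (Ci * / (1, y))))%C; [ring |].
  rewrite Cinv_r by exact Hz. ring.
Qed.

Lemma bromwich_derive k p s : rder (bromwich (S k) p) s (bromwich k p s).
Proof.
  (* Order 4: two differentiations in s bring in |v|^2, which leaves |v|^(-2) = om. *)
  destruct (flat_inv 4 p) as [K [HK H]]. destruct (cdominated_bromwich_term k p s) as [Kg Hg].
  set (A := fun y : R => ((/ (1, y)) ^ S k * F p (Ci * / (1, y)))%C).
  assert (EG : forall r y, bromwich_term (S k) p r y = (cexp (RtoC r * (1, y)) * A y)%C) by (intros; unfold bromwich_term, A; ring).
  assert (EG0 : forall y, bromwich_term k p s y = (cexp (RtoC s * (1, y)) * ((1, y) * A y))%C).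
  { intros y. rewrite <- bromwich_term_mul, EG. ring. }
  apply rder_ext with (fun r => cint_R (fun y => cexp (RtoC r * (1, y)) * A y)%C).
  { intros r. apply cint_R_ext. intros y. now rewrite EG. }
  replace (bromwich k p s) with (cint_R (fun y => cexp (RtoC s * (1, y)) * ((1, y) * A y))%C).
  2: { apply cint_R_ext. intros y. now rewrite EG0. }
  apply (cint_R_exp_param (fun y => (1, y)) A s (exp (Rabs s + 1) * K) Kg).
  - intros r. destruct (cdominated_bromwich_term (S k) p r) as [K0 [C0 B0]]. exists K0. split.
    + intros y. apply ccont_ext with (bromwich_term (S k) p r); [intros; apply EG | apply C0].
    + intros y. rewrite <- EG. apply B0.
  - destruct Hg as [C0 B0]. split.
    + intros y. apply ccont_ext with (bromwich_term k p s); [intros; apply EG0 | apply C0].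
    + intros y. rewrite <- EG0. apply B0.
  - intros r y Hr. set (z := ((1, y) : C)). unfold A. fold z.
    rewrite Cmod_mult, Cmod_pow, Cmod_inv by (apply Re1_nz; simpl; lra).
    specialize (H z ltac:(simpl; lra)).
    assert (Hz : 1 <= Cmod z) by (apply Cmod_1_ge; lra).
    replace (r * Re z) with r by (unfold z; simpl; ring).
    assert (E1 : exp r <= exp (Rabs s + 1)).
    { assert (Hx : r <= Rabs s + 1).
      { assert (Q1 := Rle_abs s). assert (Q2 := Rle_abs (r - s)). lra. }
      destruct Hx as [Hx | ->]; [left; now apply exp_increasing | right; reflexivity]. }
    rewrite Cmod_1_sq. fold z.
    assert (Hk := inv_pow_le_1 (S k) y). fold z in Hk.
    replace (exp (Rabs s + 1) * K * / Cmod z ^ 2) with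
        (exp (Rabs s + 1) * (Cmod z ^ 2 * (1 * (K * / Cmod z ^ 4)))) by (field; lra).
    apply Rmult_le_compat; [left; apply exp_pos | | exact E1 |].
    + apply Rmult_le_pos; [apply pow2_ge_0 |]. apply Rmult_le_pos; [apply Hk | apply Cmod_ge_0].
    + apply Rmult_le_compat_l; [apply pow2_ge_0 |].
      apply Rmult_le_compat; [apply Hk | apply Cmod_ge_0 | apply Hk | exact H].
Qed.

(** Integration by parts in y for k = 0. As [bromwich 0 p] is the derivative of V_p and
    [bromwich 1 (S p)] that of [bromwich 2 (S p)], the identity encodes (s V_p')' = i V_(p+1), the
    Bessel operator in the variable s. *)
Lemma bromwich_parts p s : (RtoC s * bromwich 0 p s)%C = (Ci * bromwich 2 (S p) s)%C.
Proof.
  destruct (cdominated_bromwich_term 0 p s) as [K0 H0]. destruct (cdominated_bromwich_term 2 (S p) s) as [K2 H2].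
  assert (E : cint_R (fun y => (Ci * RtoC s) * bromwich_term 0 p s y + bromwich_term 2 (S p) s y)%C = 0%C).
  { eapply cint_R_derive; [exact H0 | apply cdominated_plus; [apply cdominated_scal; exact H0 | exact H2] |].
    intros y. eapply rder_eq; [apply bromwich_term_derive |]. simpl INR. ring. }
  rewrite (cint_R_plus _ _ _ _ (cdominated_scal (Ci * RtoC s)%C _ _ H0) H2), (cint_R_scal _ _ _ H0) in E.
  fold (bromwich 0 p s) (bromwich 2 (S p) s) in E.
  assert (E2 : (- Ci * (Ci * RtoC s * bromwich 0 p s + bromwich 2 (S p) s))%C = 0%C) by (rewrite E; ring).
  replace (- Ci * (Ci * RtoC s * bromwich 0 p s + bromwich 2 (S p) s))%C with
    (- (Ci * Ci) * (RtoC s * bromwich 0 p s) - Ci * bromwich 2 (S p) s)%C in E2 by ring.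
  replace (- (Ci * Ci))%C with (RtoC 1) in E2 by (apply C_ext; simpl; ring).
  rewrite Cmult_1_l in E2.
  replace (RtoC s * bromwich 0 p s)%C with ((RtoC s * bromwich 0 p s - Ci * bromwich 2 (S p) s) + Ci * bromwich 2 (S p) s)%C by ring.
  rewrite E2. ring.
Qed.

(** At s = 0 the exponential disappears and the integrand has cubic decay on the whole half-plane,
    so Cauchy's theorem applies. *)
Lemma bromwich_at_0 p : bromwich 1 p 0 = 0%C.
Proof.
  unfold bromwich. rewrite (cint_R_ext _ (fun y => (/ (1, y)) * F p (Ci * / (1, y)))%C).
  - apply (cauchy_line (fun v => / v * F p (Ci * / v))%C). apply half_plane_C2_mult; [| apply half_plane_C2_inv | apply half_plane_C2_Finv].
    intros v Hv. left. apply Rinv_0_lt_compat, pow_lt. assert (H := Cmod_ge_Re v). lra.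
  - intros y. unfold bromwich_term. simpl Cpow. replace (RtoC 0 * (1, y))%C with (RtoC 0) by ring. rewrite cexp_0. ring.
Qed.

(** One factor 1/v comes from k = 1 and one from [flat_one], together |v|^(-2) = om; on the line
    |e^(sv)| = e^s, and 8 is the constant of [cint_R_bound]. *)
Lemma bromwich_bound p s : Cmod (bromwich 1 p s) <= 8 * (exp s * Q0 (S p)).
Proof.
  apply cint_R_bound. split; [intros; eapply rder_cont, bromwich_term_derive |].
  intros y. rewrite Cmod_bromwich_term, Rmult_assoc, Cmod_1_sq, !Rmult_assoc.
  apply Rmult_le_compat_l; [left; apply exp_pos |].
  assert (H := flat_one p (Ci * / (1, y))%C (HH_inv (1, y) ltac:(simpl; lra))).
  rewrite Cmod_Ci_inv in H by (simpl; lra).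
  assert (H1 := inv_pow_le_1 1 y). rewrite pow_1 in *.
  replace (Q0 (S p) * / Cmod (1, y) ^ 2) with (/ Cmod (1, y) * (Q0 (S p) * / Cmod (1, y))).
  - apply Rmult_le_compat_l; lra.
  - field. assert (Hz := Cmod_1_ge 1 y (Rle_refl _)). lra.
Qed.

Hypothesis Q0_pos : forall p, 0 < Q0 p.
Hypothesis Q0_lc : forall p, Q0 (S p) / Q0 p <= Q0 (S (S p)) / Q0 (S p).
Hypothesis Q0_div : is_lim_seq (sum_n (fun p => / sqrt (Q0 (S (S p)) / Q0 (S p)))) p_infty.

Lemma bromwich_zero s : 0 <= s -> bromwich 1 0 s = 0%C.
Proof.
  intros Hs.
  assert (W : forall (L : C -> R), (forall g t l, rder g t l -> is_derive (fun x => L (g x)) t (L l)) ->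
    (forall z, Rabs (L z) <= Cmod z) -> (forall (a : R) z, L (RtoC a * z)%C = a * L z) ->
    L (bromwich 1 0 s) = 0).
  { intros L Ld Lb Ll.
    set (T := 2 * sqrt s). assert (Hq := sqrt_pos s).
    assert (HT : T ^ 2 / 4 = s).
    { unfold T. replace ((2 * sqrt s) ^ 2 / 4) with (sqrt s * sqrt s) by field. now apply sqrt_sqrt. }
    (* The powers of i absorb the multiple in the Bessel relation, so that (t x_p')' = t x_(p+1)
       holds exactly. [w p] is t x_p' rewritten by [bromwich_parts]; L is the real or the imaginary
       part. *)
    set (x := fun p t => L (Ci ^ p * bromwich 1 p (t ^ 2 / 4))%C).
    set (w := fun p t => L (2 * (Ci ^ S p) * bromwich 2 (S p) (t ^ 2 / 4))%C).
    assert (Dq : forall t, is_derive (fun t => t ^ 2 / 4) t (t / 2)).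
    { intros t. auto_derive; [exact I | field]. }
    assert (L0 : L 0%C = 0).
    { replace (RtoC 0) with (RtoC 0 * 0)%C by ring. rewrite Ll. ring. }
    assert (Z : x 0%nat T = 0).
    { apply (bang x w (fun p => 8 * exp s * Q0 (S p)) T).
      - intros p t Ht.
        eapply is_derive_eq.
        + unfold x. apply Ld. apply rder_scal. apply (rder_comp (bromwich 1 p) (fun t => t ^ 2 / 4)); [apply bromwich_derive | apply Dq].
        + unfold w. destruct (Req_dec t 0) as [-> | Ht0].
          * replace (0 / 2) with 0 by field.
            replace (Ci ^ p * (RtoC 0 * bromwich 0 p (0 ^ 2 / 4)))%C with (RtoC 0) by ring. rewrite L0.
            unfold Rdiv. rewrite Rinv_0. ring.
          * replace (2 * Ci ^ S p * bromwich 2 (S p) (t ^ 2 / 4))%C with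
              (RtoC t * (Ci ^ p * (RtoC (t / 2) * bromwich 0 p (t ^ 2 / 4))))%C.
            -- rewrite Ll. field. exact Ht0.
            -- rewrite Cpow_S.
               replace (2 * (Ci * Ci ^ p) * bromwich 2 (S p) (t ^ 2 / 4))%C with
                 (2 * Ci ^ p * (Ci * bromwich 2 (S p) (t ^ 2 / 4)))%C by ring.
               rewrite <- bromwich_parts.
               replace (RtoC (t ^ 2 / 4)) with (RtoC (1 / 2) * RtoC t * RtoC (t / 2))%C
                 by (rewrite <- !RtoC_mult; f_equal; field).
               replace (2 * Ci ^ p * (RtoC (1 / 2) * RtoC t * RtoC (t / 2) * bromwich 0 p (t ^ 2 / 4)))%C with
                 ((RtoC 2 * RtoC (1 / 2)) * (RtoC t * (Ci ^ p * (RtoC (t / 2) * bromwich 0 p (t ^ 2 / 4)))))%C by ring.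
               rewrite <- RtoC_mult. replace (2 * (1 / 2)) with 1 by field. ring.
      - intros p t Ht. eapply is_derive_eq.
        + unfold w. apply Ld. apply rder_scal. apply (rder_comp (bromwich 2 (S p)) (fun t => t ^ 2 / 4)); [apply bromwich_derive | apply Dq].
        + unfold x. rewrite <- Ll. f_equal.
          replace (RtoC (t / 2)) with (RtoC t * RtoC (1 / 2))%C by (rewrite <- RtoC_mult; f_equal; field).
          replace (2 * Ci ^ S p * (RtoC t * RtoC (1 / 2) * bromwich 1 (S p) (t ^ 2 / 4)))%C with
            ((RtoC 2 * RtoC (1 / 2)) * (RtoC t * (Ci ^ S p * bromwich 1 (S p) (t ^ 2 / 4))))%C by ring.
          rewrite <- RtoC_mult. replace (2 * (1 / 2)) with 1 by field. ring.
      - intros p. unfold x. replace (0 ^ 2 / 4) with 0 by field. rewrite bromwich_at_0, Cmult_0_r. exact L0.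
      - intros p. unfold w. replace (0 ^ 2 / 4) with 0 by field.
        rewrite Cpow_S.
        replace (2 * (Ci * Ci ^ p) * bromwich 2 (S p) 0)%C with (2 * Ci ^ p * (Ci * bromwich 2 (S p) 0))%C by ring.
        rewrite <- bromwich_parts. replace (2 * Ci ^ p * (0 * bromwich 0 p 0))%C with (RtoC 0) by ring. exact L0.
      - intros p. assert (H := Q0_pos (S p)). assert (H' := exp_pos s). nra.
      - intros p. assert (H' := exp_pos s). assert (H1 := Q0_pos (S p)). assert (H2 := Q0_pos (S (S p))).
        replace (8 * exp s * Q0 (S (S p)) / (8 * exp s * Q0 (S p))) with (Q0 (S (S p)) / Q0 (S p)) by (field; lra).
        replace (8 * exp s * Q0 (S (S (S p))) / (8 * exp s * Q0 (S (S p)))) with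
          (Q0 (S (S (S p))) / Q0 (S (S p))) by (field; lra).
        apply Q0_lc.
      - intros p t Ht. unfold x. eapply Rle_trans; [apply Lb |].
        rewrite Cmod_mult, Cmod_pow, Cmod_Ci, pow1, Rmult_1_l.
        eapply Rle_trans; [apply bromwich_bound |]. rewrite Rmult_assoc. apply Rmult_le_compat_l; [lra |].
        apply Rmult_le_compat_r; [left; apply Q0_pos |].
        assert (Hts : t ^ 2 / 4 <= s) by (rewrite <- HT; nra).
        destruct Hts as [Hts | ->]; [left; now apply exp_increasing | right; reflexivity].
      - eapply is_lim_seq_ext; [| exact Q0_div]. intros n. apply sum_n_ext. intros p.
        assert (H' := exp_pos s). assert (H1 := Q0_pos (S p)). f_equal. f_equal. field. lra.
      - unfold T. lra. }
    unfold x in Z. rewrite HT in Z. rewrite <- Z. f_equal. simpl. ring. }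
  apply C_ext; simpl.
  - apply (W Re).
    + intros g t l [H _]; exact H.
    + apply re_le_Cmod.
    + intros; simpl; unfold Re; ring.
  - apply (W Im).
    + intros g t l [_ H]; exact H.
    + apply Im_le_Cmod.
    + intros; simpl; unfold Im; ring.
Qed.

(** The Poisson kernel is half the difference of 1/(v - vm) and 1/(v - ve), where ve and vm are
    mirror images in the line Re v = 1. The integral with vm vanishes by holomorphy, the one with ve
    because V_0 = 0. *)
Lemma F_zero_circle y0 : F 0%nat (Ci * / (1, y0)) = 0%C.
Proof.
  destruct (flat_inv 3 0) as [K [HK HF3]].
  set (Phi := fun y : R => (/ (1, y) * F 0%nat (Ci * / (1, y)))%C).
  assert (HPhi : forall y, bromwich_term 1 0 0 y = Phi y).
  { intros y. unfold bromwich_term, Phi. simpl Cpow. replace (RtoC 0 * (1, y))%C with (RtoC 0) by ring. rewrite cexp_0. ring. }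
  assert (BPhi : forall y, Cmod (Phi y) <= K * / Cmod (1, y) ^ 4).
  { intros y. unfold Phi. assert (Hz := Cmod_1_ge 1 y (Rle_refl _)).
    rewrite Cmod_mult, Cmod_inv by (apply Re1_nz; simpl; lra).
    specialize (HF3 (1, y) ltac:(simpl; lra)).
    replace (K * / Cmod (1, y) ^ 4) with (/ Cmod (1, y) * (K * / Cmod (1, y) ^ 3)) by (field; lra).
    apply Rmult_le_compat_l; [left; apply Rinv_0_lt_compat; lra | exact HF3]. }
  assert (BPhi2 : forall y, Cmod (Phi y) * Cmod (1, y) <= K * om y).
  { intros y. assert (Hz := Cmod_1_ge 1 y (Rle_refl _)).
    apply Rle_trans with (K * / Cmod (1, y) ^ 3); [| apply Rmult_le_compat_l; [exact HK | apply inv_cube_le_om]].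
    replace (K * / Cmod (1, y) ^ 3) with (K * / Cmod (1, y) ^ 4 * Cmod (1, y)) by (field; lra).
    apply Rmult_le_compat_r; [lra | apply BPhi]. }
  assert (DPhi : cdominated Phi K).
  { split.
    - intros y. apply ccont_ext with (bromwich_term 1 0 0); [exact HPhi |]. eapply rder_cont, bromwich_term_derive.
    - intros y. eapply Rle_trans; [| apply BPhi2]. assert (Hz := Cmod_1_ge 1 y (Rle_refl _)).
      assert (H := Cmod_ge_0 (Phi y)). nra. }
  assert (PI0 : forall e, 0 < e -> cint_R (fun y => RtoC (e / (e ^ 2 + (y - y0) ^ 2)) * Phi y)%C = 0%C).
  { intros e He.
    set (D := fun y : R => ((- e, y - y0) : C)).
    set (ve := ((1 + e, y0) : C)). set (vm := ((1 - e, y0) : C)).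
    assert (D_nz : forall y, D y <> 0%C).
    { intros y E. apply (f_equal Re) in E. simpl in E. lra. }
    assert (De : forall y, e <= Cmod (D y)).
    { intros y. assert (H := re_le_Cmod (D y)). simpl in H. rewrite Rabs_left in H; lra. }
    assert (Dd : forall y, rder D y Ci).
    { intros y. split; simpl; [apply @is_derive_const |]. auto_derive; [exact I | ring]. }
    assert (DI : forall y, ccont (fun y => / D y)%C y).
    { intros y. eapply rder_cont. apply rder_inv; [apply Dd | apply D_nz]. }
    set (A := fun y => (Phi y * / D y)%C).
    assert (CE : forall r y, ccont (fun y => cexp (RtoC r * D y)) y).
    { intros r y. eapply rder_cont. apply rder_cexp, rder_scal, Dd. }
    assert (CA : forall y, ccont A y).
    { intros y. apply ccont_mult; [apply DPhi | apply DI]. }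
    assert (BA : forall y, Cmod (A y) <= K / e * om y).
    { intros y. unfold A. rewrite Cmod_mult, Cmod_inv by apply D_nz.
      replace (K / e * om y) with (K * om y * / e) by (unfold Rdiv; ring).
      apply Rmult_le_compat; [apply Cmod_ge_0 | left; apply Rinv_0_lt_compat; specialize (De y); lra | apply DPhi |].
      apply Rinv_le_contravar; [exact He | apply De]. }
    assert (BE : forall r y, Cmod (cexp (RtoC r * D y)) = exp (- r * e)).
    { intros r y. rewrite Cmod_cexp. f_equal. simpl. ring. }
    assert (DM : forall r, cdominated (fun y => cexp (RtoC r * D y) * A y)%C (exp (- r * e) * (K / e))).
    { intros r. split.
      - intros y. apply ccont_mult; [apply CE | apply CA].
      - intros y. rewrite Cmod_mult, BE, Rmult_assoc.
        apply Rmult_le_compat_l; [left; apply exp_pos | apply BA]. }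
    assert (EA : forall y, (D y * A y)%C = Phi y).
    { intros y. unfold A. transitivity ((D y * / D y) * Phi y)%C; [ring |]. rewrite Cinv_r by apply D_nz. ring. }
    assert (DG : forall r, cdominated (fun y => cexp (RtoC r * D y) * (D y * A y))%C (exp (- r * e) * K)).
    { intros r. split.
      - intros y. apply ccont_mult; [apply CE |]. apply ccont_ext with Phi; [intros; now rewrite EA | apply DPhi].
      - intros y. rewrite EA, Cmod_mult, BE, Rmult_assoc.
        apply Rmult_le_compat_l; [left; apply exp_pos | apply DPhi]. }
    (* This replaces the Laplace transform of V_0 as a double integral: M'(r) = e^(-r ve) V_0(r) =
       0, and |M(r)| is at most a constant times e^(-re). Hence M = 0 for r >= 0, and M(0) is the
       integral of Phi / (v - ve). *)
    set (M := fun r => cint_R (fun y => cexp (RtoC r * D y) * A y)%C).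
    assert (M' : forall r, 0 <= r -> rder M r 0%C).
    { intros r Hr. eapply rder_eq.
      - apply (cint_R_exp_param D A r (exp ((Rabs r + 1) * e) * ((Cmod ve + 1) * K)) (exp (- r * e) * K)).
        + intros r'. eexists. apply DM.
        + apply DG.
        + intros r' y Hr'.
          replace (Cmod (D y) ^ 2 * Cmod (A y)) with (Cmod (D y) * Cmod (Phi y)).
          2: { rewrite <- EA, Cmod_mult. ring. }
          rewrite Rmult_assoc. apply Rmult_le_compat; [left; apply exp_pos | | |].
          * apply Rmult_le_pos; apply Cmod_ge_0.
          * assert (Hx : r' * Re (D y) <= (Rabs r + 1) * e).
            { simpl. assert (Q1 := Rle_abs (r - r')). assert (Q2 := Rle_abs (- r)). rewrite Rabs_Ropp in Q2.
              rewrite Rabs_minus_sym in Hr'. nra. }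
            destruct Hx as [Hx | ->]; [left; now apply exp_increasing | right; reflexivity].
          * rewrite Rmult_assoc. eapply Rle_trans; [| apply Rmult_le_compat_l; [| apply (BPhi2 y)]].
            -- replace (D y) with ((1, y) - ve)%C by (apply C_ext; simpl; ring).
               assert (Q := Cmod_triangle (1, y) (- ve)). rewrite Cmod_opp in Q.
               assert (Hz := Cmod_1_ge 1 y (Rle_refl _)). assert (Q2 := Cmod_ge_0 ve).
               replace ((Cmod ve + 1) * (Cmod (Phi y) * Cmod (1, y))) with
                 (((Cmod ve + 1) * Cmod (1, y)) * Cmod (Phi y)) by ring.
               apply Rmult_le_compat_r; [apply Cmod_ge_0 |].
               eapply Rle_trans; [exact Q |]. nra.
            -- assert (Q2 := Cmod_ge_0 ve). lra.
      - rewrite (cint_R_ext _ (fun y => cexp (- RtoC r * ve) * bromwich_term 1 0 r y)%C).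
        + destruct (cdominated_bromwich_term 1 0 r) as [Kr Hg]. rewrite (cint_R_scal _ _ _ Hg).
          fold (bromwich 1 0 r). rewrite bromwich_zero by exact Hr. ring.
        + intros y. rewrite EA. unfold bromwich_term, Phi. simpl Cpow.
          replace (RtoC r * D y)%C with (- RtoC r * ve + RtoC r * (1, y))%C
            by (apply C_ext; simpl; ring).
          rewrite cexp_plus. ring. }
    assert (Mc : forall r, 0 <= r -> M r = M 0).
    { intros r Hr. assert (B := mvt_cplx M (fun _ => 0%C) 0 r 0 Hr).
      assert (B' : Cmod (M r - M 0) <= 0 * (r - 0)).
      { apply B; [intros; apply M'; lra | intros; rewrite Cmod_0; lra]. }
      assert (Q := Cmod_ge_0 (M r - M 0)).
      replace (M r) with ((M r - M 0) + M 0)%C by ring.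
      rewrite (Cmod_eq_0 (M r - M 0)) by lra. ring. }
    assert (M0 : cint_R A = 0%C).
    { assert (E : cint_R A = M 0).
      { apply cint_R_ext. intros y. replace (RtoC 0 * D y)%C with (RtoC 0) by ring. rewrite cexp_0. ring. }
      rewrite E. apply Cmod_eq_0. apply Rle_antisym; [| apply Cmod_ge_0].
      apply le_epsilon. intros d Hd. rewrite Rplus_0_l.
      set (L := 8 * (K / e)). assert (HL : 0 <= L).
      { unfold L. assert (0 <= K / e); [| lra]. apply Rmult_le_pos; [exact HK | left; now apply Rinv_0_lt_compat]. }
      set (r := L / (d * e)).
      assert (Hr : 0 <= r) by (apply Rmult_le_pos; [exact HL | left; apply Rinv_0_lt_compat; nra]).
      rewrite <- (Mc r Hr). eapply Rle_trans; [apply (cint_R_bound _ _ (DM r)) |].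
      replace (- r * e) with (- (r * e)) by ring. rewrite exp_Ropp.
      replace (8 * (/ exp (r * e) * (K / e))) with (L * / exp (r * e)) by (unfold L; ring).
      assert (Q := exp_ineq1_le (r * e)).
      replace (r * e) with (L / d) in * by (unfold r; field; lra).
      apply Rmult_le_reg_r with (exp (L / d)); [apply exp_pos |].
      rewrite Rmult_assoc, Rinv_l, Rmult_1_r by (apply Rgt_not_eq, exp_pos).
      apply Rle_trans with (d * (1 + L / d)); [| apply Rmult_le_compat_l; lra].
      replace (d * (1 + L / d)) with (d + L) by (field; lra). lra. }
    (* the reflected point [vm] lies outside the half-plane, so Cauchy applies to it *)
    assert (C1 : cint_R (fun y => / ((1, y) - vm) * Phi y)%C = 0%C).
    { apply (cauchy_line (fun v => / (v - vm) * (/ v * F 0%nat (Ci * / v)))%C).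
      assert (Wp : forall v : C, 1 <= Re v -> 0 <= / Cmod v ^ 3).
      { intros v Hv. left. apply Rinv_0_lt_compat, pow_lt. assert (H := Cmod_ge_Re v). lra. }
      apply half_plane_C2_mult; [exact Wp | | apply half_plane_C2_mult; [exact Wp | apply half_plane_C2_inv | apply half_plane_C2_Finv]].
      exists (fun v => - (1) * / (v - vm) * / (v - vm))%C,
        (fun v => 2 * / (v - vm) * / (v - vm) * / (v - vm))%C,
        (/ e + / e * / e + 2 * / e * / e * / e).
      intros v Hv. set (q := (v - vm)%C).
      assert (Hq : e <= Re q) by (unfold q; simpl; unfold Re in *; lra).
      assert (Hq0 : q <> 0%C) by (apply Re1_nz; lra).
      assert (Hie : 0 < / e) by now apply Rinv_0_lt_compat.
      assert (Hqe : Cmod (/ q) <= / e).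
      { rewrite Cmod_inv by exact Hq0. apply Rinv_le_contravar; [exact He |].
        assert (H := Cmod_ge_Re q). lra. }
      assert (Hqp := Cmod_ge_0 (/ q)).
      assert (Di : cder (fun v => / (v - vm))%C v (- (1) * / q * / q)%C).
      { apply (cder_inv (fun v => v - vm)%C); [| exact Hq0].
        eapply cder_eq; [apply cder_plus; [apply cder_id | apply cder_const] | ring]. }
      split; [exact Di | split; [| split; [| split]]].
      - eapply cder_eq; [apply cder_mult; [apply cder_scal; exact Di | exact Di] |]. cbv beta. fold q. ring.
      - assert (0 < / e * / e) by nra. assert (0 < / e * / e * / e) by nra. lra.
      - rewrite !Cmod_mult, Cmod_m1. assert (0 < / e * / e) by nra. assert (0 < / e * / e * / e) by nra.
        assert (Cmod (/ q) * Cmod (/ q) <= / e * / e) by (apply Rmult_le_compat; lra). lra.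
      - rewrite !Cmod_mult, Cmod_R, Rabs_right by lra. assert (0 < / e * / e) by nra.
        assert (Cmod (/ q) * Cmod (/ q) <= / e * / e) by (apply Rmult_le_compat; lra).
        assert (0 <= Cmod (/ q) * Cmod (/ q)) by nra.
        assert (Cmod (/ q) * Cmod (/ q) * Cmod (/ q) <= / e * / e * / e) by (apply Rmult_le_compat; lra). lra. }
    assert (D1 : cdominated (fun y => / ((1, y) - vm) * Phi y)%C (K / e)).
    { assert (Hnz : forall y, ((1, y) - vm)%C <> 0%C) by (intros; apply Re1_nz; simpl; lra).
      split.
      - intros y. apply ccont_mult; [| apply DPhi].
        eapply rder_cont. apply rder_inv; [| apply Hnz].
        apply rder_minus; [apply rder_vert | apply rder_const].
      - intros y. rewrite Cmod_mult, Cmod_inv by apply Hnz.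
        replace (K / e * om y) with (/ e * (K * om y)) by (unfold Rdiv; ring).
        apply Rmult_le_compat; [| apply Cmod_ge_0 | | apply DPhi].
        + left. apply Rinv_0_lt_compat. apply Cmod_gt_0, Hnz.
        + apply Rinv_le_contravar; [exact He |].
          assert (H := Cmod_ge_Re ((1, y) - vm)). simpl in H. lra. }
    rewrite (cint_R_ext _ (fun y => RtoC (1 / 2) * (/ ((1, y) - vm) * Phi y + - (1) * A y))%C).
    - assert (DA : cdominated A (K / e)) by (split; assumption).
      rewrite (cint_R_scal _ _ _ (cdominated_plus _ _ _ _ D1 (cdominated_scal (- (1))%C _ _ DA))).
      rewrite (cint_R_plus _ _ _ _ D1 (cdominated_scal (- (1))%C _ _ DA)), (cint_R_scal _ _ _ DA), C1, M0. ring.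
    - intros y. unfold A.
      replace (RtoC (1 / 2) * (/ ((1, y) - vm) * Phi y + - (1) * (Phi y * / D y)))%C with
        ((RtoC (1 / 2) * (/ ((1, y) - vm) - / D y)) * Phi y)%C by ring.
      f_equal. unfold D. assert (0 < e ^ 2) by now apply pow_lt. assert (Hq := pow2_ge_0 (y - y0)).
      apply C_ext; simpl; field; simpl in *; lra. }
  assert (Z : Phi y0 = 0%C).
  { apply C_ext; simpl.
    - apply (poisson_unique (fun y => Re (Phi y)) K); [apply cdominated_re, DPhi |].
      intros e He. assert (E := f_equal Re (PI0 e He)). unfold cint_R in E. simpl in E. etransitivity; [| exact E].
      apply int_R_ext. intros y. unfold Re. simpl. ring.
    - apply (poisson_unique (fun y => Im (Phi y)) K); [apply cdominated_im, DPhi |].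
      intros e He. assert (E := f_equal Im (PI0 e He)). unfold cint_R in E. simpl in E. etransitivity; [| exact E].
      apply int_R_ext. intros y. unfold Im. simpl. ring. }
  unfold Phi in Z. assert (Hz : ((1, y0) : C) <> 0%C) by (apply Re1_nz; simpl; lra).
  replace (F 0%nat (Ci * / (1, y0))) with ((1, y0) * (/ (1, y0) * F 0%nat (Ci * / (1, y0))))%C.
  - rewrite Z. ring.
  - rewrite Cmult_assoc, Cinv_r by exact Hz. ring.
Qed.

End Flat.

Lemma weight_seq_quot N p : weight_seq N -> quot N p <= quot N (S p).
Proof.
  intros [Hp [Hc _]]. specialize (Hc (S p) ltac:(lia)). replace (S p - 1)%nat with p in Hc by lia.
  assert (H0 := Hp p). assert (H1 := Hp (S p)). unfold quot.
  apply Rmult_le_reg_r with (N p * N (S p)); [nra |].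
  replace (N (S p) / N p * (N p * N (S p))) with (N (S p) ^ 2) by (field; lra).
  replace (N (S (S p)) / N (S p) * (N p * N (S p))) with (N p * N (S (S p))) by (field; lra). exact Hc.
Qed.

Lemma quot_pos N p : (forall p, 0 < N p) -> 0 < quot N p.
Proof. intros H. apply Rdiv_lt_0_compat; apply H. Qed.

Lemma is_Cderive_scaled (f : C -> C) (a : C) (lam : R) (z l : C) : 0 < lam ->
  is_derive (K := C_AbsRing) (V := C_NormedModule) f (RtoC lam * z)%C l ->
  is_derive (K := C_AbsRing) (V := C_NormedModule) (fun z => (a * f (RtoC lam * z))%C) z (a * RtoC lam * l)%C.
Proof.
  intros Hl H. apply is_Cderive_eps. intros e He.
  set (A := Cmod a + 1). assert (HA : 0 < A) by (unfold A; assert (Q := Cmod_ge_0 a); lra).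
  destruct (proj1 (is_Cderive_eps _ _ _) H (e / (A * lam))) as [d [Hd Hf]].
  { apply Rdiv_lt_0_compat; nra. }
  exists (d / lam). split; [apply Rdiv_lt_0_compat; lra |]. intros y Hy.
  assert (E : Cmod (RtoC lam * y - RtoC lam * z) = lam * Cmod (y - z)).
  { replace (RtoC lam * y - RtoC lam * z)%C with (RtoC lam * (y - z))%C by ring.
    rewrite Cmod_mult, Cmod_R, Rabs_right by lra. reflexivity. }
  specialize (Hf (RtoC lam * y)%C). rewrite E in Hf.
  assert (Hlt : lam * Cmod (y - z) < d).
  { apply Rmult_lt_compat_l with (r := lam) in Hy; [| exact Hl].
    replace (lam * (d / lam)) with d in Hy by (field; lra). exact Hy. }
  specialize (Hf Hlt).
  replace (a * f (RtoC lam * y) - a * f (RtoC lam * z) - (y - z) * (a * RtoC lam * l))%C with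
    (a * (f (RtoC lam * y) - f (RtoC lam * z) - (RtoC lam * y - RtoC lam * z) * l))%C by ring.
  rewrite Cmod_mult.
  apply Rle_trans with (A * (e / (A * lam) * (lam * Cmod (y - z)))).
  - apply Rmult_le_compat; [apply Cmod_ge_0 | apply Cmod_ge_0 | unfold A; lra | exact Hf].
  - right. field. lra.
Qed.

Theorem B_injective_of_divergence N : weight_seq N ->
  is_lim_seq (sum_n (fun p => / sqrt (quot N p))) p_infty -> B_injective N.
Proof.
  (* [C1] and [half_plane_C2] are here the constants in the bounds for F and G. *)
  intros HN Hdiv F G b [DF [h1 [C1 [Hh1 BF]]]] [DG [h2 [half_plane_C2 [Hh2 BG]]]] EF EG z0 Hz0.
  assert (Np : forall p, 0 < N p) by apply HN.
  assert (Hi : 0 < Im z0) by exact Hz0.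
  assert (Hz0nz : z0 <> 0%C) by (intros ->; simpl in Hi; lra).
  assert (Hs := Cnz_sq z0 Hz0nz).
  (* Chosen so that i lam / z0 has real part 1, which puts z0 / lam on the circle where the dilated
     difference vanishes. *)
  set (lam := (Re z0 ^ 2 + Im z0 ^ 2) / Im z0).
  assert (Hlam : 0 < lam) by now apply Rdiv_lt_0_compat.
  set (h := Rmax h1 h2). assert (H1h : h1 <= h) by apply Rmax_l. assert (H2h : h2 <= h) by apply Rmax_r.
  set (K := Rabs C1 + Rabs half_plane_C2 + 1).
  assert (A1 := Rabs_pos C1). assert (A2 := Rabs_pos half_plane_C2).
  assert (HK : 0 < K) by (unfold K; lra).
  set (D := fun p z => (RtoC (lam ^ p) * (F p (RtoC lam * z) - G p (RtoC lam * z)))%C).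
  set (Q0 := fun p => K * (lam * h) ^ p * N p).
  assert (Hlh : 0 < lam * h) by (apply Rmult_lt_0_compat; lra).
  assert (Q0p : forall p, 0 < Q0 p).
  { intros p. unfold Q0. apply Rmult_lt_0_compat; [| apply Np]. apply Rmult_lt_0_compat; [lra | now apply pow_lt]. }
  assert (Q0q : forall p, Q0 (S p) / Q0 p = lam * h * quot N p).
  { intros p. unfold Q0, quot. simpl. assert (P := Np p). field.
    repeat split; try lra. apply pow_nonzero; lra. }
  assert (B1 : forall C0 h0 p, 0 < h0 -> h0 <= h -> C0 * h0 ^ p * N p <= Rabs C0 * h ^ p * N p).
  { intros C0 h0 p Hp Hle. apply Rmult_le_compat_r; [left; apply Np |].
    apply Rle_trans with (Rabs C0 * h0 ^ p).
    - apply Rmult_le_compat_r; [apply pow_le; lra | apply Rle_abs].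
    - apply Rmult_le_compat_l; [apply Rabs_pos | apply pow_incr; lra]. }
  assert (Dz : forall y0, D 0%nat (Ci * / (1, y0))%C = 0%C).
  { apply (F_zero_circle D Q0).
    - intros p z Hz. unfold D.
      replace (RtoC (lam ^ S p) * (F (S p) (RtoC lam * z) - G (S p) (RtoC lam * z)))%C with
        (RtoC (lam ^ p) * RtoC lam * (F (S p) (RtoC lam * z) - G (S p) (RtoC lam * z)))%C
        by (simpl; rewrite RtoC_mult; ring).
      apply (is_Cderive_scaled (fun z => F p z - G p z)%C); [exact Hlam |].
      assert (Hz' : HH (RtoC lam * z)) by now apply HH_scal.
      apply (is_derive_minus (K := C_AbsRing) (V := C_NormedModule) (F p) (G p)); auto.
    - intros p z Hz. assert (Hz' : HH (RtoC lam * z)) by now apply HH_scal.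
      unfold D, Q0. rewrite Cmod_mult, Cmod_R, Rabs_right by (left; now apply pow_lt).
      rewrite Rpow_mult_distr. replace (K * (lam ^ p * h ^ p) * N p) with (lam ^ p * (K * h ^ p * N p)) by ring.
      apply Rmult_le_compat_l; [apply pow_le; lra |].
      eapply Rle_trans; [apply Cmod_triangle |]. rewrite Cmod_opp.
      specialize (BF p _ Hz'). specialize (BG p _ Hz').
      assert (U1 := B1 C1 h1 p Hh1 H1h). assert (U2 := B1 half_plane_C2 h2 p Hh2 H2h).
      assert (P : 0 <= h ^ p * N p).
      { apply Rmult_le_pos; [apply pow_le; lra | left; apply Np]. }
      unfold K. nra.
    - intros p. apply ext_value_eps. intros e He.
      assert (Hlp : 0 < lam ^ p) by now apply pow_lt.
      assert (He' : 0 < e / (2 * lam ^ p)) by (apply Rdiv_lt_0_compat; lra).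
      destruct (proj1 (ext_value_eps _ _) (EF p) _ He') as [d1 [Hd1 H1]].
      destruct (proj1 (ext_value_eps _ _) (EG p) _ He') as [d2 [Hd2 H2]].
      exists (Rmin d1 d2 / lam). split.
      { apply Rdiv_lt_0_compat; [now apply Rmin_pos | exact Hlam]. }
      intros z Hz Hzd. assert (Hz' : HH (RtoC lam * z)) by now apply HH_scal.
      assert (Hm : Cmod (RtoC lam * z) < Rmin d1 d2).
      { rewrite Cmod_mult, Cmod_R, Rabs_right by lra.
        apply Rmult_lt_compat_l with (r := lam) in Hzd; [| exact Hlam].
        replace (lam * (Rmin d1 d2 / lam)) with (Rmin d1 d2) in Hzd by (field; lra). exact Hzd. }
      specialize (H1 _ Hz' (Rlt_le_trans _ _ _ Hm (Rmin_l _ _))).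
      specialize (H2 _ Hz' (Rlt_le_trans _ _ _ Hm (Rmin_r _ _))).
      unfold D. replace (RtoC (lam ^ p) * (F p (RtoC lam * z) - G p (RtoC lam * z)) - 0)%C with
        (RtoC (lam ^ p) * ((F p (RtoC lam * z) - b p) + - (G p (RtoC lam * z) - b p)))%C by ring.
      rewrite Cmod_mult, Cmod_R, Rabs_right by lra.
      assert (T := Cmod_triangle (F p (RtoC lam * z)%C - b p)%C (- (G p (RtoC lam * z)%C - b p))%C).
      rewrite Cmod_opp in T.
      apply Rlt_le_trans with (lam ^ p * (e / lam ^ p)); [| right; field; lra].
      apply Rmult_lt_compat_l; [exact Hlp |].
      replace (e / lam ^ p) with (e / (2 * lam ^ p) + e / (2 * lam ^ p)) by (field; lra). lra.
    - exact Q0p.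
    - intros p. rewrite !Q0q. apply Rmult_le_compat_l; [lra | now apply weight_seq_quot].
    - assert (Hsq : 0 < sqrt (lam * h)) by now apply sqrt_lt_R0.
      (* The sum asked for begins with the quotient of index 1, so the term of index 0 is
         subtracted; the dilation contributes only the factor (lam h)^(-1/2). *)
      apply is_lim_seq_ext with (fun n => / sqrt (lam * h) *
        (sum_n (fun p => / sqrt (quot N p)) (S n) - / sqrt (quot N 0))).
      + intros n. induction n as [|n IH].
        * rewrite sum_Sn, !sum_O. unfold plus; simpl. rewrite Q0q, (sqrt_mult_alt (lam * h) (quot N _)), Rinv_mult by lra. ring.
        * rewrite (sum_Sn (fun p => / sqrt (Q0 (S (S p)) / Q0 (S p))) n), <- IH, (sum_Sn _ (S n)). unfold plus; simpl.
          rewrite Q0q, (sqrt_mult_alt (lam * h) (quot N _)), Rinv_mult by lra. ring.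
      + replace p_infty with (Rbar_mult (/ sqrt (lam * h)) p_infty).
        * apply is_lim_seq_scal_l.
          apply (is_lim_seq_minus _ _ p_infty (/ sqrt (quot N 0))).
          -- apply -> (is_lim_seq_incr_1 (sum_n (fun p => / sqrt (quot N p)))). exact Hdiv.
          -- apply is_lim_seq_const.
          -- reflexivity.
        * simpl. assert (Hp : 0 < / sqrt (lam * h)) by now apply Rinv_0_lt_compat.
          destruct (Rle_dec 0 (/ sqrt (lam * h))) as [Hd | Hd]; [| lra].
          destruct (Rle_lt_or_eq_dec 0 (/ sqrt (lam * h)) Hd); [reflexivity | lra]. }
  set (v := (Ci * RtoC lam * / z0)%C).
  assert (Hv : v = (1, Im v)).
  { apply C_ext; [| reflexivity]. unfold v, lam. simpl. unfold Re, Im in *. simpl in *. field. lra. }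
  assert (Hvz : (RtoC lam * (Ci * / v))%C = z0).
  { unfold v. field. repeat split; try exact Hz0nz.
    - intros E. apply (f_equal Re) in E. simpl in E. lra.
    - intros E. apply (f_equal Im) in E. simpl in E. lra. }
  specialize (Dz (Im v)). rewrite <- Hv in Dz. unfold D in Dz. rewrite Hvz in Dz. simpl pow in Dz.
  rewrite Cmult_1_l in Dz.
  replace (F 0%nat z0) with (F 0%nat z0 - G 0%nat z0 + G 0%nat z0)%C by ring. rewrite Dz. ring.
Qed.

(** * The Laplace transform of a density *)

Lemma exp_le_mono x y : x <= y -> exp x <= exp y.
Proof. intros [H | ->]; [left; now apply exp_increasing | right; reflexivity]. Qed.

Lemma exp_neg_om t : 0 <= t -> exp (- t) <= 4 * om t.
Proof.
  intros Ht. rewrite exp_Ropp. unfold om.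
  assert (H := exp_ineq1_le (t / 2)).
  assert (E : exp t = exp (t / 2) * exp (t / 2)) by (rewrite <- exp_plus; f_equal; field).
  assert (Hp := exp_pos t). assert (H2 := pow2_ge_0 t).
  apply Rmult_le_reg_r with (exp t * (1 + t ^ 2)); [nra |].
  replace (/ exp t * (exp t * (1 + t ^ 2))) with (1 + t ^ 2) by (field; lra).
  replace (4 * / (1 + t ^ 2) * (exp t * (1 + t ^ 2))) with (4 * exp t) by (field; lra).
  rewrite E. nra.
Qed.

Lemma continuous_ccont (phi : R -> C) x : continuous phi x -> ccont phi x.
Proof.
  intros H. split; apply continuous_eps; intros e He.
  - destruct (H (fun w => Rabs (Re w - Re (phi x)) < e)) as [d Hd].
    + exists (mkposreal e He). intros z [Hz _]. exact Hz.
    + exists d. split; [apply cond_pos |]. intros y Hy. apply Hd. exact Hy.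
  - destruct (H (fun w => Rabs (Im w - Im (phi x)) < e)) as [d Hd].
    + exists (mkposreal e He). intros z [_ Hz]. exact Hz.
    + exists d. split; [apply cond_pos |]. intros y Hy. apply Hd. exact Hy.
Qed.

Lemma is_RInt_gen_eps (f : R -> C) (l : C) :
  is_RInt_gen (V := C_R_NormedModule) f (at_right 0) (Rbar_locally p_infty) l ->
  forall e, 0 < e -> exists d B, 0 < d /\ forall a b, 0 < a < d -> B < b ->
    exists J : C, is_RInt (V := C_R_NormedModule) f a b J /\ Rabs (Re J - Re l) < e /\ Rabs (Im J - Im l) < e.
Proof.
  intros H e He.
  destruct (H (fun w => Rabs (Re w - Re l) < e /\ Rabs (Im w - Im l) < e)) as [P Q [d Hd] [B HB] HPQ].
  - exists (mkposreal e He). intros z [H1 H2]. split; [exact H1 | exact H2].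
  - exists d, B. split; [apply cond_pos |]. intros a b Ha Hb.
    destruct (HPQ a b) as [J [HJ1 HJ2]].
    + apply Hd; [| lra]. unfold ball; simpl. unfold AbsRing_ball, minus, plus, opp, abs; simpl.
      rewrite Ropp_0, Rplus_0_r, Rabs_right; lra.
    + now apply HB.
    + exists J. split; [exact HJ1 | exact HJ2].
Qed.

(* The substitution [x = exp y] turns moments into integrals over the whole line. *)
Definition moment_term (phi : R -> C) (p : nat) (y : R) : C := (RtoC (exp y ^ p * exp y) * phi (exp y))%C.

Lemma int_n_substitution (f : R -> R) (p n : nat) : (forall x, 0 < x -> continuous f x) ->
  int_n (fun y => exp y ^ p * exp y * f (exp y)) n = RInt (fun x => x ^ p * f x) (exp (- INR n)) (exp (INR n)).
Proof.
  intros Hc.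
  rewrite <- (RInt_comp (V := R_CompleteNormedModule) (fun x => x ^ p * f x) exp exp).
  - unfold int_n. apply RInt_ext. intros. unfold scal; simpl; unfold mult; simpl. ring.
  - intros x _. apply cont_mult; [| apply Hc, exp_pos].
    apply (ex_derive_continuous (V := R_NormedModule)). auto_derive. exact I.
  - intros x _. split; [apply is_derive_exp |].
    apply (ex_derive_continuous (V := R_NormedModule)). eexists. apply is_derive_exp.
Qed.

Lemma exp_seq_small (d B : R) : 0 < d -> exists N, forall n, (N <= n)%nat ->
  0 < exp (- INR n) < d /\ B < exp (INR n).
Proof.
  intros Hd. destruct (INR_unbounded (Rmax (/ d) B)) as [N HN].
  exists N. intros n Hn. apply le_INR in Hn.
  assert (H1 := Rmax_l (/ d) B). assert (H2 := Rmax_r (/ d) B).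
  assert (H3 := exp_ineq1_le (INR n)).
  split; [split; [apply exp_pos |] | lra].
  rewrite exp_Ropp. rewrite <- (Rinv_inv d). apply Rinv_lt_contravar; [| lra].
  apply Rmult_lt_0_compat; [now apply Rinv_0_lt_compat | apply exp_pos].
Qed.

(** The improper integral is sampled along the intervals [e^(-n), e^n], the images of [-n, n]. *)
Lemma moment_term_lim (phi : R -> C) (p : nat) (l : C) : (forall x, 0 < x -> ccont phi x) ->
  is_RInt_gen (V := C_R_NormedModule) (fun x => (RtoC (x ^ p) * phi x)%C)
              (at_right 0) (Rbar_locally p_infty) l ->
  cint_R (moment_term phi p) = l.
Proof.
  intros Hc H. apply C_ext.
  - change (int_R (fun y => Re (moment_term phi p y)) = Re l). apply int_R_unique. apply is_lim_seq_spec. intros e.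
    destruct (is_RInt_gen_eps _ _ H e (cond_pos e)) as [d [B [Hd HJ]]].
    destruct (exp_seq_small d B Hd) as [N HN]. exists N. intros n Hn.
    destruct (HN n Hn) as [H1 H2]. destruct (HJ _ _ H1 H2) as [J [J1 [J2 J3]]].
    replace (int_n (fun y => Re (moment_term phi p y)) n) with (Re J); [exact J2 |].
    rewrite (int_n_ext _ (fun y => exp y ^ p * exp y * Re (phi (exp y)))).
    2: { intros y. unfold moment_term. simpl. unfold Re; simpl. ring. }
    rewrite (int_n_substitution (fun x => Re (phi x))) by (intros; now apply Hc).
    symmetry. apply is_RInt_unique.
    eapply is_RInt_ext; [| apply (is_RInt_fct_extend_fst (U := R_NormedModule) (V := R_NormedModule) _ _ _ _ J1)].
    intros x _. simpl. unfold Re. ring.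
  - change (int_R (fun y => Im (moment_term phi p y)) = Im l). apply int_R_unique. apply is_lim_seq_spec. intros e.
    destruct (is_RInt_gen_eps _ _ H e (cond_pos e)) as [d [B [Hd HJ]]].
    destruct (exp_seq_small d B Hd) as [N HN]. exists N. intros n Hn.
    destruct (HN n Hn) as [H1 H2]. destruct (HJ _ _ H1 H2) as [J [J1 [J2 J3]]].
    replace (int_n (fun y => Im (moment_term phi p y)) n) with (Im J); [exact J3 |].
    rewrite (int_n_ext _ (fun y => exp y ^ p * exp y * Im (phi (exp y)))).
    2: { intros y. unfold moment_term. simpl. unfold Im; simpl. ring. }
    rewrite (int_n_substitution (fun x => Im (phi x))) by (intros; now apply Hc).
    symmetry. apply is_RInt_unique.
    eapply is_RInt_ext; [| apply (is_RInt_fct_extend_snd (U := R_NormedModule) (V := R_NormedModule) _ _ _ _ J1)].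
    intros x _. simpl. unfold Im. ring.
Qed.

Lemma ccont_exp (phi : R -> C) y : (forall x, 0 < x -> ccont phi x) -> ccont (fun y => phi (exp y)) y.
Proof.
  intros H. destruct (H (exp y) (exp_pos y)) as [H1 H2].
  assert (Ce : continuous exp y).
  { apply (ex_derive_continuous (V := R_NormedModule)). eexists. apply is_derive_exp. }
  split.
  - apply (continuous_comp exp (fun x => Re (phi x))); assumption.
  - apply (continuous_comp exp (fun x => Im (phi x))); assumption.
Qed.

Lemma exp_pow_cont p y : continuous (fun y => exp y ^ p * exp y) y.
Proof. apply (ex_derive_continuous (V := R_NormedModule)). auto_derive. exact I. Qed.

Lemma ccont_moment_term (phi : R -> C) p y : (forall x, 0 < x -> ccont phi x) -> ccont (moment_term phi p) y.
Proof.
  intros H. apply ccont_mult; [| now apply ccont_exp].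
  split; [apply exp_pow_cont | apply continuous_const].
Qed.

Lemma Cmod_moment_term phi p y : Cmod (moment_term phi p y) = exp y * (exp y ^ p * Cmod (phi (exp y))).
Proof.
  unfold moment_term. assert (H := exp_pos y). assert (H2 := pow_lt (exp y) p H).
  rewrite Cmod_mult, Cmod_R, Rabs_right by nra. ring.
Qed.

Section LaplaceCM.

Variables (M : nat -> R) (chi : R -> C) (h K : R).
Hypothesis M_weight : weight_seq M.
Hypothesis chi_cont : forall x, 0 < x -> ccont chi x.
Hypothesis h_pos : 0 < h.
Hypothesis K_pos : 0 <= K.
Hypothesis chi_bound : forall p x, 0 < x -> x ^ p * Cmod (chi x) <= K * h ^ p * M p.

(** The bounds on chi of index p, p + 1 and p + 2, in the variable y: multiples of e^y, 1 and
    e^(-y). The smallest of them changes at y = ln (h m_p) and at y = ln (h m_(p+1)). *)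
Lemma moment_term_bounds p y :
  Cmod (moment_term chi p y) <= K * h ^ p * M p * exp y /\
  Cmod (moment_term chi p y) <= K * h ^ S p * M (S p) /\
  Cmod (moment_term chi p y) <= K * h ^ S (S p) * M (S (S p)) * exp (- y).
Proof.
  rewrite Cmod_moment_term. assert (H := exp_pos y). assert (H2 := pow_lt (exp y) p H).
  split; [| split].
  - rewrite Rmult_comm. apply Rmult_le_compat_r; [lra | now apply chi_bound].
  - assert (B := chi_bound (S p) (exp y) H). simpl in B |- *. lra.
  - assert (B := chi_bound (S (S p)) (exp y) H). rewrite exp_Ropp.
    apply Rmult_le_reg_r with (exp y); [exact H |].
    replace (K * h ^ S (S p) * M (S (S p)) * / exp y * exp y) with (K * h ^ S (S p) * M (S (S p))) by (field; lra).
    simpl in B |- *. lra.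
Qed.

Lemma cdominated_moment_term p : exists L, cdominated (moment_term chi p) L.
Proof.
  assert (Mp : forall p, 0 < M p) by apply M_weight.
  assert (A : forall q, 0 <= K * h ^ q * M q).
  { intros q. apply Rmult_le_pos; [| left; apply Mp]. apply Rmult_le_pos; [exact K_pos | apply pow_le; lra]. }
  exists (4 * (K * h ^ p * M p + K * h ^ S (S p) * M (S (S p)))). split; [intros; now apply ccont_moment_term |].
  intros y. destruct (moment_term_bounds p y) as [B1 [_ B3]].
  assert (A1 := A p). assert (A2 := A (S (S p))). assert (Ho := om_pos y).
  destruct (Rle_dec 0 y) as [Hy | Hy].
  - assert (E := exp_neg_om y Hy). assert (P := exp_pos (- y)). nra.
  - assert (E := exp_neg_om (- y) ltac:(lra)). rewrite Ropp_involutive in E.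
    replace (om (- y)) with (om y) in E by (unfold om; f_equal; ring). assert (P := exp_pos y). nra.
Qed.

Lemma Cmod_continuous (f : R -> C) y : ccont f y -> continuous (fun y => Cmod (f y)) y.
Proof.
  intros [H1 H2]. unfold Cmod.
  apply (continuous_comp (fun y => Re (f y) ^ 2 + Im (f y) ^ 2) sqrt); [| apply continuous_sqrt].
  apply continuous_ext with (fun y => Re (f y) * Re (f y) + Im (f y) * Im (f y)); [intros; simpl; ring |].
  apply cont_plus; now apply cont_mult.
Qed.

(** Enlarging [s, t] until it contains a and b is allowed since g >= 0; each of the three bounds is
    then integrated over its own range. *)
Lemma RInt_three (g : R -> R) (al be ga a b s t : R) : (forall y, continuous g y) -> (forall y, 0 <= g y) ->
  0 <= al -> 0 <= ga ->
  (forall y, g y <= al * exp y) -> (forall y, g y <= be) -> (forall y, g y <= ga * exp (- y)) ->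
  a <= b -> s <= t -> RInt g s t <= al * exp a + be * (b - a) + ga * exp (- b).
Proof.
  intros Cg Pg Hal Hga H1 H2 H3 Hab Hst.
  set (s' := Rmin s a). set (t' := Rmax t b).
  assert (S1 : s' <= s) by apply Rmin_l. assert (S2 : s' <= a) by apply Rmin_r.
  assert (T1 : t <= t') by apply Rmax_l. assert (T2 : b <= t') by apply Rmax_r.
  assert (E1 : RInt g s t <= RInt g s' t').
  { rewrite <- (RInt_Chasles g s' s t') by now apply ex_RInt_cont.
    rewrite <- (RInt_Chasles g s t t') by now apply ex_RInt_cont.
    assert (0 <= RInt g s' s) by (apply RInt_ge_0; [lra | now apply ex_RInt_cont | auto]).
    assert (0 <= RInt g t t') by (apply RInt_ge_0; [lra | now apply ex_RInt_cont | auto]).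
    unfold plus in *; simpl in *. lra. }
  assert (I1 : is_RInt (fun y => al * exp y) s' a (al * exp a - al * exp s')).
  { apply (is_RInt_derive (V := R_CompleteNormedModule) (fun y => al * exp y)).
    - intros. auto_derive; [exact I | ring].
    - intros. apply (ex_derive_continuous (V := R_NormedModule)). auto_derive. exact I. }
  assert (I3 : is_RInt (fun y => ga * exp (- y)) b t' (- ga * exp (- t') - - ga * exp (- b))).
  { apply (is_RInt_derive (V := R_CompleteNormedModule) (fun y => - ga * exp (- y))).
    - intros. auto_derive; [exact I | ring].
    - intros. apply (ex_derive_continuous (V := R_NormedModule)). auto_derive. exact I. }
  rewrite <- (RInt_Chasles g s' a t') in E1 by now apply ex_RInt_cont.
  rewrite <- (RInt_Chasles g a b t') in E1 by now apply ex_RInt_cont.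
  assert (B1 : RInt g s' a <= al * exp a - al * exp s').
  { apply (is_RInt_le g (fun y => al * exp y) s' a); auto. apply (RInt_correct g). now apply ex_RInt_cont. }
  assert (B2 : RInt g a b <= (b - a) * be).
  { apply (is_RInt_le g (fun _ => be) a b); auto. apply (RInt_correct g). now apply ex_RInt_cont.
    apply (is_RInt_const a b be). }
  assert (B3 : RInt g b t' <= - ga * exp (- t') - - ga * exp (- b)).
  { apply (is_RInt_le g (fun y => ga * exp (- y)) b t'); auto. apply (RInt_correct g). now apply ex_RInt_cont. }
  assert (X1 := exp_pos s'). assert (X2 := exp_pos (- t')).
  unfold plus in *; simpl in *. nra.
Qed.

(** This is the origin of [Mtilde]. With cuts at ln (h m_p) and ln (h m_(p+1)), each outer piece
    contributes K h^(p+1) M_(p+1), and the middle one contributes this times ln (m_(p+1) / m_p). The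
    sum is the factor ln (e^2 m_(p+1) / m_p). *)
Lemma moment_term_integral p n : int_n (fun y => Cmod (moment_term chi p y)) n <= K * h * h ^ p * Mtilde M p.
Proof.
  assert (Mp : forall p, 0 < M p) by apply M_weight.
  assert (A : forall q, 0 <= K * h ^ q * M q).
  { intros q. apply Rmult_le_pos; [| left; apply Mp]. apply Rmult_le_pos; [exact K_pos | apply pow_le; lra]. }
  assert (m1 := quot_pos M p Mp). assert (m2 := quot_pos M (S p) Mp).
  assert (m12 := weight_seq_quot M p M_weight).
  eapply Rle_trans.
  - apply (RInt_three (fun y => Cmod (moment_term chi p y)) (K * h ^ p * M p) (K * h ^ S p * M (S p))
      (K * h ^ S (S p) * M (S (S p))) (ln (h * quot M p)) (ln (h * quot M (S p)))).
    + intros y. apply Cmod_continuous. now apply ccont_moment_term.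
    + intros; apply Cmod_ge_0.
    + apply A.
    + apply A.
    + intros; apply moment_term_bounds.
    + intros; apply moment_term_bounds.
    + intros; apply moment_term_bounds.
    + apply ln_le; nra.
    + assert (Q := pos_INR n). lra.
  - right. unfold Mtilde, Rdiv.
    rewrite exp_Ropp, !exp_ln by nra.
    rewrite !ln_mult; try nra; try apply exp_pos.
    2: { apply Rmult_lt_0_compat; [apply exp_pos | exact m2]. }
    2: { now apply Rinv_0_lt_compat. }
    rewrite ln_exp, ln_Rinv by exact m1. simpl.
    assert (E1 : M p * quot M p = M (S p)) by (unfold quot; field; assert (Q := Mp p); lra).
    assert (E2 : M (S (S p)) * / quot M (S p) = M (S p)).
    { unfold quot. assert (Q := Mp (S p)). assert (Q' := Mp (S (S p))). field. lra. }
    replace (K * h ^ p * M p * (h * quot M p)) with (K * h * h ^ p * (M p * quot M p)) by ring.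
    replace (K * (h * (h * h ^ p)) * M (S (S p)) * / (h * quot M (S p))) with
      (K * h * h ^ p * (M (S (S p)) * / quot M (S p))) by (field; lra).
    rewrite E1, E2. ring.
Qed.

(** The transform of chi with kernel e^(izx), differentiated p times, after x = e^y; the factor
    (ix)^p is contained in [Ci ^ p * moment_term chi p y]. *)
Definition laplace_deriv (p : nat) (z : C) : C :=
  cint_R (fun y => cexp (Ci * z * RtoC (exp y)) * (Ci ^ p * moment_term chi p y))%C.

Lemma Re_Ci_mult (z : C) (x : R) : Re (Ci * z * RtoC x)%C = - (x * Im z).
Proof. simpl. unfold Im. ring. Qed.

Lemma Cmod_cexp_half z y : 0 <= Im z -> Cmod (cexp (Ci * z * RtoC (exp y))) <= 1.
Proof.
  intros Hz. rewrite Cmod_cexp, Re_Ci_mult, <- exp_0. apply exp_le_mono. assert (H := exp_pos y). nra.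
Qed.

Lemma laplace_term_le p z y : 0 <= Im z ->
  Cmod (cexp (Ci * z * RtoC (exp y)) * (Ci ^ p * moment_term chi p y)) <= Cmod (moment_term chi p y).
Proof.
  intros Hz. rewrite !Cmod_mult, Cmod_pow, Cmod_Ci, pow1, Rmult_1_l.
  assert (H := Cmod_cexp_half z y Hz). assert (H2 := Cmod_ge_0 (moment_term chi p y)). nra.
Qed.

Lemma ccont_laplace_term p z y : ccont (fun y => cexp (Ci * z * RtoC (exp y)) * (Ci ^ p * moment_term chi p y))%C y.
Proof.
  apply ccont_mult; [| apply ccont_scal; now apply ccont_moment_term].
  eapply rder_cont. apply rder_cexp, rder_scal, rder_RtoC, is_derive_exp.
Qed.

Lemma cdominated_laplace_term p z L : 0 <= Im z -> cdominated (moment_term chi p) L ->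
  cdominated (fun y => cexp (Ci * z * RtoC (exp y)) * (Ci ^ p * moment_term chi p y))%C L.
Proof.
  intros Hz [_ H]. split; [intros; apply ccont_laplace_term |].
  intros y. eapply Rle_trans; [now apply laplace_term_le | apply H].
Qed.

Lemma laplace_deriv_bound p z : 0 <= Im z -> Cmod (laplace_deriv p z) <= 2 * (K * h) * h ^ p * Mtilde M p.
Proof.
  intros Hz. destruct (cdominated_moment_term p) as [L HL]. assert (HD := cdominated_laplace_term p z L Hz HL).
  assert (Cc : forall y, continuous (fun y => Cmod (moment_term chi p y)) y) by (intros; apply Cmod_continuous; now apply ccont_moment_term).
  assert (W : forall P : C -> R, (forall w, Rabs (P w) <= Cmod w) ->
    dominated (fun y => P (cexp (Ci * z * RtoC (exp y)) * (Ci ^ p * moment_term chi p y))%C) L ->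
    Rabs (int_R (fun y => P (cexp (Ci * z * RtoC (exp y)) * (Ci ^ p * moment_term chi p y))%C)) <= K * h * h ^ p * Mtilde M p).
  { intros P HP HPd. eapply int_R_abs_le; [exact HPd |]. intros n.
    eapply Rle_trans; [| apply (moment_term_integral p n)].
    apply int_n_abs_le; [apply HPd | exact Cc |].
    intros y. eapply Rle_trans; [apply HP | now apply laplace_term_le]. }
  eapply Rle_trans; [apply Cmod_le_ReIm |].
  assert (W1 := W Re re_le_Cmod (cdominated_re _ _ HD)). assert (W2 := W Im Im_le_Cmod (cdominated_im _ _ HD)).
  cbv beta in W1, W2.
  change (Re (laplace_deriv p z)) with (int_R (fun y => Re (cexp (Ci * z * RtoC (exp y)) * (Ci ^ p * moment_term chi p y))%C)).
  change (Im (laplace_deriv p z)) with (int_R (fun y => Im (cexp (Ci * z * RtoC (exp y)) * (Ci ^ p * moment_term chi p y))%C)).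
  lra.
Qed.

Lemma laplace_deriv_derive p z : HH z ->
  is_derive (K := C_AbsRing) (V := C_NormedModule) (laplace_deriv p) z (laplace_deriv (S p) z).
Proof.
  intros Hz. destruct (cdominated_moment_term p) as [L0 H0]. destruct (cdominated_moment_term (S p)) as [L1 H1].
  destruct (cdominated_moment_term (S (S p))) as [L2 H2].
  assert (HL2 := cdominated_pos _ _ H2).
  (* Within distance Im z of z the segment stays in the closed half-plane, where |e^(izx)| <= 1; the
     remainder is then controlled by the moment integrand of index p + 2. *)
  apply (is_Cderive_quad _ _ _ (Im z) (8 * L2)); [exact Hz | lra |].
  intros z' Hz'.
  assert (Iz' : 0 <= Im z').
  { assert (Q := Im_le_Cmod (z' - z)). rewrite Im_minus in Q. apply Rabs_le_between in Q. lra. }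
  unfold HH in Hz.
  set (w := (z' - z)%C).
  assert (D0 := cdominated_laplace_term p z L0 ltac:(lra) H0). assert (D0' := cdominated_laplace_term p z' L0 Iz' H0).
  assert (D1 := cdominated_laplace_term (S p) z L1 ltac:(lra) H1).
  assert (B := cint_R_quad _ _ _ _ _ _ (L2 * Cmod w ^ 2) 1 D0 D0' (cdominated_scal w _ _ D1)).
  rewrite (cint_R_scal _ _ _ D1), Cmult_1_l in B. fold (laplace_deriv p z) (laplace_deriv p z') (laplace_deriv (S p) z) in B.
  rewrite pow1, !Rmult_1_r in B. rewrite Rmult_assoc. apply B. clear B. intros y.
  set (x := RtoC (exp y)). set (A := (Ci ^ p * moment_term chi p y)%C).
  assert (EA : (Ci ^ S p * moment_term chi (S p) y)%C = (Ci * x * A)%C).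
  { unfold A, x, moment_term. rewrite Cpow_S. simpl pow. rewrite !RtoC_mult. ring. }
  assert (EA2 : (Ci ^ S (S p) * moment_term chi (S (S p)) y)%C = (Ci * x * (Ci * x) * A)%C).
  { unfold A, x, moment_term. rewrite !Cpow_S. simpl pow. rewrite !RtoC_mult. ring. }
  assert (T := taylor01 (fun t => cexp (Ci * (z + RtoC t * w) * x) * A)%C
    (fun t => (Ci * w * x) * cexp (Ci * (z + RtoC t * w) * x) * A)%C
    (fun t => (Ci * w * x) * (Ci * w * x) * cexp (Ci * (z + RtoC t * w) * x) * A)%C
    (L2 * Cmod w ^ 2 * om y)).
  assert (DE : forall t, rder (fun t => cexp (Ci * (z + RtoC t * w) * x)%C) t
      ((Ci * w * x) * cexp (Ci * (z + RtoC t * w) * x))%C).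
  { intros t. apply rder_cexp.
    eapply rder_eq; [apply rder_mult; [apply rder_scal, rder_line | apply rder_const] |]. cbv beta; ring. }
  cbv beta in T. rewrite EA.
  replace (z + RtoC 1 * w)%C with z' in T by (unfold w; ring).
  replace (z + RtoC 0 * w)%C with z in T by ring.
  replace (RtoC 1 * (w * (cexp (Ci * z * x) * (Ci * x * A))))%C with
    (Ci * w * x * cexp (Ci * z * x) * A)%C by ring.
  apply T.
  - intros t _. eapply rder_eq; [apply rder_mult; [apply DE | apply rder_const] |]. cbv beta; ring.
  - intros t _. eapply rder_eq.
    + apply rder_mult; [apply rder_mult; [apply rder_const | apply DE] | apply rder_const].
    + cbv beta; ring.
  - intros t Ht.
    replace ((Ci * w * x) * (Ci * w * x) * cexp (Ci * (z + RtoC t * w) * x) * A)%C with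
      (w * w * (cexp (Ci * (z + RtoC t * w) * x) * (Ci ^ S (S p) * moment_term chi (S (S p)) y)))%C by (rewrite EA2; ring).
    rewrite Cmod_mult, Cmod_mult. replace (L2 * Cmod w ^ 2 * om y) with (Cmod w * Cmod w * (L2 * om y)) by ring.
    apply Rmult_le_compat_l; [apply Rmult_le_pos; apply Cmod_ge_0 |].
    eapply Rle_trans; [apply laplace_term_le | apply H2].
    replace (Im (z + RtoC t * w)%C) with ((1 - t) * Im z + t * Im z') by (unfold w; simpl; unfold Im; ring).
    nra.
Qed.

(** |e^(izx) - 1| <= |z| x, and the additional x raises the moment index by one; the distance to i^p
    times the p-th moment is therefore O(|z|). *)
Lemma laplace_deriv_at_0 p : cint_R (moment_term chi p) = 0%C -> ext_value_at0 (laplace_deriv p) 0%C.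
Proof.
  intros E. destruct (cdominated_moment_term p) as [L0 H0]. destruct (cdominated_moment_term (S p)) as [L1 H1].
  assert (HL1 := cdominated_pos _ _ H1).
  apply ext_value_eps. intros e He. exists (e / (8 * (L1 + 1))).
  split; [apply Rdiv_lt_0_compat; lra |]. intros z Hz Hzd. unfold HH in Hz.
  assert (D := cdominated_laplace_term p z L0 ltac:(lra) H0). assert (D' := cdominated_scal (Ci ^ p)%C _ _ H0).
  assert (E2 : (laplace_deriv p z - 0)%C = cint_R (fun y => cexp (Ci * z * RtoC (exp y)) * (Ci ^ p * moment_term chi p y) - Ci ^ p * moment_term chi p y)%C).
  { rewrite (cint_R_minus _ _ _ _ D D'), (cint_R_scal _ _ _ H0), E. fold (laplace_deriv p z). ring. }
  rewrite E2.
  assert (B : Cmod (cint_R (fun y => cexp (Ci * z * RtoC (exp y)) * (Ci ^ p * moment_term chi p y) - Ci ^ p * moment_term chi p y)%C)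
    <= 8 * (L1 * Cmod z)).
  { apply cint_R_bound. split.
    - intros y. apply ccont_minus; [apply D | apply D'].
    - intros y. set (x := RtoC (exp y)).
      assert (T := mvt_cplx (fun t => cexp (RtoC t * (Ci * z * x)) * (Ci ^ p * moment_term chi p y))%C
        (fun t => (Ci * z * x) * cexp (RtoC t * (Ci * z * x)) * (Ci ^ p * moment_term chi p y))%C 0 1 (L1 * Cmod z * om y)).
      cbv beta in T. rewrite Cmult_1_l in T.
      replace (RtoC 0 * (Ci * z * x))%C with (RtoC 0) in T by ring. rewrite cexp_0, Cmult_1_l in T.
      rewrite Rminus_0_r, Rmult_1_r in T. apply T; [lra | |].
      + intros t Ht. eapply rder_eq; [apply rder_mult; [apply rder_cexp | apply rder_const] |].
        * apply rder_ext with (fun t => 0 + RtoC t * (Ci * z * x))%C; [intros; ring | apply rder_line].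
        * cbv beta. ring.
      + intros t Ht.
        replace ((Ci * z * x) * cexp (RtoC t * (Ci * z * x)) * (Ci ^ p * moment_term chi p y))%C with
          (z * (cexp (Ci * (RtoC t * z) * x) * (Ci ^ S p * moment_term chi (S p) y)))%C.
        2: { replace (RtoC t * (Ci * z * x))%C with (Ci * (RtoC t * z) * x)%C by ring.
             unfold x, moment_term. rewrite Cpow_S. simpl pow. rewrite !RtoC_mult. ring. }
        rewrite Cmod_mult. replace (L1 * Cmod z * om y) with (Cmod z * (L1 * om y)) by ring.
        apply Rmult_le_compat_l; [apply Cmod_ge_0 |].
        eapply Rle_trans; [apply laplace_term_le | apply H1].
        simpl. unfold Im in Hz. nra. }
  eapply Rle_lt_trans; [exact B |].
  apply Rlt_le_trans with (8 * (L1 + 1) * (e / (8 * (L1 + 1)))); [| right; field; lra].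
  assert (Q := Cmod_ge_0 z). nra.
Qed.

End LaplaceCM.

(** In the variable u = ln (x / a), the kernel x^n e^(-nx/a) is a constant times the n-th power of
    exp (gumbel u); the exponent is normalised to have its maximum 0 at u = 0. *)
Definition gumbel (u : R) : R := u - exp u + 1.

Lemma gumbel_neg u : u <> 0 -> gumbel u < 0.
Proof. intros H. unfold gumbel. assert (Q := exp_ineq1 u H). lra. Qed.

Lemma gumbel_le_0 u : gumbel u <= 0.
Proof. unfold gumbel. assert (Q := exp_ineq1_le u). lra. Qed.

(** Concavity: the tangent inequality for exp at d and at -d shows that the values farther out stay
    below those at the two ends. *)
Lemma gumbel_far d u : 0 < d -> d <= Rabs u -> gumbel u <= Rmax (gumbel d) (gumbel (- d)).
Proof.
  intros Hd Hu. unfold gumbel.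
  assert (Q : forall a, exp u = exp a * exp (u - a)) by (intros; rewrite <- exp_plus; f_equal; ring).
  assert (X1 := exp_pos d). assert (X2 := exp_pos (- d)).
  assert (Y1 := exp_ineq1_le d).
  assert (Y2 : exp (- d) <= 1) by (rewrite <- exp_0; apply exp_le_mono; lra).
  destruct (Rle_dec 0 u) as [H0 | H0].
  - rewrite Rabs_right in Hu by lra. eapply Rle_trans; [| apply Rmax_l].
    rewrite (Q d). assert (Z := exp_ineq1_le (u - d)).
    assert (exp d * (1 + (u - d)) <= exp d * exp (u - d)) by (apply Rmult_le_compat_l; lra). nra.
  - rewrite Rabs_left in Hu by lra. eapply Rle_trans; [| apply Rmax_r].
    rewrite (Q (- d)). assert (Z := exp_ineq1_le (u - - d)).
    assert (exp (- d) * (1 + (u - - d)) <= exp (- d) * exp (u - - d)) by (apply Rmult_le_compat_l; lra). nra.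
Qed.

Lemma gumbel_continuous c y0 y : continuous (fun y => exp (c * gumbel (y - y0))) y.
Proof. apply (ex_derive_continuous (V := R_NormedModule)). unfold gumbel. auto_derive. exact I. Qed.

(** Laplace's method by contradiction. If q(y0) > 0, the part near y0 is at least of order e^(-n eta
    / 2) while the part beyond distance d is O(e^(-n eta)), so the integral cannot vanish for large
    n. *)
Lemma laplace_nonpos (q : R -> R) (K y0 : R) : (forall y, continuous q y) ->
  dominated (fun y => exp (1 * gumbel (y - y0)) * q y) K ->
  (forall n : nat, int_R (fun y => exp (INR (S n) * gumbel (y - y0)) * q y) = 0) -> q y0 <= 0.
Proof.
  intros Cq DH HI. apply Rnot_lt_le. intros Hpos.
  assert (HK := dominated_pos _ _ DH).
  (* One factor of the kernel stays with q to make it dominated; the other n factors concentrate. *)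
  set (H := fun y => exp (1 * gumbel (y - y0)) * q y).
  assert (H0 : H y0 = q y0).
  { unfold H, gumbel. rewrite Rminus_eq_0, exp_0. replace (1 * (0 - 1 + 1)) with 0 by ring. rewrite exp_0. ring. }
  set (al := q y0 / 2).
  destruct (proj1 (continuous_eps H y0) (proj1 DH y0) al ltac:(unfold al; lra)) as [d0 [Hd0 Hc]].
  set (d := d0 / 2). assert (Hd : 0 < d) by (unfold d; lra).
  assert (Hnear : forall y, Rabs (y - y0) <= d -> al <= H y).
  { intros y Hy. assert (Q := Hc y ltac:(unfold d in Hy; lra)).
    apply Rabs_lt_between in Q. rewrite H0 in Q. unfold al in *. lra. }
  set (eta := - Rmax (gumbel d) (gumbel (- d))).
  assert (Heta : 0 < eta).
  { unfold eta, Rmax. assert (Q1 := gumbel_neg d ltac:(lra)). assert (Q2 := gumbel_neg (- d) ltac:(lra)).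
    destruct (Rle_dec _ _); lra. }
  assert (CE : continuous gumbel 0).
  { apply (ex_derive_continuous (V := R_NormedModule)). unfold gumbel. auto_derive. exact I. }
  destruct (proj1 (continuous_eps gumbel 0) CE (eta / 2) ltac:(lra)) as [d1 [Hd1 Hc1]].
  assert (E0 : gumbel 0 = 0) by (unfold gumbel; rewrite exp_0; ring).
  (* Within r the exponent stays above -eta / 2, half of its bound -eta outside d. *)
  set (r := Rmin d (d1 / 2)). assert (Hr : 0 < r) by (apply Rmin_pos; lra).
  assert (Hrd : r <= d) by apply Rmin_l. assert (Hrd1 : r <= d1 / 2) by apply Rmin_r.
  assert (Hn : forall n : nat, al * (2 * r) <= 4 * K * / (1 + INR n * (eta / 2))).
  { intros n. assert (Hn := pos_INR n).
    set (k := fun y => exp (INR n * gumbel (y - y0))).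
    assert (Ck : forall y, continuous k y) by (intros; apply gumbel_continuous).
    assert (B := concentration H k K K y0 d al (2 * r * exp (- (INR n * (eta / 2)))) (exp (- (INR n * eta)))).
    assert (EI : int_R (fun y => H y * k y) = 0).
    { rewrite <- (HI n). apply int_R_ext. intros y. unfold H, k. rewrite S_INR.
      replace ((INR n + 1) * gumbel (y - y0)) with (1 * gumbel (y - y0) + INR n * gumbel (y - y0)) by ring.
      rewrite exp_plus. ring. }
    rewrite EI in B.
    assert (k1 : forall y, 0 < k y <= 1).
    { intros y. unfold k. split; [apply exp_pos |]. rewrite <- exp_0. apply exp_le_mono.
      assert (Q := gumbel_le_0 (y - y0)). nra. }
    assert (B1 : al * (2 * r * exp (- (INR n * (eta / 2)))) - 4 * K * exp (- (INR n * eta)) <= 0).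
    { apply B; clear B.
      - exact DH.
      - split.
        + intros y. apply cont_mult; [apply DH | apply Ck].
        + intros y. rewrite Rabs_mult. destruct DH as [_ DB]. specialize (DB y). fold (H y) in DB.
          rewrite (Rabs_right (k y)) by (specialize (k1 y); lra).
          specialize (k1 y). assert (Q := Rabs_pos (H y)). nra.
      - exact Ck.
      - intros y. specialize (k1 y). lra.
      - exact Hd.
      - unfold al; lra.
      - left; apply exp_pos.
      - exact Hnear.
      - intros y Hy. unfold k. apply exp_le_mono.
        assert (Q := gumbel_far d (y - y0) Hd Hy). unfold eta. nra.
      - apply Rle_trans with (RInt k (y0 - r) (y0 + r)).
        + replace (2 * r * exp (- (INR n * (eta / 2)))) with (((y0 + r) - (y0 - r)) * exp (- (INR n * (eta / 2)))) by ring.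
          apply (is_RInt_le (fun _ => exp (- (INR n * (eta / 2)))) k (y0 - r) (y0 + r)); [lra | | |].
          * apply (is_RInt_const (y0 - r) (y0 + r) (exp (- (INR n * (eta / 2))))).
          * apply (RInt_correct k). now apply ex_RInt_cont.
          * intros y Hy. unfold k. apply exp_le_mono.
            assert (Q : Rabs (gumbel (y - y0) - gumbel 0) < eta / 2).
            { apply Hc1. rewrite Rminus_0_r. apply Rabs_lt_between. lra. }
            rewrite E0 in Q. apply Rabs_lt_between in Q. nra.
        + rewrite <- (RInt_Chasles k (y0 - d) (y0 - r) (y0 + d)) by now apply ex_RInt_cont.
          rewrite <- (RInt_Chasles k (y0 - r) (y0 + r) (y0 + d)) by now apply ex_RInt_cont.
          assert (0 <= RInt k (y0 - d) (y0 - r)).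
          { apply RInt_ge_0; [lra | now apply ex_RInt_cont | intros y _; specialize (k1 y); lra]. }
          assert (0 <= RInt k (y0 + r) (y0 + d)).
          { apply RInt_ge_0; [lra | now apply ex_RInt_cont | intros y _; specialize (k1 y); lra]. }
          unfold plus in *; simpl in *. lra. }
    set (s := INR n * (eta / 2)) in *. assert (Hs : 0 <= s) by (apply Rmult_le_pos; lra).
    replace (INR n * eta) with (s + s) in B1 by (unfold s; field).
    rewrite Ropp_plus_distr, exp_plus in B1.
    assert (P := exp_pos (- s)).
    assert (B2 : al * (2 * r) <= 4 * K * exp (- s)).
    { apply Rmult_le_reg_r with (exp (- s)); [exact P | lra]. }
    eapply Rle_trans; [exact B2 |]. apply Rmult_le_compat_l; [lra |].
    rewrite exp_Ropp. apply Rinv_le_contravar; [lra | apply exp_ineq1_le]. }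
  assert (Hc0 : 0 < al * (2 * r)) by (apply Rmult_lt_0_compat; unfold al; lra).
  set (c0 := al * (2 * r)) in *. clearbody c0.
  destruct (INR_unbounded (4 * K / c0 / (eta / 2))) as [n HNn].
  specialize (Hn n). assert (P := pos_INR n).
  assert (Hx : 4 * K / c0 < INR n * (eta / 2)).
  { apply Rmult_lt_compat_r with (r := eta / 2) in HNn; [| lra].
    replace (4 * K / c0 / (eta / 2) * (eta / 2)) with (4 * K / c0) in HNn by (field; split; lra).
    exact HNn. }
  apply Rmult_lt_compat_r with (r := c0) in Hx; [| exact Hc0].
  replace (4 * K / c0 * c0) with (4 * K) in Hx by (field; lra).
  assert (Hp : 0 < 1 + INR n * (eta / 2)) by nra.
  apply Rmult_le_compat_r with (r := 1 + INR n * (eta / 2)) in Hn; [| lra].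
  set (w := 1 + INR n * (eta / 2)) in *.
  replace (4 * K * / w * w) with (4 * K) in Hn by (field; lra). unfold w in *. nra.
Qed.

Lemma laplace_unique (q : R -> R) (K y0 : R) : (forall y, continuous q y) ->
  dominated (fun y => exp (1 * gumbel (y - y0)) * q y) K ->
  (forall n : nat, int_R (fun y => exp (INR (S n) * gumbel (y - y0)) * q y) = 0) -> q y0 = 0.
Proof.
  intros Cq DH HI. apply Rle_antisym; [now apply (laplace_nonpos q K) |].
  assert (D : forall n, dominated (fun y => exp (INR (S n) * gumbel (y - y0)) * q y) K).
  { intros n. split; [intros y; apply cont_mult; [apply gumbel_continuous | apply Cq] |].
    intros y. eapply Rle_trans; [| apply DH]. rewrite !Rabs_mult.
    apply Rmult_le_compat_r; [apply Rabs_pos |]. rewrite !Rabs_right by (left; apply exp_pos).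
    apply exp_le_mono. assert (Q := gumbel_le_0 (y - y0)). assert (P := pos_INR n). rewrite S_INR. nra. }
  assert (Q : -1 * q y0 <= 0).
  { apply (laplace_nonpos (fun y => -1 * q y) K).
    - intros; now apply cont_scal.
    - split.
      + intros y. apply cont_mult; [apply gumbel_continuous | now apply cont_scal].
      + intros y. destruct DH as [_ DB]. specialize (DB y).
        replace (exp (1 * gumbel (y - y0)) * (-1 * q y)) with (- (exp (1 * gumbel (y - y0)) * q y)) by ring.
        now rewrite Rabs_Ropp.
    - intros n. rewrite <- (Rmult_0_r (-1)), <- (HI n), <- (int_R_scal _ _ _ (D n)). apply int_R_ext. intros; ring. }
  lra.
Qed.

Lemma is_derive_C_zero (f : C -> C) (z l : C) : HH z -> (forall w, HH w -> f w = 0%C) ->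
  is_derive (K := C_AbsRing) (V := C_NormedModule) f z l -> l = 0%C.
Proof.
  intros Hz Hf H.
  assert (R1 := cder_of_is_derive _ _ _ H (fun t => z + RtoC t * 1)%C 0 1%C).
  assert (R2 : rder (fun t => f (z + RtoC t * 1)%C) 0 (l * 1)%C).
  { apply R1; [ring | apply rder_line]. }
  assert (E : forall t, f (z + RtoC t * 1)%C = 0%C).
  { intros t. apply Hf. unfold HH in *. simpl. unfold Im in *. lra. }
  rewrite Cmult_1_r in R2. destruct R2 as [Q1 Q2]. apply C_ext.
  - rewrite <- (is_derive_unique _ _ _ Q1).
    rewrite (Derive_ext _ (fun _ => 0)) by (intros; now rewrite E). apply Derive_const.
  - rewrite <- (is_derive_unique _ _ _ Q2).
    rewrite (Derive_ext _ (fun _ => 0)) by (intros; now rewrite E). apply Derive_const.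
Qed.

Lemma in_CM_bound M phi : (forall p, 0 < M p) -> in_CM M phi ->
  exists h K, 0 < h /\ 0 <= K /\ (forall x, 0 < x -> ccont phi x) /\
    forall p x, 0 < x -> x ^ p * Cmod (phi x) <= K * h ^ p * M p.
Proof.
  intros Mp [Hc [h [K [Hh HK]]]]. exists h, K. split; [exact Hh | split; [| split; [| exact HK]]].
  - assert (Q := HK 0%nat 1 ltac:(lra)). simpl in Q. rewrite Rmult_1_l, Rmult_1_r in Q.
    assert (Q2 := Cmod_ge_0 (phi 1)). specialize (Mp 0%nat). nra.
  - intros x Hx. now apply continuous_ccont, Hc.
Qed.

Lemma exp_INR_mult n y : exp (INR n * y) = exp y ^ n.
Proof.
  induction n as [|n IH]; [simpl; rewrite Rmult_0_l; apply exp_0 |].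
  rewrite S_INR, Rmult_plus_distr_r, exp_plus, IH, Rmult_1_l. simpl. ring.
Qed.

Lemma moment_term_laplace_factor phi p (r : R) y :
  (cexp (Ci * (Ci * RtoC r) * RtoC (exp y)) * (Ci ^ p * moment_term phi p y))%C =
  (Ci ^ p * (RtoC (exp (INR (S p) * y - r * exp y)) * phi (exp y)))%C.
Proof.
  replace (Ci * (Ci * RtoC r) * RtoC (exp y))%C with (RtoC (- (r * exp y))).
  2: { apply C_ext; simpl; ring. }
  rewrite cexp_RtoC. unfold moment_term.
  replace (exp (INR (S p) * y - r * exp y)) with (exp (- (r * exp y)) * (exp y ^ p * exp y)).
  - rewrite (RtoC_mult (exp (- (r * exp y)))). ring.
  - replace (exp y ^ p * exp y) with (exp y ^ S p) by (simpl; ring).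
    rewrite <- exp_INR_mult, <- exp_plus. f_equal. ring.
Qed.

Theorem CM_injective_of_B_injective M :
  weight_seq M -> weight_seq (Mtilde M) -> B_injective (Mtilde M) -> moment_injective (in_CM M).
Proof.
  intros HM HMt HB phi psi m Hphi Hpsi Mphi Mpsi x0 Hx0.
  assert (Mp : forall p, 0 < M p) by apply HM.
  destruct (in_CM_bound M phi Mp Hphi) as [h1 [K1 [Hh1 [HK1 [C1 B1]]]]].
  destruct (in_CM_bound M psi Mp Hpsi) as [h2 [K2 [Hh2 [HK2 [C2' B2]]]]].
  set (h := Rmax h1 h2). assert (E1 : h1 <= h) by apply Rmax_l. assert (E2 : h2 <= h) by apply Rmax_r.
  set (K := K1 + K2). set (chi := fun x => (phi x - psi x)%C).
  assert (Hh : 0 < h) by lra. assert (HK : 0 <= K) by (unfold K; lra).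
  assert (Cc : forall x, 0 < x -> ccont chi x) by (intros; apply ccont_minus; auto).
  assert (Bc : forall p x, 0 < x -> x ^ p * Cmod (chi x) <= K * h ^ p * M p).
  { intros p x Hx. assert (P := pow_lt x p Hx).
    apply Rle_trans with (x ^ p * (Cmod (phi x) + Cmod (psi x))).
    - apply Rmult_le_compat_l; [lra |]. eapply Rle_trans; [apply Cmod_triangle |]. rewrite Cmod_opp. lra.
    - specialize (B1 p x Hx). specialize (B2 p x Hx).
      assert (U1 : K1 * h1 ^ p * M p <= K1 * h ^ p * M p).
      { apply Rmult_le_compat_r; [left; apply Mp |]. apply Rmult_le_compat_l; [exact HK1 | apply pow_incr; lra]. }
      assert (U2 : K2 * h2 ^ p * M p <= K2 * h ^ p * M p).
      { apply Rmult_le_compat_r; [left; apply Mp |]. apply Rmult_le_compat_l; [exact HK2 | apply pow_incr; lra]. }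
      unfold K. lra. }
  assert (Z : forall p, cint_R (moment_term chi p) = 0%C).
  { intros p. destruct (cdominated_moment_term M phi h1 K1 HM C1 Hh1 HK1 B1 p) as [L1 D1].
    destruct (cdominated_moment_term M psi h2 K2 HM C2' Hh2 HK2 B2 p) as [L2 D2].
    rewrite (cint_R_ext _ (fun y => moment_term phi p y - moment_term psi p y)%C) by (intros; unfold moment_term, chi; ring).
    rewrite (cint_R_minus _ _ _ _ D1 D2), (moment_term_lim phi p (m p) C1 (Mphi p)), (moment_term_lim psi p (m p) C2' (Mpsi p)). ring. }
  assert (LF0 : forall z, HH z -> laplace_deriv chi 0 z = 0%C).
  { intros z Hz. apply (HB (laplace_deriv chi) (fun _ _ => 0%C) (fun _ => 0%C)); [| | | | exact Hz].
    - split.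
      + intros p w Hw. now apply (laplace_deriv_derive M chi h K HM Cc Hh HK Bc).
      + exists h, (2 * (K * h)). split; [exact Hh |]. intros p w Hw.
        apply (laplace_deriv_bound M chi h K HM Cc Hh HK Bc). unfold HH in Hw. lra.
    - split.
      + intros p w Hw. apply @is_derive_const.
      + exists 1, 0. split; [lra |]. intros p w Hw. rewrite Cmod_0. lra.
    - intros p. apply (laplace_deriv_at_0 M chi h K HM Cc Hh HK Bc), Z.
    - intros p. apply ext_value_eps. intros e He. exists 1. split; [lra |]. intros.
      replace (0 - 0)%C with (RtoC 0) by ring. now rewrite Cmod_0. }
  assert (LFp : forall p z, HH z -> laplace_deriv chi p z = 0%C).
  { induction p as [|p IH]; [exact LF0 |]. intros z Hz.
    apply (is_derive_C_zero (laplace_deriv chi p) z); auto. now apply (laplace_deriv_derive M chi h K HM Cc Hh HK Bc). }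
  set (y0 := ln x0). assert (Ey0 : exp y0 = x0) by (apply exp_ln, Hx0).
  set (q := fun y => chi (exp y)).
  assert (Cq : forall y, ccont q y) by (intros; now apply ccont_exp).
  (* With x0 = e^(y0), the kernel is a constant times x^(p+1) e^(-(p+1) x / x0). It is produced by
     the p-th derivative of the transform at z = i (p+1) / x0, the extra power of x being the
     Jacobian of x = e^y. *)
  assert (QE : forall p y, INR (S p) * gumbel (y - y0) = INR (S p) * y - (INR (S p) * exp (- y0)) * exp y + INR (S p) * (1 - y0)).
  { intros p y. unfold gumbel. replace (y - y0) with (y + - y0) at 2 by ring. rewrite exp_plus. ring. }
  destruct (cdominated_moment_term M chi h K HM Cc Hh HK Bc 0) as [L DL].
  assert (D0 : cdominated (fun y => RtoC (exp (INR 1 * gumbel (y - y0))) * q y)%C (exp (INR 1 * (1 - y0)) * L)).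
  { split.
    - intros y. apply ccont_mult; [| apply Cq].
      split; [apply gumbel_continuous | apply continuous_const].
    - intros y. destruct DL as [_ DB]. specialize (DB y). rewrite Cmod_moment_term in DB. simpl pow in DB. fold (q y) in DB.
      rewrite Cmod_mult, Cmod_R, Rabs_right by (left; apply exp_pos).
      rewrite QE, exp_plus. rewrite Rmult_1_l in DB.
      replace (exp (INR 1 * (1 - y0)) * L * om y) with (exp (INR 1 * (1 - y0)) * (L * om y)) by ring.
      rewrite (Rmult_comm (exp _) (exp (INR 1 * (1 - y0)))), Rmult_assoc.
      apply Rmult_le_compat_l; [left; apply exp_pos |].
      eapply Rle_trans; [| exact DB]. apply Rmult_le_compat_r; [apply Cmod_ge_0 |].
      apply exp_le_mono. simpl INR. assert (P1 := exp_pos y). assert (P2 := exp_pos (- y0)). nra. }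
  assert (IZ : forall p, cint_R (fun y => RtoC (exp (INR (S p) * gumbel (y - y0))) * q y)%C = 0%C).
  { intros p. set (r := INR (S p) * exp (- y0)).
    assert (Hr : 0 < r). { apply Rmult_lt_0_compat; [apply lt_0_INR; lia | apply exp_pos]. }
    assert (Hz : HH (Ci * RtoC r)). { unfold HH. simpl. lra. }
    assert (E := LFp p _ Hz).
    destruct (cdominated_moment_term M chi h K HM Cc Hh HK Bc p) as [Lp Dp].
    assert (DD := cdominated_laplace_term chi Cc p (Ci * RtoC r) Lp ltac:(unfold HH in Hz; lra) Dp).
    set (c := (RtoC (exp (INR (S p) * (1 - y0))) * (- Ci) ^ p)%C).
    rewrite (cint_R_ext _ (fun y => c * (cexp (Ci * (Ci * RtoC r) * RtoC (exp y)) * (Ci ^ p * moment_term chi p y)))%C).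
    - rewrite (cint_R_scal _ _ _ DD). unfold laplace_deriv in E. rewrite E. ring.
    - intros y. rewrite moment_term_laplace_factor, QE, exp_plus, RtoC_mult. unfold c. fold r. fold (q y).
      assert (EI : ((- Ci) ^ p * Ci ^ p)%C = 1%C).
      { rewrite <- Cpow_mult_l. replace (- Ci * Ci)%C with (RtoC 1) by (apply C_ext; simpl; ring).
        clear. induction p; [reflexivity |]. rewrite Cpow_S, IHp. ring. }
      transitivity (((- Ci) ^ p * Ci ^ p) * (RtoC (exp (INR (S p) * (1 - y0))) *
        (RtoC (exp (INR (S p) * y - r * exp y)) * q y)))%C; [rewrite EI; ring | ring]. }
  assert (W : forall (P : C -> R), (forall (a : R) z, P (RtoC a * z)%C = a * P z) ->
    (forall y, continuous (fun y => P (q y)) y) ->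
    (forall f K, cdominated f K -> dominated (fun y => P (f y)) K) ->
    (forall f, cint_R f = 0%C -> int_R (fun y => P (f y)) = 0) -> P (q y0) = 0).
  { intros P Pl Pc Pd Pi.
    apply (laplace_unique (fun y => P (q y)) (exp (INR 1 * (1 - y0)) * L)); [exact Pc | |].
    - destruct (Pd _ _ D0) as [Da Db]. split.
      + intros y. eapply continuous_ext; [| apply Da]. intros; simpl. now rewrite Pl.
      + intros y. specialize (Db y). cbv beta in Db. rewrite Pl in Db. exact Db.
    - intros n. rewrite <- (Pi _ (IZ n)). apply int_R_ext. intros y. now rewrite Pl. }
  assert (Zq : q y0 = 0%C).
  { apply C_ext.
    - apply W.
      + intros; simpl; unfold Re; ring.
      + intros; apply Cq.
      + intros; now apply cdominated_re.
      + intros f E. exact (f_equal Re E).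
    - apply W.
      + intros; simpl; unfold Im; ring.
      + intros; apply Cq.
      + intros; now apply cdominated_im.
      + intros f E. exact (f_equal Im E). }
  unfold q, chi in Zq. rewrite Ey0 in Zq.
  replace (phi x0) with (phi x0 - psi x0 + psi x0)%C by ring. rewrite Zq. ring.
Qed.

(** * An outer function with prescribed decay *)

(** Sum over k < n, starting from the empty sum, unlike [sum_n]. *)
Fixpoint psum (f : nat -> R) (n : nat) : R :=
  match n with O => 0 | S m => psum f m + f m end.

Lemma psum_S f n : psum f (S n) = psum f n + f n.
Proof. reflexivity. Qed.

Lemma psum_mono f n m : (forall k, 0 <= f k) -> (n <= m)%nat -> psum f n <= psum f m.
Proof. intros Hf H. induction H; [lra |]. simpl. specialize (Hf m). lra. Qed.

Lemma psum_le_lim f (l : R) n : (forall k, 0 <= f k) -> is_lim_seq (psum f) l -> psum f n <= l.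
Proof.
  intros Hf Hl. apply (is_lim_seq_incr_compare (psum f) l); [exact Hl |].
  intros k. simpl. specialize (Hf k). lra.
Qed.

(** A Cauchy criterion with a rate; the remainder s - psum c n is the error used in all later
    approximations by partial products. *)
Lemma seq_conv (u c : nat -> R) (a s : R) : 0 <= a -> (forall n, 0 <= c n) ->
  (forall n, Rabs (u (S n) - u n) <= a * c n) -> is_lim_seq (psum c) s ->
  is_lim_seq u (real (Lim_seq u)) /\
  forall n, Rabs (real (Lim_seq u) - u n) <= a * (s - psum c n).
Proof.
  intros Ha Hc Hu Hs.
  assert (D : forall n m, (n <= m)%nat -> Rabs (u m - u n) <= a * (psum c m - psum c n)).
  { intros n m H. induction H as [| m H IH].
    - rewrite !Rminus_eq_0, Rabs_R0. lra.
    - replace (u (S m) - u n) with ((u (S m) - u m) + (u m - u n)) by ring.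
      eapply Rle_trans; [apply Rabs_triang |]. specialize (Hu m). simpl. lra. }
  assert (Hle : forall n, psum c n <= s) by (intros; now apply psum_le_lim).
  assert (L : is_lim_seq u (real (Lim_seq u))).
  { assert (F : ex_finite_lim_seq (fun n => u n + a * psum c n)).
    { apply ex_finite_lim_seq_incr with (u 0%nat + 2 * a * s).
      - intros n. specialize (Hu n). apply Rabs_le_between in Hu. simpl. lra.
      - intros n. specialize (D 0%nat n ltac:(lia)). apply Rabs_le_between in D. simpl in D.
        assert (a * psum c n <= a * s) by (apply Rmult_le_compat_l; auto). lra. }
    destruct F as [l Hl].
    assert (Q : is_lim_seq u (l - a * s)).
    { apply is_lim_seq_ext with (fun n => (u n + a * psum c n) - a * psum c n); [intros; ring |].
      apply is_lim_seq_minus'; [exact Hl |]. apply (is_lim_seq_scal_l (psum c) a s), Hs. }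
    rewrite (is_lim_seq_unique _ _ Q). exact Q. }
  split; [exact L |]. intros n.
  apply (is_lim_seq_le_loc (fun m => Rabs (u m - u n)) (fun _ => a * (s - psum c n))
    (Rabs (real (Lim_seq u) - u n)) (a * (s - psum c n))).
  - exists n. intros m Hm. eapply Rle_trans; [now apply D |]. apply Rmult_le_compat_l; [exact Ha |].
    specialize (Hle m). lra.
  - apply (is_lim_seq_abs _ (Finite _)). apply is_lim_seq_minus'; [exact L | apply is_lim_seq_const].
  - apply is_lim_seq_const.
Qed.

Lemma psum_sum_n f n : psum f (S n) = sum_n f n.
Proof.
  induction n as [|n IH]; [rewrite sum_O; simpl; ring |].
  rewrite sum_Sn, <- IH. reflexivity.
Qed.

Lemma bounded_of_not_divergent (f : nat -> R) : (forall k, 0 <= f k) ->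
  ~ is_lim_seq (sum_n f) p_infty -> exists B, forall n, psum f n <= B.
Proof.
  intros Hf H. apply NNPP. intros HN. apply H.
  apply is_lim_seq_spec. intros B.
  destruct (not_all_ex_not _ _ (fun Q => HN (ex_intro _ B Q))) as [N HNN].
  exists N. intros n Hn. rewrite <- psum_sum_n.
  assert (Q := psum_mono f N (S n) Hf ltac:(lia)). lra.
Qed.

Lemma psum_ex_lim (f : nat -> R) B : (forall k, 0 <= f k) -> (forall n, psum f n <= B) ->
  exists s : R, is_lim_seq (psum f) s.
Proof.
  intros Hf HB. destruct (ex_finite_lim_seq_incr (psum f) B) as [s Hs].
  - intros n. simpl. specialize (Hf n). lra.
  - exact HB.
  - now exists s.
Qed.

Lemma ln_le_minus_1 x : 0 < x -> ln x <= x - 1.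
Proof.
  intros Hx. assert (H := exp_ineq1_le (ln x)). rewrite exp_ln in H by exact Hx. lra.
Qed.

(* Either [quot M (p+2) <= 4 quot M (p+1)], and the logarithmic factor of [Mtilde] is bounded,
   or the terms decrease geometrically; in both cases the bound telescopes. *)
Lemma quot_sum_bounded (M : nat -> R) (B : R) : weight_seq M ->
  (forall n, psum (fun p => / sqrt (quot (Mtilde M) p)) n <= B) ->
  exists s : R, is_lim_seq (psum (fun p => / sqrt (quot M p))) s.
Proof.
  intros HM HB. assert (Mp : forall p, 0 < M p) by apply HM.
  set (m := quot M). assert (Hm : forall p, 0 < m p) by (intros; now apply quot_pos).
  assert (Hmm : forall p, m p <= m (S p)) by (intros; now apply weight_seq_quot).
  set (x := fun p => / sqrt (m p)).
  assert (Hsq : forall p, 0 < sqrt (m p)) by (intros; apply sqrt_lt_R0, Hm).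
  assert (Hx : forall p, 0 < x p) by (intros; apply Rinv_0_lt_compat, Hsq).
  set (L := fun p => ln (exp 2 * quot M (S p) / quot M p)).
  assert (HL : forall p, L p = 2 + ln (m (S p) / m p)).
  { intros p. unfold L, Rdiv. rewrite Rmult_assoc, ln_mult, ln_exp; [reflexivity | apply exp_pos |].
    apply Rmult_lt_0_compat; [apply Hm | apply Rinv_0_lt_compat, Hm]. }
  assert (HL2 : forall p, 2 <= L p).
  { intros p. rewrite HL. assert (0 <= ln (m (S p) / m p)); [| lra].
    rewrite <- ln_1. apply ln_le; [lra |].
    apply Rmult_le_reg_r with (m p); [apply Hm |]. unfold Rdiv. rewrite Rmult_assoc, Rinv_l by (assert (Q := Hm p); lra).
    specialize (Hmm p). lra. }
  assert (Hmt : forall p, quot (Mtilde M) p = m (S p) * L (S p) / L p).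
  { intros p. unfold quot at 1, Mtilde. fold (L p) (L (S p)). unfold m, quot. assert (Q := Mp (S p)).
    field. specialize (HL2 p). lra. }
  assert (K : forall p, x (S p) <= 2 * / sqrt (quot (Mtilde M) p) + 2 * (x (S p) - x (S (S p)))).
  { intros p. assert (Hxp := Hx (S p)). assert (Hxp2 := Hx (S (S p))).
    assert (Hmtp : 0 < quot (Mtilde M) p).
    { rewrite Hmt. assert (Q := HL2 p). assert (Q' := HL2 (S p)). assert (Q2 := Hm (S p)).
      apply Rdiv_lt_0_compat; nra. }
    assert (Hst : 0 < / sqrt (quot (Mtilde M) p)) by (apply Rinv_0_lt_compat, sqrt_lt_R0, Hmtp).
    (* In the first case the telescoping term suffices. Otherwise m_(p+2) < 4 m_(p+1), so [L (S p)]
       <= 2 + (4 - 1) by ln r <= r - 1, while [L p] >= 2; the ratio 5/2 is rounded up to 4, whose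
       square root is 2. *)
    destruct (Rle_dec (x (S (S p))) (x (S p) / 2)) as [Hc | Hc]; [lra |].
    assert (Hs : sqrt (m (S (S p))) < 2 * sqrt (m (S p))).
    { assert (S1 := Hsq (S p)). assert (S2 := Hsq (S (S p))).
      apply Rnot_le_lt in Hc. unfold x in Hc.
      apply Rmult_lt_compat_r with (r := 2 * sqrt (m (S p)) * sqrt (m (S (S p)))) in Hc; [| nra].
      replace (/ sqrt (m (S p)) / 2 * (2 * sqrt (m (S p)) * sqrt (m (S (S p))))) with (sqrt (m (S (S p)))) in Hc by (field; lra).
      replace (/ sqrt (m (S (S p))) * (2 * sqrt (m (S p)) * sqrt (m (S (S p))))) with (2 * sqrt (m (S p))) in Hc by (field; lra).
      exact Hc. }
    assert (Hm4 : m (S (S p)) < 4 * m (S p)).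
    { rewrite <- (sqrt_sqrt (m (S (S p)))) by (left; apply Hm).
      rewrite <- (sqrt_sqrt (m (S p))) by (left; apply Hm).
      assert (S1 := Hsq (S p)). assert (S2 := Hsq (S (S p))). nra. }
    assert (HL5 : L (S p) <= 5).
    { rewrite HL. assert (Q := Hm (S p)). assert (Q' := Hm (S (S p))).
      assert (T := ln_le_minus_1 (m (S (S p)) / m (S p)) ltac:(now apply Rdiv_lt_0_compat)).
      assert (m (S (S p)) / m (S p) < 4).
      { apply Rmult_lt_reg_r with (m (S p)); [exact Q |]. replace (m (S (S p)) / m (S p) * m (S p)) with (m (S (S p))) by (field; lra). exact Hm4. }
      lra. }
    assert (Hle : quot (Mtilde M) p <= 4 * m (S p)).
    { rewrite Hmt. assert (Q := HL2 p). assert (Q2 := Hm (S p)).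
      apply Rmult_le_reg_r with (L p); [lra |].
      replace (m (S p) * L (S p) / L p * L p) with (m (S p) * L (S p)) by (field; lra). nra. }
    assert (Hsle : sqrt (quot (Mtilde M) p) <= 2 * sqrt (m (S p))).
    { replace 2 with (sqrt 4).
      - rewrite <- sqrt_mult_alt by lra. now apply sqrt_le_1_alt.
      - replace 4 with (2 * 2) by ring. apply sqrt_square. lra. }
    assert (x (S p) <= 2 * / sqrt (quot (Mtilde M) p)).
    { unfold x. assert (S1 := Hsq (S p)). assert (S3 : 0 < sqrt (quot (Mtilde M) p)) by now apply sqrt_lt_R0.
      apply Rmult_le_reg_r with (sqrt (m (S p)) * sqrt (quot (Mtilde M) p)); [nra |].
      replace (/ sqrt (m (S p)) * (sqrt (m (S p)) * sqrt (quot (Mtilde M) p))) with (sqrt (quot (Mtilde M) p)) by (field; lra).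
      replace (2 * / sqrt (quot (Mtilde M) p) * (sqrt (m (S p)) * sqrt (quot (Mtilde M) p))) with (2 * sqrt (m (S p))) by (field; lra).
      exact Hsle. }
    assert (Hmon : x (S (S p)) <= x (S p)).
    { unfold x. apply Rinv_le_contravar; [apply Hsq |]. apply sqrt_le_1_alt, Hmm. }
    lra. }
  assert (T : forall n, psum x (S n) <= x 0%nat + 2 * B + 2 * (x 1%nat - x (S n))).
  { intros n. assert (T1 : psum x (S n) <= x 0%nat + 2 * psum (fun p => / sqrt (quot (Mtilde M) p)) n + 2 * (x 1%nat - x (S n))).
    { induction n as [|n IH]; [simpl; lra |].
      change (psum x (S (S n))) with (psum x (S n) + x (S n)).
      specialize (K n). simpl (psum _ (S n)) at 2. simpl psum in *. lra. }
    specialize (HB n). lra. }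
  apply psum_ex_lim with (x 0%nat + 2 * B + 2 * x 1%nat).
  - intros k. left. apply Hx.
  - intros n. specialize (T n). assert (Q := Hx (S n)). assert (Q2 := Hx n).
    assert (E : psum x (S n) = psum x n + x n) by reflexivity.
    fold x. change (psum x n <= x 0%nat + 2 * B + 2 * x 1%nat). lra.
Qed.

Lemma atan_lipschitz a b : Rabs (atan a - atan b) <= Rabs (a - b).
Proof.
  destruct (MVT_gen atan b a (fun x => / (1 + x²))) as [c [_ Hc]].
  - intros x _. eapply is_derive_eq; [apply is_derive_atan | reflexivity].
  - intros x _. eapply is_derive_cont_pt, is_derive_atan.
  - rewrite Hc, Rabs_mult. assert (Q := Rle_0_sqr c).
    assert (E : 0 < / (1 + c²) <= 1).
    { split; [apply Rinv_0_lt_compat; lra |]. rewrite <- Rinv_1. apply Rinv_le_contravar; lra. }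
    rewrite (Rabs_right (/ (1 + c²))) by lra. assert (P := Rabs_pos (a - b)). nra.
Qed.

(** From 1 + a^2 <= (1 + b^2) (1 + |a - b|)^2 and ln (1 + d) <= d. *)
Lemma ln_sq_lipschitz a b : Rabs (ln (1 + a ^ 2) - ln (1 + b ^ 2)) <= 2 * Rabs (a - b).
Proof.
  assert (W : forall a b, ln (1 + a ^ 2) - ln (1 + b ^ 2) <= 2 * Rabs (a - b)).
  { clear. intros a b. set (d := Rabs (a - b)). assert (Hd : 0 <= d) by apply Rabs_pos.
    assert (Q1 := pow2_ge_0 a). assert (Q2 := pow2_ge_0 b).
    assert (H : 1 + a ^ 2 <= (1 + b ^ 2) * ((1 + d) * (1 + d))).
    { assert (D1 : (a - b) ^ 2 = d ^ 2) by (unfold d; now rewrite pow2_abs).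
      assert (D2 : a - b <= d) by apply Rle_abs.
      assert (D3 : - (a - b) <= d) by (unfold d; rewrite <- Rabs_Ropp; apply Rle_abs).
      assert (D4 : 2 * b * (a - b) <= d * (1 + b ^ 2)).
      { assert (U1 := Rmult_le_pos _ _ Hd (pow2_ge_0 (1 - b))). assert (U2 := Rmult_le_pos _ _ Hd (pow2_ge_0 (1 + b))).
        destruct (Rle_dec 0 b) as [Hb | Hb].
        - assert (b * (a - b) <= b * d) by (apply Rmult_le_compat_l; lra). nra.
        - assert (- b * - (a - b) <= - b * d) by (apply Rmult_le_compat_l; lra). nra. }
      assert (E : a ^ 2 = b ^ 2 + 2 * b * (a - b) + (a - b) ^ 2) by ring. rewrite E, D1. nra. }
    apply ln_le in H; [| lra].
    rewrite ln_mult, ln_mult in H by nra.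
    assert (T := ln_le_minus_1 (1 + d) ltac:(lra)). lra. }
  apply Rabs_le. split.
  - assert (Q := W b a). rewrite Rabs_minus_sym in Q. lra.
  - apply W.
Qed.

Lemma cos_sin_2atan a :
  cos (2 * atan a) = (1 - a ^ 2) / (1 + a ^ 2) /\ sin (2 * atan a) = 2 * a / (1 + a ^ 2).
Proof.
  assert (Q := pow2_ge_0 a).
  assert (S : sqrt (1 + a²) * sqrt (1 + a²) = 1 + a ^ 2).
  { replace (1 + a²) with (1 + a ^ 2) by (unfold Rsqr; ring). apply sqrt_sqrt. lra. }
  assert (Sp : 0 < sqrt (1 + a²)) by (apply sqrt_lt_R0; unfold Rsqr; nra).
  rewrite cos_2a, sin_2a, cos_atan, sin_atan. rewrite <- S. split; field_simplify; try lra.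
  all: rewrite ?pow2_sqrt by (unfold Rsqr; nra); unfold Rsqr; field; nra.
Qed.

(** * Boundary values of the infinite product in polar form *)

Section Outer.

Variables (c : nat -> R) (s : R).
Hypothesis c_pos : forall k, 0 < c k.
Hypothesis c_sum : is_lim_seq (psum c) s.

(** At w = it, the factor (1 + i c_k t)^(-2) is exp (- ln (1 + (c_k t)^2) - 2 i atan (c_k t)). Thus
    [lam_n] is minus the logarithm of the modulus of a partial product and [th_n] is minus its
    argument; the infinite product is handled through these real series. *)
Definition lam_n (n : nat) (t : R) : R := psum (fun k => ln (1 + (c k * t) ^ 2)) n.
Definition th_n (n : nat) (t : R) : R := psum (fun k => 2 * atan (c k * t)) n.
Definition lam (t : R) : R := real (Lim_seq (fun n => lam_n n t)).
Definition th (t : R) : R := real (Lim_seq (fun n => th_n n t)).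

Lemma c_nonneg k : 0 <= c k.
Proof. left; apply c_pos. Qed.

Lemma lam_conv t : is_lim_seq (fun n => lam_n n t) (lam t) /\
  forall n, Rabs (lam t - lam_n n t) <= 2 * Rabs t * (s - psum c n).
Proof.
  apply (seq_conv (fun n => lam_n n t) c (2 * Rabs t) s); [| apply c_nonneg | | exact c_sum].
  - assert (Q := Rabs_pos t). lra.
  - intros n. unfold lam_n. rewrite psum_S.
    replace (psum (fun k => ln (1 + (c k * t) ^ 2)) n + ln (1 + (c n * t) ^ 2) - psum (fun k => ln (1 + (c k * t) ^ 2)) n)
      with (ln (1 + (c n * t) ^ 2) - ln (1 + 0 ^ 2)).
    + eapply Rle_trans; [apply ln_sq_lipschitz |]. rewrite Rminus_0_r, Rabs_mult, (Rabs_right (c n)) by (assert (Q := c_pos n); lra). lra.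
    + replace (1 + 0 ^ 2) with 1 by ring. rewrite ln_1. ring.
Qed.

Lemma th_conv t : is_lim_seq (fun n => th_n n t) (th t) /\
  forall n, Rabs (th t - th_n n t) <= 2 * Rabs t * (s - psum c n).
Proof.
  apply (seq_conv (fun n => th_n n t) c (2 * Rabs t) s); [| apply c_nonneg | | exact c_sum].
  - assert (Q := Rabs_pos t). lra.
  - intros n. unfold th_n. rewrite psum_S.
    replace (psum (fun k => 2 * atan (c k * t)) n + 2 * atan (c n * t) - psum (fun k => 2 * atan (c k * t)) n)
      with (2 * (atan (c n * t) - atan 0)) by (rewrite atan_0; ring).
    rewrite Rabs_mult, (Rabs_right 2) by lra.
    assert (Q := atan_lipschitz (c n * t) 0). rewrite Rminus_0_r, Rabs_mult, (Rabs_right (c n)) in Q by (assert (Q2 := c_pos n); lra). lra.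
Qed.

Lemma psum_lipschitz (f g : nat -> R) (a : R) n :
  (forall k, Rabs (f k - g k) <= a * c k) -> Rabs (psum f n - psum g n) <= a * psum c n.
Proof.
  intros H. induction n as [|n IH]; [simpl; rewrite Rminus_eq_0, Rabs_R0; lra |].
  simpl. replace (psum f n + f n - (psum g n + g n)) with ((psum f n - psum g n) + (f n - g n)) by ring.
  eapply Rle_trans; [apply Rabs_triang |]. specialize (H n). lra.
Qed.

Lemma lipschitz_limit (u : nat -> R -> R) (v : R -> R) (t t' : R) :
  is_lim_seq (fun n => u n t) (v t) -> is_lim_seq (fun n => u n t') (v t') ->
  (forall n, Rabs (u n t - u n t') <= 2 * Rabs (t - t') * psum c n) ->
  Rabs (v t - v t') <= 2 * Rabs (t - t') * s.
Proof.
  intros H1 H2 H. apply is_lim_seq_abs_le with (fun n => u n t - u n t').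
  - now apply is_lim_seq_minus'.
  - intros n. eapply Rle_trans; [apply H |]. assert (Q := Rabs_pos (t - t')).
    apply Rmult_le_compat_l; [lra |]. apply psum_le_lim; [apply c_nonneg | exact c_sum].
Qed.

Lemma lam_lipschitz t t' : Rabs (lam t - lam t') <= 2 * Rabs (t - t') * s.
Proof.
  apply (lipschitz_limit lam_n); try apply lam_conv. intros n. apply psum_lipschitz. intros k.
  eapply Rle_trans; [apply ln_sq_lipschitz |].
  replace (c k * t - c k * t') with (c k * (t - t')) by ring.
  rewrite Rabs_mult, (Rabs_right (c k)) by (assert (Q := c_pos k); lra). lra.
Qed.

Lemma th_lipschitz t t' : Rabs (th t - th t') <= 2 * Rabs (t - t') * s.
Proof.
  apply (lipschitz_limit th_n); try apply th_conv. intros n. apply psum_lipschitz. intros k.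
  replace (2 * atan (c k * t) - 2 * atan (c k * t')) with (2 * (atan (c k * t) - atan (c k * t'))) by ring.
  rewrite Rabs_mult, (Rabs_right 2) by lra.
  assert (Q := atan_lipschitz (c k * t) (c k * t')).
  replace (c k * t - c k * t') with (c k * (t - t')) in Q by ring.
  rewrite Rabs_mult, (Rabs_right (c k)) in Q by (assert (Q' := c_pos k); lra). lra.
Qed.

Lemma lipschitz_continuous (f : R -> R) (L : R) :
  (forall t t', Rabs (f t - f t') <= 2 * Rabs (t - t') * L) -> forall t, continuous f t.
Proof.
  intros H t. apply continuous_eps. intros e He.
  assert (HL : 0 <= L).
  { specialize (H 1 0). assert (Q := Rabs_pos (f 1 - f 0)). rewrite Rminus_0_r, Rabs_R1 in H. lra. }
  exists (e / (2 * (L + 1))). split; [apply Rdiv_lt_0_compat; lra |]. intros y Hy.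
  eapply Rle_lt_trans; [apply H |].
  apply Rlt_le_trans with (2 * (L + 1) * (e / (2 * (L + 1)))); [| right; field; lra].
  assert (Q := Rabs_pos (y - t)). nra.
Qed.

Lemma ln_sq_nonneg a : 0 <= ln (1 + a ^ 2).
Proof. rewrite <- ln_1. apply ln_le; [lra |]. assert (Q := pow2_ge_0 a). lra. Qed.

Lemma lam_n_mono n m t : (n <= m)%nat -> lam_n n t <= lam_n m t.
Proof. apply psum_mono. intros. apply ln_sq_nonneg. Qed.

Lemma lam_n_le_lam n t : lam_n n t <= lam t.
Proof. apply psum_le_lim; [intros; apply ln_sq_nonneg | apply lam_conv]. Qed.

(** Minus the imaginary part of the infinite product at w = it. *)
Definition outer_im (t : R) : R := exp (- lam t) * sin (th t).
Definition outer_im_n (n : nat) (t : R) : R := exp (- lam_n n t) * sin (th_n n t).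

Lemma exp_diff_bound l a b : l <= a -> l <= b -> Rabs (exp (- a) - exp (- b)) <= exp (- l) * Rabs (a - b).
Proof.
  intros Ha Hb.
  assert (W : forall a b, l <= a -> a <= b -> Rabs (exp (- a) - exp (- b)) <= exp (- l) * Rabs (a - b)).
  { clear. intros a b Ha Hab.
    assert (E : exp (- b) = exp (- a) * exp (- (b - a))) by (rewrite <- exp_plus; f_equal; ring).
    assert (P := exp_pos (- a)). assert (Q := exp_ineq1_le (- (b - a))).
    assert (Q2 : exp (- (b - a)) <= 1) by (rewrite <- exp_0; apply exp_le_mono; lra).
    assert (Q3 : exp (- a) <= exp (- l)) by (apply exp_le_mono; lra).
    rewrite Rabs_right by (rewrite E; nra). rewrite Rabs_left1 by lra. rewrite E. nra. }
  destruct (Rle_dec a b); [now apply W |].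
  rewrite Rabs_minus_sym, (Rabs_minus_sym a). apply W; lra.
Qed.

Lemma sin_diff_bound a b : Rabs (sin a - sin b) <= Rabs (a - b).
Proof.
  destruct (MVT_gen sin b a cos) as [x [_ Hx]].
  - intros x _. apply is_derive_sin.
  - intros x _. eapply is_derive_cont_pt, is_derive_sin.
  - rewrite Hx, Rabs_mult. assert (P := Rabs_pos (a - b)).
    assert (Q : Rabs (cos x) <= 1) by (apply Rabs_le; split; apply COS_bound). nra.
Qed.

Lemma expsin_diff l a b al be : l <= a -> l <= b ->
  Rabs (exp (- a) * sin al - exp (- b) * sin be) <= exp (- l) * (Rabs (a - b) + Rabs (al - be)).
Proof.
  intros Ha Hb.
  replace (exp (- a) * sin al - exp (- b) * sin be) with
    ((exp (- a) - exp (- b)) * sin al + exp (- b) * (sin al - sin be)) by ring.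
  eapply Rle_trans; [apply Rabs_triang |]. rewrite !Rabs_mult, Rmult_plus_distr_l.
  assert (S1 : Rabs (sin al) <= 1) by (apply Rabs_le; split; apply SIN_bound).
  assert (E := exp_diff_bound l a b Ha Hb). assert (S2 := sin_diff_bound al be).
  rewrite (Rabs_right (exp (- b))) by (left; apply exp_pos).
  assert (E2 : exp (- b) <= exp (- l)) by (apply exp_le_mono; lra).
  assert (P1 := Rabs_pos (exp (- a) - exp (- b))). assert (P2 := Rabs_pos (sin al - sin be)).
  assert (P3 := exp_pos (- b)).
  apply Rplus_le_compat; [nra |]. apply Rmult_le_compat; lra.
Qed.

(** The decay of a fixed number p of factors is retained while n grows, so the error is both small
    and integrable against powers of t. *)
Lemma outer_im_approx n p t : (p <= n)%nat ->
  Rabs (outer_im t - outer_im_n n t) <= exp (- lam_n p t) * (4 * Rabs t * (s - psum c n)).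
Proof.
  intros H. eapply Rle_trans.
  - apply (expsin_diff (lam_n p t)); [apply lam_n_le_lam | now apply lam_n_mono].
  - apply Rmult_le_compat_l; [left; apply exp_pos |].
    assert (L1 := proj2 (lam_conv t) n). assert (L2 := proj2 (th_conv t) n). lra.
Qed.

Lemma outer_im_bound p t : Rabs (outer_im t) <= exp (- lam_n p t).
Proof.
  unfold outer_im. rewrite Rabs_mult, (Rabs_right (exp _)) by (left; apply exp_pos).
  assert (S1 : Rabs (sin (th t)) <= 1) by (apply Rabs_le; split; apply SIN_bound).
  assert (E : exp (- lam t) <= exp (- lam_n p t)) by (apply exp_le_mono; assert (Q := lam_n_le_lam p t); lra).
  assert (P := exp_pos (- lam t)). assert (P2 := Rabs_pos (sin (th t))). nra.
Qed.

Lemma outer_im_continuous t : continuous outer_im t.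
Proof.
  assert (C1 := lipschitz_continuous lam s lam_lipschitz t).
  assert (half_plane_C2 := lipschitz_continuous th s th_lipschitz t).
  apply cont_mult.
  - apply (continuous_comp (fun t => - lam t) exp).
    + apply (continuous_opp lam), C1.
    + apply (ex_derive_continuous (V := R_NormedModule)). eexists. apply is_derive_exp.
  - apply (continuous_comp th sin); [exact half_plane_C2 |].
    apply (ex_derive_continuous (V := R_NormedModule)). eexists. apply is_derive_sin.
Qed.

Lemma exp_lam_n_S p t : exp (- lam_n (S p) t) = exp (- lam_n p t) * / (1 + (c p * t) ^ 2).
Proof.
  unfold lam_n. rewrite psum_S, Ropp_plus_distr, exp_plus, (exp_Ropp (ln _)), exp_ln; [reflexivity |].
  assert (Q := pow2_ge_0 (c p * t)). lra.
Qed.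

(** One factor at a time, 1 + t^2 <= (1 + 1/c^2) (1 + c^2 t^2). *)
Lemma exp_lam_n_om p : exists K, 0 <= K /\ forall t, exp (- lam_n p t) <= K * om t ^ p.
Proof.
  induction p as [|p [K [HK IH]]].
  - exists 1. split; [lra |]. intros t. unfold lam_n; simpl. rewrite Ropp_0, exp_0. lra.
  - exists (K * (1 + / c p ^ 2)). assert (Hc := c_pos p).
    assert (Hc2 : 0 < / c p ^ 2) by (apply Rinv_0_lt_compat, pow_lt, Hc).
    split; [nra |]. intros t. rewrite exp_lam_n_S. simpl.
    replace (K * (1 + / (c p * (c p * 1))) * (om t * om t ^ p)) with (K * om t ^ p * ((1 + / c p ^ 2) * om t)) by (simpl; ring).
    apply Rmult_le_compat; [left; apply exp_pos | left; apply Rinv_0_lt_compat; assert (Q := pow2_ge_0 (c p * t)); simpl in Q; lra | apply IH |].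
    unfold om. assert (Q := pow2_ge_0 t). assert (Q' := pow2_ge_0 (c p * t)).
    apply Rmult_le_reg_r with ((1 + (c p * t) ^ 2) * (1 + t ^ 2)); [nra |].
    replace (/ (1 + c p * t * (c p * t * 1)) * ((1 + (c p * t) ^ 2) * (1 + t ^ 2))) with (1 + t ^ 2)
      by (field; simpl in Q'; lra).
    replace ((1 + / c p ^ 2) * / (1 + t ^ 2) * ((1 + (c p * t) ^ 2) * (1 + t ^ 2))) with
      ((1 + / c p ^ 2) * (1 + (c p * t) ^ 2)) by (field; split; lra).
    replace ((1 + / c p ^ 2) * (1 + (c p * t) ^ 2)) with (1 + t ^ 2 + (/ c p ^ 2 + (c p * t) ^ 2)) by (field; lra).
    lra.
Qed.

Lemma om_pow_abs m t : Rabs t ^ m * om t ^ m <= 1.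
Proof.
  rewrite <- Rpow_mult_distr.
  assert (H : 0 <= Rabs t * om t <= 1).
  { assert (Q := om_pos t). assert (Q' := Rabs_pos t). split; [nra |].
    unfold om. assert (Q2 := pow2_abs t).
    apply Rmult_le_reg_r with (1 + t ^ 2); [nra |]. rewrite Rmult_assoc, Rinv_l, Rmult_1_r by nra. nra. }
  assert (Q := pow_incr _ 1 m H). now rewrite pow1 in Q.
Qed.

(** m + 2 factors pay for t^(m+1) and leave an integrable [om]; the power m + 1 instead of m makes
    room for the factor |t| of [outer_im_approx]. *)
Lemma moment_weight m : exists K, 0 <= K /\ forall t, Rabs t ^ S m * exp (- lam_n (S (S m)) t) <= K * om t.
Proof.
  destruct (exp_lam_n_om (S (S m))) as [K [HK H]]. exists K. split; [exact HK |]. intros t.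
  assert (P := pow_le _ (S m) (Rabs_pos t)).
  eapply Rle_trans; [apply Rmult_le_compat_l; [exact P | apply H] |].
  assert (Q := om_pow_abs (S m) t). assert (Q2 := om_pos t).
  replace (Rabs t ^ S m * (K * om t ^ S (S m))) with (K * om t * (Rabs t ^ S m * om t ^ S m)) by (simpl; ring).
  assert (0 <= K * om t) by nra. nra.
Qed.

Lemma moment_weight0 m : exists K, 0 <= K /\ forall t, Rabs t ^ m * exp (- lam_n (S m) t) <= K * om t.
Proof.
  destruct (exp_lam_n_om (S m)) as [K [HK H]]. exists K. split; [exact HK |]. intros t.
  assert (P := pow_le _ m (Rabs_pos t)).
  eapply Rle_trans; [apply Rmult_le_compat_l; [exact P | apply H] |].
  assert (Q := om_pow_abs m t). assert (Q2 := om_pos t).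
  replace (Rabs t ^ m * (K * om t ^ S m)) with (K * om t * (Rabs t ^ m * om t ^ m)) by (simpl; ring).
  assert (0 <= K * om t) by nra. nra.
Qed.

End Outer.

Lemma half_plane_C2_const (a : C) : half_plane_C2 (fun _ => 1) (fun _ => a).
Proof.
  exists (fun _ => 0%C), (fun _ => 0%C), (Cmod a). intros v _. assert (H := Cmod_ge_0 a).
  rewrite Cmod_0. split; [apply cder_const | split; [apply cder_const | split; [| split]]]; lra.
Qed.

Lemma half_plane_C2_shift : half_plane_C2 (fun v => Cmod v) (fun v => (v - 1)%C).
Proof.
  exists (fun _ => 1%C), (fun _ => 0%C), 2. intros v Hv. assert (H := Cmod_ge_Re v).
  split; [| split; [apply cder_const | split; [| split]]].
  - eapply cder_eq; [apply cder_plus; [apply cder_id | apply cder_const] | ring].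
  - eapply Rle_trans; [apply Cmod_triangle |]. rewrite Cmod_opp, Cmod_1. lra.
  - rewrite Cmod_1. lra.
  - rewrite Cmod_0. lra.
Qed.

Lemma half_plane_C2_shift_pow m : half_plane_C2 (fun v => Cmod v ^ m) (fun v => (v - 1) ^ m)%C.
Proof.
  induction m as [|m IH]; [exact (half_plane_C2_const 1%C) |].
  apply (half_plane_C2_mult_gen (fun v => Cmod v) (fun v => Cmod v ^ m) (fun v => v - 1)%C (fun v => (v - 1) ^ m)%C); auto using half_plane_C2_shift.
  - intros; apply Cmod_ge_0.
  - intros; apply pow_le, Cmod_ge_0.
Qed.

(** The factor 1/(1 + a w) in the coordinate v = w + 1, which moves the imaginary axis to the line
    of [cauchy_line]. *)
Definition outer_factor (a : R) (v : C) : C := (/ (1 + RtoC a * (v - 1)))%C.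

Lemma outer_factor_den (a : R) (v : C) : 0 < a -> 1 <= Re v ->
  1 <= Re (1 + RtoC a * (v - 1))%C /\ Rmin 1 a * Cmod v <= Cmod (1 + RtoC a * (v - 1))%C.
Proof.
  intros Ha Hv.
  assert (ER : Re (1 + RtoC a * (v - 1))%C = 1 + a * (Re v - 1)) by (simpl; unfold Re; ring).
  assert (EI : Im (1 + RtoC a * (v - 1))%C = a * Im v) by (simpl; unfold Im; ring).
  split; [rewrite ER; nra |].
  set (k := Rmin 1 a). assert (K1 : k <= 1) by apply Rmin_l. assert (K2 : k <= a) by apply Rmin_r.
  assert (K0 : 0 < k) by (apply Rmin_pos; lra).
  apply Rsqr_incr_0_var; [| apply Cmod_ge_0]. rewrite Rsqr_mult, !Rsqr_pow2, !Cmod2_alt, ER, EI.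
  assert (k * Re v <= 1 + a * (Re v - 1)).
  { unfold k, Rmin. destruct (Rle_dec 1 a); nra. }
  assert (k ^ 2 * Im v ^ 2 <= (a * Im v) ^ 2).
  { rewrite Rpow_mult_distr. apply Rmult_le_compat_r; [apply pow2_ge_0 | apply pow_incr; lra]. }
  assert ((k * Re v) ^ 2 <= (1 + a * (Re v - 1)) ^ 2) by (apply pow_incr; nra).
  rewrite Rpow_mult_distr in H1. lra.
Qed.

Lemma half_plane_C2_ufac a : 0 < a -> half_plane_C2 (fun v => / Cmod v) (outer_factor a).
Proof.
  intros Ha. set (k := Rmin 1 a). assert (K0 : 0 < k) by (apply Rmin_pos; lra).
  exists (fun v => - RtoC a * outer_factor a v * outer_factor a v)%C, (fun v => 2 * RtoC a * RtoC a * outer_factor a v * outer_factor a v * outer_factor a v)%C,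
    ((1 + a + 2 * a * a) * / k).
  intros v Hv. destruct (outer_factor_den a v Ha Hv) as [D1 D2]. fold k in D2.
  set (q := (1 + RtoC a * (v - 1))%C) in *. assert (Hq : q <> 0%C) by (apply Re1_nz; lra).
  assert (Hv1 : 1 <= Cmod v) by (assert (H := Cmod_ge_Re v); lra).
  assert (B : Cmod (outer_factor a v) <= / k * / Cmod v).
  { unfold outer_factor. fold q. rewrite Cmod_inv, <- Rinv_mult by exact Hq. apply Rinv_le_contravar; nra. }
  assert (B1 : Cmod (outer_factor a v) <= 1) by (unfold outer_factor; fold q; now apply Cinv_le_1).
  assert (B0 := Cmod_ge_0 (outer_factor a v)).
  assert (Di : cder (outer_factor a) v (- RtoC a * outer_factor a v * outer_factor a v)%C).
  { unfold outer_factor. apply (cder_inv (fun v => 1 + RtoC a * (v - 1))%C); [| exact Hq].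
    eapply cder_eq; [apply cder_plus; [apply cder_const | apply cder_scal, cder_plus; [apply cder_id | apply cder_const]] | ring]. }
  assert (Hw : 0 < / k * / Cmod v) by (apply Rmult_lt_0_compat; apply Rinv_0_lt_compat; lra).
  split; [exact Di | split; [| split; [| split]]].
  - eapply cder_eq; [apply cder_mult; [apply cder_scal; exact Di | exact Di] |]. cbv beta. ring.
  - rewrite Rmult_assoc. nra.
  - rewrite !Cmod_mult, Cmod_opp, Cmod_R, (Rabs_right a), !Rmult_assoc by lra.
    assert (Cmod (outer_factor a v) * Cmod (outer_factor a v) <= / k * / Cmod v) by nra. nra.
  - rewrite !Cmod_mult, !Cmod_R, (Rabs_right a), (Rabs_right 2), !Rmult_assoc by lra.
    assert (Cmod (outer_factor a v) * Cmod (outer_factor a v) <= / k * / Cmod v) by nra.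
    assert (Cmod (outer_factor a v) * (Cmod (outer_factor a v) * Cmod (outer_factor a v)) <= / k * / Cmod v) by nra.
    assert (0 <= 2 * (a * a)) by nra.
    apply Rle_trans with (2 * (a * a) * (/ k * / Cmod v)); [nra |]. nra.
Qed.

Section OuterMoments.

Variables (c : nat -> R) (s : R).
Hypothesis c_pos : forall k, 0 < c k.
Hypothesis c_sum : is_lim_seq (psum c) s.

Fixpoint outer_prod (n : nat) (v : C) : C :=
  match n with O => 1%C | S m => (outer_prod m v * (outer_factor (c m) v * outer_factor (c m) v))%C end.

Lemma half_plane_C2_Uprod n : half_plane_C2 (fun v => (/ Cmod v) ^ (2 * n)) (outer_prod n).
Proof.
  assert (P : forall v : C, 1 <= Re v -> 0 <= / Cmod v).
  { intros v Hv. left. apply Rinv_0_lt_compat. assert (H := Cmod_ge_Re v). lra. }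
  induction n as [|n IH]; [exact (half_plane_C2_const 1%C) |].
  apply half_plane_C2_le with (fun v => (/ Cmod v) ^ (2 * n) * (/ Cmod v * / Cmod v)).
  - intros v Hv. replace (2 * S n)%nat with (2 * n + 2)%nat by lia. rewrite pow_add. specialize (P v Hv).
    assert (Q := pow_le _ (2 * n) P). split; [apply Rmult_le_pos; nra | right; ring].
  - apply (half_plane_C2_mult_gen (fun v => (/ Cmod v) ^ (2 * n)) (fun v => / Cmod v * / Cmod v)
      (outer_prod n) (fun v => outer_factor (c n) v * outer_factor (c n) v)%C); auto.
    + intros. apply pow_le; auto.
    + intros. apply Rmult_le_pos; auto.
    + apply (half_plane_C2_mult_gen (fun v => / Cmod v) (fun v => / Cmod v) (outer_factor (c n)) (outer_factor (c n))); auto using half_plane_C2_ufac.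
Qed.

Lemma outer_prod_polar n t : outer_prod n (1, t) =
  (exp (- lam_n c n t) * cos (th_n c n t), - (exp (- lam_n c n t) * sin (th_n c n t))).
Proof.
  induction n as [|n IH].
  - unfold lam_n, th_n. simpl. rewrite Ropp_0, exp_0, cos_0, sin_0. apply C_ext; simpl; ring.
  - change (outer_prod (S n) (1, t)) with (outer_prod n (1, t) * (outer_factor (c n) (1, t) * outer_factor (c n) (1, t)))%C.
    rewrite IH, exp_lam_n_S by exact c_pos.
    set (a := c n * t).
    assert (Et : th_n c (S n) t = th_n c n t + 2 * atan a) by reflexivity.
    rewrite Et, cos_plus, sin_plus. destruct (cos_sin_2atan a) as [-> ->].
    assert (Q := pow2_ge_0 a).
    assert (Eu : (outer_factor (c n) (1, t) * outer_factor (c n) (1, t))%C =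
      ((1 - a ^ 2) / (1 + a ^ 2) * / (1 + a ^ 2), - (2 * a / (1 + a ^ 2) * / (1 + a ^ 2)))).
    { assert (Ed : (1 + RtoC (c n) * ((1, t) - 1))%C = (1, a)) by (apply C_ext; simpl; unfold a; ring).
      unfold outer_factor. rewrite Ed. apply C_ext; simpl; field; simpl in Q; lra. }
    rewrite Eu. fold a. apply C_ext; simpl; field; simpl in Q; lra.
Qed.

(** The n squared factors decay like |v|^(-2n), so the power m leaves cubic decay when m + 3 <= 2n.
    The constant (-i)^m turns w^m at w = it into the real number t^m, after which the imaginary part
    can be taken. *)
Lemma outer_im_n_moment m n : (m + 3 <= 2 * n)%nat -> int_R (fun t => t ^ m * outer_im_n c n t) = 0.
Proof.
  intros Hmn.
  assert (HC2 : half_plane_C2 (fun v => / Cmod v ^ 3) (fun v => (v - 1) ^ m * outer_prod n v)%C).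
  { apply half_plane_C2_le with (fun v => Cmod v ^ m * (/ Cmod v) ^ (2 * n)).
    - intros v Hv. assert (H := Cmod_ge_Re v). assert (Hp : 0 < Cmod v) by lra.
      split; [apply Rmult_le_pos; apply pow_le; [lra | left; now apply Rinv_0_lt_compat] |].
      rewrite pow_inv. replace (2 * n)%nat with (m + (3 + (2 * n - m - 3)))%nat by lia.
      rewrite !pow_add. assert (P1 := pow_lt _ m Hp). assert (P2 := pow_lt _ 3 Hp).
      assert (P3 : 1 <= Cmod v ^ (2 * n - m - 3)) by (apply pow_R1_Rle; lra).
      replace (Cmod v ^ m * / (Cmod v ^ m * (Cmod v ^ 3 * Cmod v ^ (2 * n - m - 3)))) with
        (/ (Cmod v ^ 3 * Cmod v ^ (2 * n - m - 3))) by (field; lra).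
      apply Rinv_le_contravar; [lra | nra].
    - apply (half_plane_C2_mult_gen (fun v => Cmod v ^ m) (fun v => (/ Cmod v) ^ (2 * n))
        (fun v => (v - 1) ^ m)%C (outer_prod n)); auto using half_plane_C2_shift_pow, half_plane_C2_Uprod.
      + intros; apply pow_le, Cmod_ge_0.
      + intros v Hv. apply pow_le. left. apply Rinv_0_lt_compat. assert (H := Cmod_ge_Re v). lra. }
  assert (E := cauchy_line _ HC2).
  assert (D : exists K, cdominated (fun t => ((1, t) - 1) ^ m * outer_prod n (1, t))%C K).
  { destruct HC2 as [f1 [f2 [K HK]]]. exists (Rabs K). split.
    - intros t. eapply rder_cont.
      apply (proj1 (HK (1, t) (Rle_refl _)) (fun t => (1, t)) t Ci eq_refl), rder_vert.
    - intros t. destruct (HK (1, t) (Rle_refl _)) as [_ [_ [B _]]]. eapply Rle_trans; [exact B |].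
      assert (Q := inv_cube_le_om t). assert (Q2 := Rle_abs K). assert (Q3 := Rabs_pos K).
      assert (Q4 : 0 < / Cmod (1, t) ^ 3) by (apply Rinv_0_lt_compat, pow_lt; assert (H := Cmod_1_ge 1 t (Rle_refl _)); lra).
      nra. }
  destruct D as [K D].
  assert (E2 : cint_R (fun t => (- Ci) ^ m * (((1, t) - 1) ^ m * outer_prod n (1, t)))%C = 0%C).
  { rewrite (cint_R_scal _ _ _ D). rewrite E. ring. }
  assert (D2 := cdominated_im _ _ (cdominated_scal ((- Ci) ^ m)%C _ _ D)).
  assert (EIm : forall t, Im ((- Ci) ^ m * (((1, t) - 1) ^ m * outer_prod n (1, t)))%C = -1 * (t ^ m * outer_im_n c n t)).
  { intros t. rewrite Cmult_assoc, <- Cpow_mult_l.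
    replace (- Ci * ((1, t) - 1))%C with (RtoC t) by (apply C_ext; simpl; ring).
    rewrite <- RtoC_pow, outer_prod_polar. unfold outer_im_n. simpl. ring. }
  assert (E3 : int_R (fun t => Im ((- Ci) ^ m * (((1, t) - 1) ^ m * outer_prod n (1, t)))%C) = 0) by exact (f_equal Im E2).
  rewrite (int_R_ext _ _ EIm) in E3.
  assert (E4 : int_R (fun t => t ^ m * outer_im_n c n t) = -1 * int_R (fun t => -1 * (t ^ m * outer_im_n c n t))).
  { rewrite <- (int_R_scal (-1) (fun t => -1 * (t ^ m * outer_im_n c n t)) (Cmod ((- Ci) ^ m) * K)).
    - apply int_R_ext. intros; ring.
    - destruct D2 as [D3 D4]. split.
      + intros y. eapply continuous_ext; [exact EIm | apply D3].
      + intros y. rewrite <- EIm. apply D4. }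
  rewrite E4, E3. ring.
Qed.

Lemma pow_continuous m t : continuous (fun t => t ^ m) t.
Proof. apply (ex_derive_continuous (V := R_NormedModule)). auto_derive. exact I. Qed.

Lemma outer_im_n_continuous n t : continuous (outer_im_n c n) t.
Proof.
  assert (E : forall t, Im (outer_prod n (1, t)) = - outer_im_n c n t) by (intros; rewrite outer_prod_polar; reflexivity).
  destruct (half_plane_C2_Uprod n) as [f1 [f2 [K HK]]].
  assert (R := rder_cont _ _ _ (proj1 (HK (1, t) (Rle_refl _)) (fun t => (1, t)) t Ci eq_refl (rder_vert 1 t))).
  apply continuous_ext with (fun t => -1 * Im (outer_prod n (1, t))); [intros r; rewrite E; change (-1 * - outer_im_n c n r = outer_im_n c n r); ring |].
  apply cont_scal, R.
Qed.

Lemma dominated_outer_im m : exists K, dominated (fun t => t ^ m * outer_im c t) K.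
Proof.
  destruct (moment_weight0 c c_pos m) as [K [HK H]]. exists K. split.
  - intros t. apply cont_mult; [apply pow_continuous | apply (outer_im_continuous c s c_pos c_sum)].
  - intros t. rewrite Rabs_mult, <- RPow_abs. eapply Rle_trans; [| apply H].
    apply Rmult_le_compat_l; [apply pow_le, Rabs_pos | apply (outer_im_bound c s c_pos c_sum)].
Qed.

(** The moment vanishes exactly for partial products with n >= m + 3, and the integrated error is
    O(s - psum c n), which tends to 0. *)
Lemma outer_im_moment m : int_R (fun t => t ^ m * outer_im c t) = 0.
Proof.
  destruct (dominated_outer_im m) as [K0 D0].
  destruct (moment_weight c c_pos m) as [K [HK H]].
  assert (Hb : forall n, (m + 3 <= n)%nat -> Rabs (int_R (fun t => t ^ m * outer_im c t)) <= 16 * K * (s - psum c n)).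
  { intros n Hn.
    assert (Hs : 0 <= s - psum c n).
    { assert (Q := psum_le_lim c s n (fun k => Rlt_le _ _ (c_pos k)) c_sum). lra. }
    assert (DD : dominated (fun t => t ^ m * outer_im c t + -1 * (t ^ m * outer_im_n c n t)) (4 * K * (s - psum c n))).
    { split.
      - intros t. apply cont_plus; [apply D0 |]. apply cont_scal. apply cont_mult; [apply pow_continuous | apply outer_im_n_continuous].
      - intros t. replace (t ^ m * outer_im c t + -1 * (t ^ m * outer_im_n c n t)) with (t ^ m * (outer_im c t - outer_im_n c n t)) by ring.
        rewrite Rabs_mult, <- RPow_abs.
        assert (A := outer_im_approx c s c_pos c_sum n (S (S m)) t ltac:(lia)).
        eapply Rle_trans; [apply Rmult_le_compat_l; [apply pow_le, Rabs_pos | exact A] |].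
        replace (Rabs t ^ m * (exp (- lam_n c (S (S m)) t) * (4 * Rabs t * (s - psum c n)))) with
          (4 * (s - psum c n) * (Rabs t ^ S m * exp (- lam_n c (S (S m)) t))) by (simpl; ring).
        replace (4 * K * (s - psum c n) * om t) with (4 * (s - psum c n) * (K * om t)) by ring.
        apply Rmult_le_compat_l; [lra | apply H]. }
    assert (DN : dominated (fun t => t ^ m * outer_im_n c n t) (K0 + 4 * K * (s - psum c n))).
    { destruct (dominated_plus _ _ _ _ D0 (dominated_scal (-1) _ _ DD)) as [P1 P2].
      assert (EQ : forall t, t ^ m * outer_im c t + -1 * (t ^ m * outer_im c t + -1 * (t ^ m * outer_im_n c n t)) = t ^ m * outer_im_n c n t)
        by (intros; ring).
      split.
      - intros t. eapply continuous_ext; [exact EQ | apply P1].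
      - intros t. rewrite <- EQ. eapply Rle_trans; [apply P2 |].
        rewrite Rabs_left by lra. right. ring. }
    assert (B := int_R_bound _ _ DD).
    rewrite (int_R_plus _ _ _ _ D0 (dominated_scal (-1) _ _ DN)), (int_R_scal _ _ _ DN), outer_im_n_moment in B by lia.
    rewrite Rmult_0_r, Rplus_0_r in B. lra. }
  destruct (Req_dec (int_R (fun t => t ^ m * outer_im c t)) 0) as [E | E]; [exact E | exfalso].
  apply Rabs_pos_lt in E.
  assert (He : 0 < Rabs (int_R (fun t => t ^ m * outer_im c t)) / (16 * K + 1)) by (apply Rdiv_lt_0_compat; lra).
  assert (Cs := c_sum). apply is_lim_seq_spec in Cs. destruct (Cs (mkposreal _ He)) as [N HN].
  specialize (HN (Nat.max N (m + 3)) ltac:(lia)). specialize (Hb (Nat.max N (m + 3)) ltac:(lia)). simpl in HN.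
  rewrite Rabs_minus_sym in HN. apply Rabs_lt_between in HN.
  set (A := Rabs (int_R (fun t => t ^ m * outer_im c t))) in *. set (d := s - psum c (Nat.max N (m + 3))) in *.
  assert (A < A); [| lra].
  eapply Rle_lt_trans; [exact Hb |].
  apply Rle_lt_trans with (16 * K * (A / (16 * K + 1))); [apply Rmult_le_compat_l; lra |].
  apply Rlt_le_trans with ((16 * K + 1) * (A / (16 * K + 1))); [nra | right; field; lra].
Qed.

End OuterMoments.

(** * Regularization preserving moments *)

Definition shifted_moment (g : R -> R) (p : nat) (a B : R) : R := RInt (fun x => (x + a) ^ p * g x) 0 B.

(** Support in [0, oo), rapid decay and vanishing moments, the latter as an explicit rate for
    truncated moments, which is stable under the operations below. All shifts a >= 0 are included
    because a translation by d replaces x^p by (x + d)^p. *)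
Definition null_moments (g : R -> R) : Prop :=
  (forall x, continuous g x) /\ (forall x, x <= 0 -> g x = 0) /\
  (forall p, exists K, forall x, 0 <= x -> (1 + x) ^ p * Rabs (g x) <= K) /\
  (forall p a, 0 <= a -> exists K, forall B, 0 <= B -> Rabs (shifted_moment g p a B) <= K / (1 + B)).

Lemma RInt_abs_le (f g : R -> R) a b : a <= b -> (forall x, continuous f x) -> ex_RInt g a b ->
  (forall x, a <= x <= b -> Rabs (f x) <= g x) -> Rabs (RInt f a b) <= RInt g a b.
Proof.
  intros Hab Cf Eg H.
  apply (norm_RInt_le (V := R_NormedModule) f g a b); auto.
  - apply (RInt_correct f). now apply ex_RInt_cont.
  - now apply (RInt_correct g).
Qed.

Lemma RInt_split (f : R -> R) (a b c : R) : (forall x, continuous f x) ->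
  RInt f a c = RInt f a b + RInt f b c.
Proof.
  intros Cf. symmetry. apply (RInt_Chasles f a b c); now apply ex_RInt_cont.
Qed.

Lemma inv_sq_RInt B B' (K : R) : 0 <= B <= B' ->
  is_RInt (fun x => K * / (1 + x) ^ 2) B B' (K * / (1 + B) - K * / (1 + B')).
Proof.
  intros H.
  replace (K * / (1 + B) - K * / (1 + B')) with (- K * / (1 + B') - - K * / (1 + B)) by ring.
  apply (is_RInt_derive (V := R_CompleteNormedModule) (fun x => - K * / (1 + x))).
  - intros x Hx. rewrite Rmin_left, Rmax_right in Hx by lra. auto_derive; [lra | field; lra].
  - intros x Hx. rewrite Rmin_left, Rmax_right in Hx by lra.
    apply (ex_derive_continuous (V := R_NormedModule)). auto_derive. apply Rgt_not_eq. nra.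
Qed.

Lemma shift_pow_le a x p : 0 <= a -> 0 <= x -> 0 <= (x + a) ^ p <= (1 + a) ^ p * (1 + x) ^ p.
Proof.
  intros Ha Hx. rewrite <- Rpow_mult_distr. split; [apply pow_le; lra | apply pow_incr; nra].
Qed.

Lemma shifted_moment_integrand_continuous (g : R -> R) p a x : (forall x, continuous g x) ->
  continuous (fun x => (x + a) ^ p * g x) x.
Proof.
  intros Cg. apply cont_mult; [| apply Cg].
  apply (ex_derive_continuous (V := R_NormedModule)). auto_derive. exact I.
Qed.

Lemma shifted_moment_tail (g : R -> R) p a K B B' : (forall x, continuous g x) ->
  (forall x, 0 <= x -> (1 + x) ^ (p + 2) * Rabs (g x) <= K) -> 0 <= a -> 0 <= B <= B' ->
  Rabs (RInt (fun x => (x + a) ^ p * g x) B B') <= (1 + a) ^ p * K / (1 + B).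
Proof.
  intros Cg HK Ha HB.
  assert (K0 : 0 <= K).
  { specialize (HK 0 (Rle_refl _)). eapply Rle_trans; [| exact HK].
    apply Rmult_le_pos; [apply pow_le; lra | apply Rabs_pos]. }
  assert (Hp : 0 <= (1 + a) ^ p) by (apply pow_le; lra).
  eapply Rle_trans.
  - apply (RInt_abs_le _ (fun x => (1 + a) ^ p * K * / (1 + x) ^ 2)); [lra | | |].
    + intros. now apply shifted_moment_integrand_continuous.
    + eexists. now apply inv_sq_RInt.
    + intros x Hx. rewrite Rabs_mult.
      assert (P := shift_pow_le a x p Ha ltac:(lra)). rewrite (Rabs_right ((x + a) ^ p)) by lra.
      assert (Hx2 : 0 < (1 + x) ^ 2) by (apply pow_lt; lra).
      specialize (HK x ltac:(lra)). rewrite pow_add in HK.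
      apply Rmult_le_reg_r with ((1 + x) ^ 2); [exact Hx2 |].
      replace ((1 + a) ^ p * K * / (1 + x) ^ 2 * (1 + x) ^ 2) with ((1 + a) ^ p * K) by (field; lra).
      apply Rle_trans with ((1 + a) ^ p * ((1 + x) ^ p * (1 + x) ^ 2 * Rabs (g x))); [| now apply Rmult_le_compat_l].
      replace ((1 + a) ^ p * ((1 + x) ^ p * (1 + x) ^ 2 * Rabs (g x))) with
        ((1 + a) ^ p * (1 + x) ^ p * Rabs (g x) * (1 + x) ^ 2) by ring.
      apply Rmult_le_compat_r; [lra |]. apply Rmult_le_compat_r; [apply Rabs_pos | lra].
  - rewrite (is_RInt_unique _ _ _ _ (inv_sq_RInt B B' ((1 + a) ^ p * K) HB)).
    assert (0 <= (1 + a) ^ p * K * / (1 + B')).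
    { apply Rmult_le_pos; [now apply Rmult_le_pos | left; apply Rinv_0_lt_compat; lra]. }
    unfold Rdiv. lra.
Qed.

(** The rate comes from the decay of g alone: the truncated moment has to be small only at
    arbitrarily distant B', since the piece from B to B' is bounded by the tail. The constant
    depends on g through K only, which makes the bound uniform along the averages. *)
Lemma shifted_moment_of_limit (g : R -> R) p a K : (forall x, continuous g x) ->
  (forall x, 0 <= x -> (1 + x) ^ (p + 2) * Rabs (g x) <= K) -> 0 <= a ->
  (forall e B, 0 < e -> exists B', B <= B' /\ Rabs (shifted_moment g p a B') <= e) ->
  forall B, 0 <= B -> Rabs (shifted_moment g p a B) <= (1 + a) ^ p * K / (1 + B).
Proof.
  intros Cg HK Ha Hl B HB. apply le_epsilon. intros e He.
  destruct (Hl e B He) as [B' [HB' Hm]].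
  assert (E : shifted_moment g p a B = shifted_moment g p a B' - RInt (fun x => (x + a) ^ p * g x) B B').
  { unfold shifted_moment. rewrite (RInt_split (fun x => (x + a) ^ p * g x) 0 B B')
      by (intros; now apply shifted_moment_integrand_continuous). lra. }
  rewrite E. unfold Rminus. eapply Rle_trans; [apply Rabs_triang |]. rewrite Rabs_Ropp.
  assert (T := shifted_moment_tail g p a K B B' Cg HK Ha (conj HB HB')). lra.
Qed.

Lemma RInt_zero_left (f : R -> R) a b : (forall x, x <= 0 -> f x = 0) -> a <= 0 -> b <= 0 -> RInt f a b = 0.
Proof.
  intros Hf Ha Hb. rewrite (RInt_ext _ (fun _ => 0)).
  - rewrite RInt_const. apply Rmult_0_r.
  - intros x Hx. apply Hf. assert (Rmax a b <= 0) by (apply Rmax_lub; lra). lra.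
Qed.

Lemma antider_derive (g : R -> R) x : (forall x, continuous g x) -> is_derive (fun x => RInt g 0 x) x (g x).
Proof.
  intros Cg. apply (is_derive_RInt g (fun x => RInt g 0 x) 0 x); [| apply Cg].
  exists (mkposreal 1 Rlt_0_1). intros y _. apply (RInt_correct g). now apply ex_RInt_cont.
Qed.

Lemma derive_continuous (f : R -> R) x l : is_derive f x l -> continuous f x.
Proof. intros H. apply (ex_derive_continuous (V := R_NormedModule)). eexists; exact H. Qed.

(** The antiderivative decays because the whole integral is 0, so that it equals minus the tail.
    Integration by parts gives its moments: p + 1 times the p-th is a boundary term minus the
    (p+1)-st truncated moment of g. *)
Lemma null_moments_antider g : null_moments g -> null_moments (fun x => RInt g 0 x).
Proof.
  intros [Cg [Zg [Dg Mg]]]. set (Ga := fun x => RInt g 0 x).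
  assert (CG : forall x, continuous Ga x) by (intros; eapply derive_continuous, antider_derive, Cg).
  assert (E0 : forall x, shifted_moment g 0 0 x = Ga x).
  { intros x. unfold shifted_moment, Ga. apply RInt_ext. intros. simpl. ring. }
  assert (DG : forall p, exists K, 0 <= K /\ forall x, 0 <= x -> (1 + x) ^ S p * Rabs (Ga x) <= K).
  { intros p. destruct (Dg (p + 2)%nat) as [K HK]. destruct (Mg 0%nat 0 (Rle_refl _)) as [L HL].
    assert (K0 : 0 <= K).
    { specialize (HK 0 (Rle_refl _)). eapply Rle_trans; [| exact HK].
      apply Rmult_le_pos; [apply pow_le; lra | apply Rabs_pos]. }
    exists K. split; [exact K0 |]. intros x Hx.
    assert (Hxp : 0 < (1 + x) ^ p) by (apply pow_lt; lra).
    assert (B : Rabs (shifted_moment g 0 0 x) <= (1 + 0) ^ 0 * (K / (1 + x) ^ p) / (1 + x)).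
    { apply le_epsilon. intros e He.
      set (B' := Rmax x (L / e)). assert (H1 : x <= B') by apply Rmax_l. assert (H2 : L / e <= B') by apply Rmax_r.
      assert (T : Rabs (RInt g x B') <= K / (1 + x) ^ p * / (1 + x)).
      { eapply Rle_trans.
        - apply (RInt_abs_le g (fun y => K / (1 + x) ^ p * / (1 + y) ^ 2)); [lra | exact Cg | |].
          + eexists. apply inv_sq_RInt. lra.
          + intros y Hy. specialize (HK y ltac:(lra)). rewrite pow_add in HK.
            assert (Hy2 : 0 < (1 + y) ^ 2) by (apply pow_lt; lra).
            assert (Hyx : (1 + x) ^ p <= (1 + y) ^ p) by (apply pow_incr; lra).
            apply Rmult_le_reg_r with ((1 + x) ^ p * (1 + y) ^ 2); [nra |].
            replace (K / (1 + x) ^ p * / (1 + y) ^ 2 * ((1 + x) ^ p * (1 + y) ^ 2)) with K by (field; lra).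
            eapply Rle_trans; [| exact HK].
            replace (Rabs (g y) * ((1 + x) ^ p * (1 + y) ^ 2)) with ((1 + x) ^ p * (1 + y) ^ 2 * Rabs (g y)) by ring.
            apply Rmult_le_compat_r; [apply Rabs_pos |]. apply Rmult_le_compat_r; lra.
        - rewrite (is_RInt_unique _ _ _ _ (inv_sq_RInt x B' (K / (1 + x) ^ p) ltac:(lra))).
          assert (0 <= K / (1 + x) ^ p * / (1 + B')).
          { apply Rmult_le_pos; [| left; apply Rinv_0_lt_compat; lra].
            apply Rmult_le_pos; [lra | left; now apply Rinv_0_lt_compat]. }
          lra. }
      assert (Hm := HL B' ltac:(lra)).
      assert (Hm2 : L / (1 + B') <= e).
      { apply Rmult_le_reg_r with (1 + B'); [lra |]. replace (L / (1 + B') * (1 + B')) with L by (field; lra).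
        apply Rmult_le_compat_r with (r := e) in H2; [| lra]. replace (L / e * e) with L in H2 by (field; lra). nra. }
      rewrite E0 in *.
      assert (E : Ga x = Ga B' - RInt g x B').
      { unfold Ga. rewrite (RInt_split g 0 x B') by exact Cg. lra. }
      rewrite E. unfold Rminus. eapply Rle_trans; [apply Rabs_triang |]. rewrite Rabs_Ropp.
      simpl pow. unfold Rdiv in *. lra. }
    rewrite E0 in B. simpl pow in B |- *.
    apply Rle_trans with ((1 + x) * (1 + x) ^ p * (1 * (K / (1 + x) ^ p) / (1 + x))).
    - apply Rmult_le_compat_l; [nra | exact B].
    - right. field. lra. }
  assert (DG' : forall p, exists K, forall x, 0 <= x -> (1 + x) ^ p * Rabs (Ga x) <= K).
  { intros [|p].
    - destruct (DG 0%nat) as [K [_ HK]]. exists K. intros x Hx. specialize (HK x Hx).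
      assert (Q := Rabs_pos (Ga x)). simpl in *. nra.
    - destruct (DG p) as [K [_ HK]]. now exists K. }
  split; [exact CG | split; [| split; [exact DG' |]]].
  - intros x Hx. now apply RInt_zero_left.
  - intros p a Ha. destruct (DG (S p)) as [K [K0 HK]]. destruct (Mg (S p) a Ha) as [L HL].
    assert (HP : 0 < INR (S p)) by (apply lt_0_INR; lia).
    exists ((1 + a) ^ S p * K / INR (S p) + L / INR (S p)). intros B HB.
    assert (E : shifted_moment Ga p a B = / INR (S p) * ((B + a) ^ S p * Ga B) - / INR (S p) * shifted_moment g (S p) a B).
    { assert (E1 : is_RInt (fun x => (x + a) ^ p * Ga x + / INR (S p) * ((x + a) ^ S p * g x)) 0 B
        (/ INR (S p) * ((B + a) ^ S p * Ga B) - / INR (S p) * ((0 + a) ^ S p * Ga 0))).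
      { apply (is_RInt_derive (V := R_CompleteNormedModule) (fun x => / INR (S p) * ((x + a) ^ S p * Ga x))).
        - intros x _. eapply is_derive_eq.
          + apply (is_derive_scal (fun x => (x + a) ^ S p * Ga x)).
            apply (is_derive_Rmult (fun x => (x + a) ^ S p) Ga).
            * apply (is_derive_pow (fun x => x + a) (S p) x 1). auto_derive; [exact I | ring].
            * now apply antider_derive.
          + simpl pred. field. lra.
        - intros x _. apply cont_plus; [now apply shifted_moment_integrand_continuous |].
          apply cont_scal. now apply shifted_moment_integrand_continuous. }
      apply (is_RInt_unique (V := R_CompleteNormedModule)) in E1.
      rewrite (RInt_plus (fun x => (x + a) ^ p * Ga x) (fun x => / INR (S p) * ((x + a) ^ S p * g x))) in E1.
      2, 3: apply ex_RInt_cont; intros; try apply cont_scal; now apply shifted_moment_integrand_continuous.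
      rewrite (RInt_scal (fun x => (x + a) ^ S p * g x)) in E1.
      2: apply ex_RInt_cont; intros; now apply shifted_moment_integrand_continuous.
      assert (G0 : Ga 0 = 0) by (unfold Ga; apply (RInt_point (V := R_CompleteNormedModule))).
      rewrite G0 in E1. unfold shifted_moment. unfold plus, scal, mult in E1; simpl in E1. unfold mult in E1; simpl in E1.
      simpl. lra. }
    rewrite E. unfold Rminus. eapply Rle_trans; [apply Rabs_triang |].
    rewrite Rabs_Ropp, !Rabs_mult, (Rabs_right (/ INR (S p))) by (left; now apply Rinv_0_lt_compat).
    specialize (HL B HB). specialize (HK B HB).
    assert (P := shift_pow_le a B (S p) Ha HB). rewrite (Rabs_right ((B + a) ^ S p)) by lra.
    assert (Hip : 0 < / INR (S p)) by now apply Rinv_0_lt_compat.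
    assert (X : (B + a) ^ S p * Rabs (Ga B) <= (1 + a) ^ S p * K / (1 + B)).
    { apply Rle_trans with ((1 + a) ^ S p * (1 + B) ^ S p * Rabs (Ga B)).
      - apply Rmult_le_compat_r; [apply Rabs_pos | lra].
      - apply Rmult_le_reg_r with (1 + B); [lra |].
        replace ((1 + a) ^ S p * K / (1 + B) * (1 + B)) with ((1 + a) ^ S p * K) by (field; lra).
        replace ((1 + a) ^ S p * (1 + B) ^ S p * Rabs (Ga B) * (1 + B)) with
          ((1 + a) ^ S p * ((1 + B) ^ S (S p) * Rabs (Ga B))) by (simpl; ring).
        apply Rmult_le_compat_l; [apply pow_le; lra | exact HK]. }
    replace (((1 + a) ^ S p * K / INR (S p) + L / INR (S p)) / (1 + B)) with
      (/ INR (S p) * ((1 + a) ^ S p * K / (1 + B)) + / INR (S p) * (L / (1 + B))) by (field; lra).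
    apply Rplus_le_compat; apply Rmult_le_compat_l; lra.
Qed.

(** The substitution trades the shift a for a + d; the new interval starts at -d, but g vanishes up
    to 0. *)
Lemma null_moments_shift g d : 0 <= d -> null_moments g -> null_moments (fun x => g (x - d)).
Proof.
  intros Hd [Cg [Zg [Dg Mg]]].
  assert (CS : forall x, continuous (fun x => g (x - d)) x).
  { intros x. apply (continuous_comp (fun x => x - d) g); [| apply Cg].
    apply (ex_derive_continuous (V := R_NormedModule)). auto_derive. exact I. }
  split; [exact CS | split; [| split]].
  - intros x Hx. apply Zg. lra.
  - intros p. destruct (Dg p) as [K HK]. exists ((1 + d) ^ p * K). intros x Hx.
    assert (K0 : 0 <= K).
    { specialize (HK 0 (Rle_refl _)). eapply Rle_trans; [| exact HK].
      apply Rmult_le_pos; [apply pow_le; lra | apply Rabs_pos]. }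
    assert (P0 : 0 <= (1 + d) ^ p) by (apply pow_le; lra).
    destruct (Rle_dec (x - d) 0) as [Hn | Hn].
    + rewrite Zg, Rabs_R0 by exact Hn. rewrite Rmult_0_r. now apply Rmult_le_pos.
    + specialize (HK (x - d) ltac:(lra)).
      assert (P : (1 + x) ^ p <= (1 + d) ^ p * (1 + (x - d)) ^ p).
      { rewrite <- Rpow_mult_distr. apply pow_incr. nra. }
      apply Rle_trans with ((1 + d) ^ p * (1 + (x - d)) ^ p * Rabs (g (x - d))).
      * apply Rmult_le_compat_r; [apply Rabs_pos | exact P].
      * rewrite Rmult_assoc. now apply Rmult_le_compat_l.
  - intros p a Ha. destruct (Mg p (a + d) ltac:(lra)) as [K HK]. exists (K * (1 + d)). intros B HB.
    assert (K0 : 0 <= K).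
    { specialize (HK 0 (Rle_refl _)). assert (Q := Rabs_pos (shifted_moment g p (a + d) 0)).
      unfold Rdiv in HK. rewrite Rplus_0_r, Rinv_1, Rmult_1_r in HK. lra. }
    set (f := fun y => (y + (a + d)) ^ p * g y).
    assert (Cf : forall y, continuous f y) by (intros; now apply shifted_moment_integrand_continuous).
    assert (E : shifted_moment (fun x => g (x - d)) p a B = RInt f (- d) (B - d)).
    { unfold shifted_moment. replace (- d) with (0 - d) by ring.
      rewrite <- (RInt_comp (V := R_CompleteNormedModule) f (fun x => x - d) (fun _ => 1)).
      - apply RInt_ext. intros x _. unfold f, scal; simpl; unfold mult; simpl.
        replace (x - d + (a + d)) with (x + a) by ring. ring.
      - intros; apply Cf.
      - intros x _. split; [auto_derive; [exact I | ring] | apply continuous_const]. }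
    assert (Zf : forall x, x <= 0 -> f x = 0) by (intros x Hx; unfold f; rewrite Zg by exact Hx; ring).
    rewrite E. destruct (Rle_dec (B - d) 0) as [Hn | Hn].
    + rewrite RInt_zero_left, Rabs_R0 by (auto; lra).
      apply Rmult_le_pos; [nra | left; apply Rinv_0_lt_compat; lra].
    + rewrite (RInt_split f (- d) 0 (B - d)) by exact Cf.
      rewrite (RInt_zero_left f (- d) 0), Rplus_0_l by (auto; lra).
      change (RInt f 0 (B - d)) with (shifted_moment g p (a + d) (B - d)).
      eapply Rle_trans; [apply HK; lra |].
      apply Rmult_le_reg_r with ((1 + (B - d)) * (1 + B)); [nra |].
      replace (K / (1 + (B - d)) * ((1 + (B - d)) * (1 + B))) with (K * (1 + B)) by (field; lra).
      replace (K * (1 + d) / (1 + B) * ((1 + (B - d)) * (1 + B))) with (K * ((1 + d) * (1 + (B - d)))) by (field; lra).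
      apply Rmult_le_compat_l; [exact K0 | nra].
Qed.

Lemma null_moments_lin f g al be : null_moments f -> null_moments g -> null_moments (fun x => al * f x + be * g x).
Proof.
  intros [Cf [Zf [Df Mf]]] [Cg [Zg [Dg Mg]]].
  split; [| split; [| split]].
  - intros. apply cont_plus; now apply cont_scal.
  - intros x Hx. rewrite Zf, Zg by exact Hx. ring.
  - intros p. destruct (Df p) as [K HK]. destruct (Dg p) as [L HL].
    exists (Rabs al * K + Rabs be * L). intros x Hx. specialize (HK x Hx). specialize (HL x Hx).
    assert (P : 0 <= (1 + x) ^ p) by (apply pow_le; lra).
    eapply Rle_trans; [apply Rmult_le_compat_l; [exact P | apply Rabs_triang] |].
    rewrite !Rabs_mult.
    assert (A1 := Rabs_pos al). assert (A2 := Rabs_pos be). nra.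
  - intros p a Ha. destruct (Mf p a Ha) as [K HK]. destruct (Mg p a Ha) as [L HL].
    exists (Rabs al * K + Rabs be * L). intros B HB. specialize (HK B HB). specialize (HL B HB).
    assert (E : shifted_moment (fun x => al * f x + be * g x) p a B = al * shifted_moment f p a B + be * shifted_moment g p a B).
    { unfold shifted_moment.
      rewrite (RInt_ext _ (fun x => plus (scal al ((x + a) ^ p * f x)) (scal be ((x + a) ^ p * g x)))).
      2: { intros x _. unfold plus, scal; simpl; unfold mult; simpl. ring. }
      rewrite (RInt_plus (fun x => scal al ((x + a) ^ p * f x)) (fun x => scal be ((x + a) ^ p * g x))).
      2, 3: apply (ex_RInt_scal (fun x => (x + a) ^ p * _ x)); apply ex_RInt_cont; intros; now apply shifted_moment_integrand_continuous.
      rewrite (RInt_scal (fun x => (x + a) ^ p * f x)), (RInt_scal (fun x => (x + a) ^ p * g x)); [reflexivity | |];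
        apply ex_RInt_cont; intros; now apply shifted_moment_integrand_continuous. }
    rewrite E. eapply Rle_trans; [apply Rabs_triang |]. rewrite !Rabs_mult.
    replace ((Rabs al * K + Rabs be * L) / (1 + B)) with (Rabs al * (K / (1 + B)) + Rabs be * (L / (1 + B))) by (field; lra).
    apply Rplus_le_compat; apply Rmult_le_compat_l; auto; apply Rabs_pos.
Qed.

Lemma null_moments_ext f g : (forall x, f x = g x) -> null_moments f -> null_moments g.
Proof.
  intros E [Cf [Zf [Df Mf]]]. split; [| split; [| split]].
  - intros x. eapply continuous_ext; [exact E | apply Cf].
  - intros x Hx. rewrite <- E. now apply Zf.
  - intros p. destruct (Df p) as [K HK]. exists K. intros x Hx. rewrite <- E. now apply HK.
  - intros p a Ha. destruct (Mf p a Ha) as [K HK]. exists K. intros B HB.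
    assert (Em : shifted_moment g p a B = shifted_moment f p a B) by (apply RInt_ext; intros; now rewrite E).
    rewrite Em. now apply HK.
Qed.

(** Convolution with the uniform density on [0, d]; averaging to the left only keeps the support in
    [0, oo). *)
Definition left_avg (d : R) (g : R -> R) (x : R) : R := / d * RInt g (x - d) x.

Lemma left_avg_antider d g x : (forall x, continuous g x) ->
  left_avg d g x = / d * RInt g 0 x + - / d * RInt g 0 (x - d).
Proof.
  intros Cg. unfold left_avg.
  assert (E := RInt_split g 0 (x - d) x Cg). rewrite E. lra.
Qed.

(** The average is a multiple of the difference of two translates of the antiderivative, so
    stability under antiderivatives, shifts and linear combinations suffices. *)
Lemma null_moments_Tavg d g : 0 <= d -> null_moments g -> null_moments (left_avg d g).
Proof.
  intros Hd Hg.
  apply null_moments_ext with (fun x => / d * RInt g 0 x + - / d * RInt g 0 (x - d)).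
  { intros x. symmetry. apply left_avg_antider, Hg. }
  apply null_moments_lin; [now apply null_moments_antider |].
  apply (null_moments_shift (fun x => RInt g 0 x)); [exact Hd | now apply null_moments_antider].
Qed.

Lemma left_avg_derive d g x : (forall x, continuous g x) ->
  is_derive (left_avg d g) x (/ d * (g x - g (x - d))).
Proof.
  intros Cg.
  apply is_derive_ext with (fun x => / d * RInt g 0 x + - / d * RInt g 0 (x - d)).
  { intros y. symmetry. now apply left_avg_antider. }
  eapply is_derive_eq.
  - apply (is_derive_Rplus (fun x => / d * RInt g 0 x) (fun x => - / d * RInt g 0 (x - d))).
    + apply (is_derive_scal (fun x => RInt g 0 x)). now apply antider_derive.
    + apply (is_derive_scal (fun x => RInt g 0 (x - d))).
      apply (is_derive_comp (fun x => RInt g 0 x) (fun x => x - d)); [now apply antider_derive |].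
      auto_derive; [exact I | reflexivity].
  - unfold scal; simpl; unfold mult; simpl. ring.
Qed.

Lemma left_avg_continuous d g x : (forall x, continuous g x) -> continuous (left_avg d g) x.
Proof. intros Cg. eapply derive_continuous, left_avg_derive, Cg. Qed.

Lemma left_avg_le d g x E : 0 < d -> (forall x, continuous g x) ->
  (forall y, x - d <= y <= x -> g y <= E) -> left_avg d g x <= E.
Proof.
  intros Hd Cg H. unfold left_avg.
  assert (B : RInt g (x - d) x <= d * E).
  { replace (d * E) with ((x - (x - d)) * E) by ring.
    apply (is_RInt_le g (fun _ => E) (x - d) x); [lra | | apply (is_RInt_const (x - d) x E) | intros; apply H; lra].
    apply (RInt_correct g). now apply ex_RInt_cont. }
  apply Rmult_le_reg_l with d; [exact Hd |]. rewrite <- Rmult_assoc, Rinv_r, Rmult_1_l by lra. exact B.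
Qed.

Lemma left_avg_ge d g x E : 0 < d -> (forall x, continuous g x) ->
  (forall y, x - d <= y <= x -> E <= g y) -> E <= left_avg d g x.
Proof.
  intros Hd Cg H. unfold left_avg.
  assert (B : d * E <= RInt g (x - d) x).
  { replace (d * E) with ((x - (x - d)) * E) by ring.
    apply (is_RInt_le (fun _ => E) g (x - d) x); [lra | apply (is_RInt_const (x - d) x E) | | intros; apply H; lra].
    apply (RInt_correct g). now apply ex_RInt_cont. }
  apply Rmult_le_reg_l with d; [exact Hd |]. rewrite <- Rmult_assoc, Rinv_r, Rmult_1_l by lra. exact B.
Qed.

Lemma left_avg_abs_le d g x E : 0 < d -> (forall x, continuous g x) ->
  (forall y, x - d <= y <= x -> Rabs (g y) <= E) -> Rabs (left_avg d g x) <= E.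
Proof.
  intros Hd Cg H. apply Rabs_le. split.
  - apply left_avg_ge; auto. intros y Hy. specialize (H y Hy). apply Rabs_le_between in H. lra.
  - apply left_avg_le; auto. intros y Hy. specialize (H y Hy). apply Rabs_le_between in H. lra.
Qed.

Lemma mvt_abs (f df : R -> R) (L x y : R) : (forall t, is_derive f t (df t)) ->
  (forall t, Rmin x y <= t <= Rmax x y -> Rabs (df t) <= L) -> Rabs (f y - f x) <= L * Rabs (y - x).
Proof.
  intros Hd HL. destruct (MVT_gen f x y df) as [c [Hc1 Hc2]].
  - intros; apply Hd.
  - intros t _. eapply is_derive_cont_pt, Hd.
  - rewrite Hc2, Rabs_mult. apply Rmult_le_compat_r; [apply Rabs_pos | now apply HL].
Qed.

Section Regularize.

Variables (phi : R -> R) (delta : nat -> R) (r : R).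
Hypothesis phi_cont : forall x, continuous phi x.
Hypothesis phi_le_1 : forall x, Rabs (phi x) <= 1.
Hypothesis delta_pos : forall k, 0 < delta k.
Hypothesis delta_sum : is_lim_seq (psum delta) r.

(** Differentiating an average of length d gives the backward difference quotient of step d; these
    are the iterated quotients left by q differentiations. *)
Fixpoint diff_quot (q : nat) (x : R) : R :=
  match q with O => phi x | S k => / delta k * (diff_quot k x - diff_quot k (x - delta k)) end.

(** Averages of lengths delta q, ..., delta (q + n - 1) are applied to the q-th difference quotient.
    By [avg_diff_derive] this is the q-th derivative of the (q + n)-fold average of phi. *)
Fixpoint avg_diff (q n : nat) : R -> R :=
  match n with O => diff_quot q | S k => left_avg (delta (q + k)) (avg_diff q k) end.

Fixpoint diff_bound (q : nat) : R := match q with O => 1 | S k => 2 / delta k * diff_bound k end.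

Lemma diff_bound_pos q : 0 < diff_bound q.
Proof.
  induction q as [|q IH]; [simpl; lra |]. simpl.
  apply Rmult_lt_0_compat; [apply Rdiv_lt_0_compat; [lra | apply delta_pos] | exact IH].
Qed.

Lemma diff_quot_continuous q x : continuous (diff_quot q) x.
Proof.
  revert x. induction q as [|q IH]; intros x; [apply phi_cont |]. simpl.
  apply cont_scal. apply (continuous_minus (diff_quot q) (fun x => diff_quot q (x - delta q))); [apply IH |].
  apply (continuous_comp (fun x => x - delta q) (diff_quot q)); [| apply IH].
  apply (ex_derive_continuous (V := R_NormedModule)). auto_derive. exact I.
Qed.

Lemma avg_diff_continuous q n x : continuous (avg_diff q n) x.
Proof.
  revert x. induction n as [|n IH]; intros x; [apply diff_quot_continuous |]. simpl. now apply left_avg_continuous.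
Qed.

(** The bound is local: only values of phi at distance at most [psum delta q] to the left of x
    enter, which is what transports both decay and support. *)
Lemma diff_quot_bound q x E : (forall y, x - psum delta q <= y <= x -> Rabs (phi y) <= E) ->
  Rabs (diff_quot q x) <= diff_bound q * E.
Proof.
  revert x. induction q as [|q IH]; intros x H.
  - simpl. rewrite Rmult_1_l. apply H. simpl. lra.
  - simpl in H |- *. assert (Hd := delta_pos q). assert (Hid : 0 < / delta q) by now apply Rinv_0_lt_compat.
    assert (B1 : Rabs (diff_quot q x) <= diff_bound q * E) by (apply IH; intros; apply H; lra).
    assert (B2 : Rabs (diff_quot q (x - delta q)) <= diff_bound q * E) by (apply IH; intros; apply H; lra).
    rewrite Rabs_mult, (Rabs_right (/ delta q)) by lra.
    replace (2 / delta q * diff_bound q * E) with (/ delta q * (diff_bound q * E + diff_bound q * E)) by (field; lra).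
    apply Rmult_le_compat_l; [lra |]. unfold Rminus. eapply Rle_trans; [apply Rabs_triang |].
    rewrite Rabs_Ropp. fold (x - delta q). lra.
Qed.

Lemma avg_diff_bound q n x E : (forall y, x - psum delta (q + n) <= y <= x -> Rabs (phi y) <= E) ->
  Rabs (avg_diff q n x) <= diff_bound q * E.
Proof.
  revert x. induction n as [|n IH]; intros x H.
  - apply diff_quot_bound. intros; apply H. rewrite Nat.add_0_r. lra.
  - simpl. apply left_avg_abs_le; [apply delta_pos | intros; apply avg_diff_continuous |].
    intros y Hy. apply IH. intros z Hz. apply H. rewrite Nat.add_succ_r. simpl. lra.
Qed.

Lemma avg_diff_le q n x : Rabs (avg_diff q n x) <= diff_bound q.
Proof. rewrite <- (Rmult_1_r (diff_bound q)). apply avg_diff_bound. intros; apply phi_le_1. Qed.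

Lemma avg_diff0_lower n x E : (forall y, x - psum delta n <= y <= x -> E <= phi y) -> E <= avg_diff 0 n x.
Proof.
  revert x. induction n as [|n IH]; intros x H.
  - simpl in *. apply H. lra.
  - simpl. apply left_avg_ge; [apply delta_pos | intros; apply avg_diff_continuous |].
    intros y Hy. apply IH. intros z Hz. apply H. simpl. lra.
Qed.

(** Averaging commutes with differentiation, and the innermost average, of length delta q, turns
    into the difference quotient of step delta q. *)
Lemma avg_diff_derive q n x : is_derive (avg_diff q (S n)) x (avg_diff (S q) n x).
Proof.
  revert x. induction n as [|n IH]; intros x.
  - simpl. rewrite Nat.add_0_r. apply left_avg_derive. intros; apply diff_quot_continuous.
  - change (avg_diff q (S (S n))) with (left_avg (delta (q + S n)) (avg_diff q (S n))).
    eapply is_derive_eq; [apply left_avg_derive; intros; apply avg_diff_continuous |].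
    change (avg_diff (S q) (S n) x) with (left_avg (delta (S q + n)) (avg_diff (S q) n) x).
    replace (S q + n)%nat with (q + S n)%nat by lia. unfold left_avg. f_equal.
    symmetry. apply is_RInt_unique.
    apply (is_RInt_derive (V := R_CompleteNormedModule) (avg_diff q (S n))); intros; [apply IH | apply avg_diff_continuous].
Qed.

(** The index S n guarantees at least one average, so every approximant is differentiable. *)
Definition regularized (q : nat) (x : R) : R := real (Lim_seq (fun n => avg_diff q (S n) x)).

Lemma delta_tail_sum q : exists l : R, is_lim_seq (psum (fun k => delta (q + S k))) l.
Proof.
  apply psum_ex_lim with r; [intros; left; apply delta_pos |].
  intros n. apply Rle_trans with (psum delta (q + S n)).
  - induction n as [|n IH].
    + simpl. assert (Q := psum_mono delta 0 (q + 1) (fun k => Rlt_le _ _ (delta_pos k)) ltac:(lia)). exact Q.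
    + rewrite psum_S. replace (q + S (S n))%nat with (S (q + S n)) by lia. rewrite psum_S. lra.
  - apply psum_le_lim; [intros; left; apply delta_pos | exact delta_sum].
Qed.

(** An average of length d moves a function by at most d times its Lipschitz constant, here
    [diff_bound (S q)], and the lengths are summable. *)
Lemma avg_diff_conv q : exists (l : R), is_lim_seq (psum (fun k => delta (q + S k))) l /\
  forall x, is_lim_seq (fun n => avg_diff q (S n) x) (regularized q x) /\
  forall n, Rabs (regularized q x - avg_diff q (S n) x) <= diff_bound (S q) * (l - psum (fun k => delta (q + S k)) n).
Proof.
  destruct (delta_tail_sum q) as [l Hl]. exists l. split; [exact Hl |]. intros x.
  apply (seq_conv (fun n => avg_diff q (S n) x) (fun k => delta (q + S k)) (diff_bound (S q)) l); auto.
  - left. apply diff_bound_pos.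
  - intros. left. apply delta_pos.
  - intros n. change (avg_diff q (S (S n)) x) with (left_avg (delta (q + S n)) (avg_diff q (S n)) x).
    set (d := delta (q + S n)). assert (Hd : 0 < d) by apply delta_pos.
    assert (HL : forall y, x - d <= y <= x -> Rabs (avg_diff q (S n) y - avg_diff q (S n) x) <= diff_bound (S q) * d).
    { intros y Hy. eapply Rle_trans.
      - apply (mvt_abs (avg_diff q (S n)) (avg_diff (S q) n) (diff_bound (S q)) x y); intros; [apply avg_diff_derive | apply avg_diff_le].
      - apply Rmult_le_compat_l; [left; apply diff_bound_pos |]. apply Rabs_le. lra. }
    apply Rabs_le. split.
    + assert (avg_diff q (S n) x - diff_bound (S q) * d <= left_avg d (avg_diff q (S n)) x); [| lra].
      apply left_avg_ge; [exact Hd | intros; apply avg_diff_continuous |].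
      intros y Hy. specialize (HL y Hy). apply Rabs_le_between in HL. lra.
    + assert (left_avg d (avg_diff q (S n)) x <= avg_diff q (S n) x + diff_bound (S q) * d); [| lra].
      apply left_avg_le; [exact Hd | intros; apply avg_diff_continuous |].
      intros y Hy. specialize (HL y Hy). apply Rabs_le_between in HL. lra.
Qed.

Lemma regularized_lim q x : is_lim_seq (fun n => avg_diff q (S n) x) (regularized q x).
Proof. destruct (avg_diff_conv q) as [l [_ H]]. apply H. Qed.

Lemma regularized_uniform q e : 0 < e -> exists n, forall x, Rabs (regularized q x - avg_diff q (S n) x) <= e.
Proof.
  intros He. destruct (avg_diff_conv q) as [l [Hl H]].
  assert (HP := diff_bound_pos (S q)). set (P := diff_bound (S q)) in *. clearbody P.
  assert (He' : 0 < e / P) by now apply Rdiv_lt_0_compat.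
  apply is_lim_seq_spec in Hl. destruct (Hl (mkposreal _ He')) as [N HN].
  exists N. intros x. specialize (HN N (Nat.le_refl _)). simpl in HN.
  eapply Rle_trans; [apply H |]. apply Rabs_lt_between in HN.
  apply Rle_trans with (P * (e / P)); [apply Rmult_le_compat_l; lra | right; field; lra].
Qed.

(** The remainder is controlled by the Lipschitz constant of the next derivative, uniformly in n, so
    it passes to the limit and yields differentiability there. The indices S (S n) and S n differ
    because a differentiation uses up one average. *)
Lemma regularized_quad q x y : Rabs (regularized q y - regularized q x - (y - x) * regularized (S q) x) <= diff_bound (S (S q)) * (y - x) ^ 2.
Proof.
  apply is_lim_seq_abs_le with
    (fun n => avg_diff q (S (S n)) y - avg_diff q (S (S n)) x - (y - x) * avg_diff (S q) (S n) x).
  - apply is_lim_seq_minus'.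
    + apply is_lim_seq_minus'.
      * apply (is_lim_seq_incr_1 (fun n => avg_diff q (S n) y)). apply regularized_lim.
      * apply (is_lim_seq_incr_1 (fun n => avg_diff q (S n) x)). apply regularized_lim.
    + apply (is_lim_seq_scal_l _ (y - x) (regularized (S q) x)). apply regularized_lim.
  - intros n.
    set (f := fun t => avg_diff q (S (S n)) t - t * avg_diff (S q) (S n) x).
    replace (avg_diff q (S (S n)) y - avg_diff q (S (S n)) x - (y - x) * avg_diff (S q) (S n) x) with (f y - f x) by (unfold f; ring).
    eapply Rle_trans.
    + apply (mvt_abs f (fun t => avg_diff (S q) (S n) t - avg_diff (S q) (S n) x) (diff_bound (S (S q)) * Rabs (y - x)) x y).
      * intros t. apply (is_derive_Rminus (avg_diff q (S (S n))) (fun t => t * avg_diff (S q) (S n) x)); [apply avg_diff_derive |].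
        generalize (avg_diff (S q) (S n) x); intros k; auto_derive; [exact I | ring].
      * intros t Ht. eapply Rle_trans.
        -- apply (mvt_abs (avg_diff (S q) (S n)) (avg_diff (S (S q)) n) (diff_bound (S (S q))) x t); intros; [apply avg_diff_derive | apply avg_diff_le].
        -- apply Rmult_le_compat_l; [left; apply diff_bound_pos |].
           unfold Rmin, Rmax in Ht. destruct (Rle_dec x y).
           ++ rewrite !Rabs_right; lra.
           ++ rewrite !Rabs_left1; lra.
    + rewrite <- (pow2_abs (y - x)). right. ring.
Qed.

Lemma regularized_derive q x : is_derive (regularized q) x (regularized (S q) x).
Proof.
  apply is_derive_eps. intros e He. set (L := diff_bound (S (S q))). assert (HL : 0 < L) by apply diff_bound_pos.
  exists (e / L). split; [now apply Rdiv_lt_0_compat |]. intros y Hy.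
  eapply Rle_trans; [apply regularized_quad |]. fold L. rewrite <- (pow2_abs (y - x)).
  replace (L * Rabs (y - x) ^ 2) with ((L * Rabs (y - x)) * Rabs (y - x)) by ring.
  apply Rmult_le_compat_r; [apply Rabs_pos |].
  apply Rle_trans with (L * (e / L)); [apply Rmult_le_compat_l; lra | right; field; lra].
Qed.

Lemma psum_delta_le n : psum delta n <= r.
Proof. apply psum_le_lim; [intros; left; apply delta_pos | exact delta_sum]. Qed.

Lemma regularized_bound q x E : (forall y, x - r <= y <= x -> Rabs (phi y) <= E) -> Rabs (regularized q x) <= diff_bound q * E.
Proof.
  intros H. apply is_lim_seq_abs_le with (fun n => avg_diff q (S n) x); [apply regularized_lim |].
  intros n. apply avg_diff_bound. intros y Hy. apply H. assert (Q := psum_delta_le (q + S n)). lra.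
Qed.

Lemma regularized0_lower x E : (forall y, x - r <= y <= x -> E <= phi y) -> E <= regularized 0 x.
Proof.
  intros H. apply (is_lim_seq_le (fun _ => E) (fun n => avg_diff 0 (S n) x) E (regularized 0 x)).
  - intros n. apply avg_diff0_lower. intros y Hy. apply H. assert (Q := psum_delta_le (S n)). lra.
  - apply is_lim_seq_const.
  - apply regularized_lim.
Qed.

Hypothesis phi_Zc : null_moments phi.

Lemma r_pos : 0 < r.
Proof. assert (Q := psum_delta_le 1). simpl in Q. assert (Q2 := delta_pos 0). lra. Qed.

Lemma avg_diff0_Zc n : null_moments (avg_diff 0 n).
Proof. induction n as [|n IH]; [exact phi_Zc |]. simpl. apply null_moments_Tavg; [left; apply delta_pos | exact IH]. Qed.

Lemma phi_decay_shift p : exists K, forall x, 0 <= x -> forall y, x - r <= y <= x -> (1 + x) ^ p * Rabs (phi y) <= K.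
Proof.
  destruct phi_Zc as [_ [Zp [Dp _]]]. destruct (Dp p) as [K HK]. assert (Hr := r_pos).
  assert (K0 : 0 <= K).
  { specialize (HK 0 (Rle_refl _)). eapply Rle_trans; [| exact HK].
    apply Rmult_le_pos; [apply pow_le; lra | apply Rabs_pos]. }
  exists ((1 + r) ^ p * K). intros x Hx y Hy.
  assert (P0 : 0 <= (1 + r) ^ p) by (apply pow_le; lra).
  destruct (Rle_dec y 0) as [Hn | Hn].
  - rewrite Zp, Rabs_R0, Rmult_0_r by exact Hn. now apply Rmult_le_pos.
  - specialize (HK y ltac:(lra)).
    assert (P : (1 + x) ^ p <= (1 + r) ^ p * (1 + y) ^ p) by (rewrite <- Rpow_mult_distr; apply pow_incr; nra).
    apply Rle_trans with ((1 + r) ^ p * (1 + y) ^ p * Rabs (phi y)).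
    + apply Rmult_le_compat_r; [apply Rabs_pos | exact P].
    + rewrite Rmult_assoc. now apply Rmult_le_compat_l.
Qed.

Lemma avg_diff0_decay p : exists K, forall n x, 0 <= x -> (1 + x) ^ p * Rabs (avg_diff 0 n x) <= K.
Proof.
  destruct (phi_decay_shift p) as [K HK]. exists K. intros n x Hx.
  assert (Hp : 0 < (1 + x) ^ p) by (apply pow_lt; lra).
  assert (B : Rabs (avg_diff 0 n x) <= diff_bound 0 * (K / (1 + x) ^ p)).
  { apply avg_diff_bound. intros y Hy. simpl in Hy.
    assert (Q := psum_delta_le n). specialize (HK x Hx y ltac:(lra)).
    apply Rmult_le_reg_l with ((1 + x) ^ p); [exact Hp |].
    replace ((1 + x) ^ p * (K / (1 + x) ^ p)) with K by (field; lra). exact HK. }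
  simpl in B. apply Rmult_le_compat_l with (r := (1 + x) ^ p) in B; [| lra].
  eapply Rle_trans; [exact B |]. right. field. lra.
Qed.

(** The finite averages have null moments with a constant depending only on their common decay;
    uniform convergence on [0, B] carries the bound to the limit. *)
Lemma regularized0_moment p : exists K, forall B, 0 <= B -> Rabs (RInt (fun x => x ^ p * regularized 0 x) 0 B) <= K / (1 + B).
Proof.
  destruct (avg_diff0_decay (p + 2)) as [K HK]. exists ((1 + 0) ^ p * K). intros B HB.
  apply le_epsilon. intros e He.
  assert (HBp : 0 < B * B ^ p + 1).
  { assert (0 <= B * B ^ p) by (apply Rmult_le_pos; [lra | now apply pow_le]). lra. }
  (* This precision makes the error, integrated against x^p over [0, B], at most e. *)
  destruct (regularized_uniform 0 (e / (B * B ^ p + 1))) as [n Hn]; [now apply Rdiv_lt_0_compat |].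
  assert (M : Rabs (shifted_moment (avg_diff 0 (S n)) p 0 B) <= (1 + 0) ^ p * K / (1 + B)).
  { apply shifted_moment_of_limit; [intros; apply avg_diff_continuous | intros; now apply HK | lra | | exact HB].
    intros e' B' He'. destruct (avg_diff0_Zc (S n)) as [_ [_ [_ Mz]]].
    destruct (Mz p 0 (Rle_refl _)) as [L HL].
    exists (Rmax (Rmax 0 B') (L / e')).
    assert (H1 := Rmax_l (Rmax 0 B') (L / e')). assert (H2 := Rmax_r (Rmax 0 B') (L / e')).
    assert (H3 := Rmax_l 0 B'). assert (H4 := Rmax_r 0 B').
    set (b := Rmax (Rmax 0 B') (L / e')) in *. split; [lra |].
    eapply Rle_trans; [apply HL; lra |].
    apply Rmult_le_reg_r with (1 + b); [lra |]. replace (L / (1 + b) * (1 + b)) with L by (field; lra).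
    apply Rmult_le_compat_r with (r := e') in H2; [| lra]. replace (L / e' * e') with L in H2 by (field; lra). nra. }
  assert (CP : forall x, continuous (regularized 0) x) by (intros; eapply derive_continuous, regularized_derive).
  assert (Cd : forall x, continuous (fun x => regularized 0 x - avg_diff 0 (S n) x) x).
  { intros. apply (continuous_minus (regularized 0) (avg_diff 0 (S n))); [apply CP | apply avg_diff_continuous]. }
  assert (E : RInt (fun x => x ^ p * regularized 0 x) 0 B =
    RInt (fun x => x ^ p * (regularized 0 x - avg_diff 0 (S n) x)) 0 B + shifted_moment (avg_diff 0 (S n)) p 0 B).
  { unfold shifted_moment. rewrite <- (RInt_plus (fun x => x ^ p * (regularized 0 x - avg_diff 0 (S n) x)) (fun x => (x + 0) ^ p * avg_diff 0 (S n) x)).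
    - apply RInt_ext. intros x _. rewrite Rplus_0_r. unfold plus; simpl. ring.
    - apply ex_RInt_cont. intros. apply cont_mult; [apply pow_continuous | apply Cd].
    - apply ex_RInt_cont. intros. apply shifted_moment_integrand_continuous. intros; apply avg_diff_continuous. }
  rewrite E. eapply Rle_trans; [apply Rabs_triang |].
  assert (S1 : Rabs (RInt (fun x => x ^ p * (regularized 0 x - avg_diff 0 (S n) x)) 0 B) <= e).
  { apply Rle_trans with (RInt (fun _ => B ^ p * (e / (B * B ^ p + 1))) 0 B).
    - apply RInt_abs_le; [exact HB | | apply ex_RInt_const |].
      + intros. apply cont_mult; [apply pow_continuous | apply Cd].
      + intros x Hx. rewrite Rabs_mult, (Rabs_right (x ^ p)) by (apply Rle_ge, pow_le; lra).
        apply Rmult_le_compat; [apply pow_le; lra | apply Rabs_pos | apply pow_incr; lra | apply Hn].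
    - rewrite RInt_const. unfold scal; simpl; unfold mult; simpl.
      apply Rle_trans with ((B * B ^ p + 1) * (e / (B * B ^ p + 1))); [| right; field; lra].
      assert (0 < e / (B * B ^ p + 1)) by now apply Rdiv_lt_0_compat. nra. }
  lra.
Qed.

End Regularize.

(** * A density with vanishing moments *)

Section Kernel.

Variables (c : nat -> R) (s : R).
Hypothesis c_pos : forall k, 0 < c k.
Hypothesis c_sum : is_lim_seq (psum c) s.

(** For x <= 0 [sqrt] returns 0, where the odd function [outer_im c] vanishes; hence a continuous
    density on the whole line, supported in [0, oo). *)
Definition null_density (x : R) : R := outer_im c (sqrt x).

Lemma psum_ext f g n : (forall k, f k = g k) -> psum f n = psum g n.
Proof. intros H. induction n as [|n IH]; [reflexivity |]. now rewrite !psum_S, IH, H. Qed.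

Lemma psum_opp f n : psum (fun k => - f k) n = - psum f n.
Proof. induction n as [|n IH]; [simpl; ring |]. rewrite !psum_S, IH. ring. Qed.

Lemma th_opp t : th c (- t) = - th c t.
Proof.
  unfold th.
  rewrite (Lim_seq_ext _ (fun n => - th_n c n t)).
  - rewrite Lim_seq_opp. destruct (Lim_seq (fun n => th_n c n t)); simpl; ring.
  - intros n. unfold th_n. rewrite <- psum_opp. apply psum_ext. intros k.
    replace (c k * - t) with (- (c k * t)) by ring. rewrite atan_opp. ring.
Qed.

Lemma lam_opp t : lam c (- t) = lam c t.
Proof.
  unfold lam. f_equal. apply Lim_seq_ext. intros n. apply psum_ext. intros k. f_equal. ring.
Qed.

Lemma outer_im_odd t : outer_im c (- t) = - outer_im c t.
Proof. unfold outer_im. rewrite lam_opp, th_opp, sin_neg. ring. Qed.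

Lemma outer_im_0 : outer_im c 0 = 0.
Proof. assert (H := outer_im_odd 0). rewrite Ropp_0 in H. lra. Qed.

Lemma null_density_nonpos x : x <= 0 -> null_density x = 0.
Proof. intros H. unfold null_density. rewrite sqrt_neg_0 by exact H. apply outer_im_0. Qed.

Lemma null_density_continuous x : continuous null_density x.
Proof.
  apply (continuous_comp sqrt (outer_im c)); [apply continuous_sqrt | apply (outer_im_continuous c s c_pos c_sum)].
Qed.

Lemma null_density_bound p x : Rabs (null_density x) <= exp (- lam_n c p (sqrt x)).
Proof. apply (outer_im_bound c s c_pos c_sum). Qed.

Lemma null_density_le_1 x : Rabs (null_density x) <= 1.
Proof. assert (H := null_density_bound 0 x). unfold lam_n in H. simpl in H. now rewrite Ropp_0, exp_0 in H. Qed.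

Lemma null_density_decay p : exists K, forall x, 0 <= x -> (1 + x) ^ p * Rabs (null_density x) <= K.
Proof.
  destruct (exp_lam_n_om c c_pos p) as [K [HK H]]. exists K. intros x Hx.
  assert (P : 0 < (1 + x) ^ p) by (apply pow_lt; lra).
  apply Rle_trans with ((1 + x) ^ p * (K * om (sqrt x) ^ p)).
  - apply Rmult_le_compat_l; [lra |]. eapply Rle_trans; [apply null_density_bound | apply H].
  - unfold om. rewrite pow2_sqrt by exact Hx. rewrite pow_inv. right. field. lra.
Qed.

Lemma RInt_sq_substitution (p : nat) (b : R) : 0 <= b ->
  RInt (fun x => x ^ p * null_density x) 0 (b ^ 2) = 2 * RInt (fun t => t ^ (2 * p + 1) * outer_im c t) 0 b.
Proof.
  intros Hb. replace 0 with (0 ^ 2) at 1 by ring.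
  rewrite <- (RInt_comp (V := R_CompleteNormedModule) (fun x => x ^ p * null_density x) (fun t => t ^ 2) (fun t => 2 * t)).
  - rewrite <- (RInt_scal (fun t => t ^ (2 * p + 1) * outer_im c t)).
    + apply RInt_ext. intros t Ht. rewrite Rmin_left, Rmax_right in Ht by exact Hb.
      unfold null_density. rewrite sqrt_pow2 by lra. rewrite <- pow_mult, pow_add.
      unfold scal; simpl; unfold mult; simpl. change (2 * t * (t ^ (p + (p + 0)) * outer_im c t) = 2 * (t ^ (p + (p + 0)) * (t * 1) * outer_im c t)). ring.
    + apply ex_RInt_cont. intros. apply cont_mult; [apply pow_continuous | apply (outer_im_continuous c s c_pos c_sum)].
  - intros x _. apply cont_mult; [apply pow_continuous | apply null_density_continuous].
  - intros x _. split; [auto_derive; [exact I | ring] |].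
    apply (ex_derive_continuous (V := R_NormedModule)). auto_derive. exact I.
Qed.

(** The substitution x = t^2 leads from the moment of order p to the odd order 2p + 1. As
    [outer_im c] is odd, the integrand is even and the half-line carries half of an integral that
    tends to 0. *)
Lemma int_n_even p n : int_n (fun t => t ^ (2 * p + 1) * outer_im c t) n =
  2 * RInt (fun t => t ^ (2 * p + 1) * outer_im c t) 0 (INR n).
Proof.
  set (f := fun t => t ^ (2 * p + 1) * outer_im c t).
  assert (Cf : forall t, continuous f t).
  { intros. apply cont_mult; [apply pow_continuous | apply (outer_im_continuous c s c_pos c_sum)]. }
  unfold int_n. rewrite (RInt_split f (- INR n) 0 (INR n)) by exact Cf.
  assert (E : RInt f (- INR n) 0 = RInt f 0 (INR n)).
  { assert (Ev : forall t, f (- t) = f t).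
    { intros t. unfold f. rewrite outer_im_odd.
      replace ((- t) ^ (2 * p + 1)) with (- t ^ (2 * p + 1)); [ring |].
      rewrite !pow_add, !pow_mult. replace ((- t) ^ 2) with (t ^ 2) by ring. ring. }
    replace 0 with (- 0) at 1 by ring.
    rewrite <- (RInt_comp (V := R_CompleteNormedModule) f Ropp (fun _ => -1)).
    - rewrite (RInt_ext _ (fun t => scal (-1) (f t))) by (intros; now rewrite Ev).
      rewrite (RInt_scal f) by apply (ex_RInt_cont f _ _ Cf).
      rewrite <- (opp_RInt_swap f) by apply (ex_RInt_cont f _ _ Cf).
      change (-1 * - RInt f 0 (INR n) = RInt f 0 (INR n)). lra.
    - intros; apply Cf.
    - intros t _. split; [auto_derive; [exact I | ring] | apply continuous_const]. }
  rewrite E. lra.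
Qed.

Lemma null_density_moment_seq p : is_lim_seq (fun n => RInt (fun x => x ^ p * null_density x) 0 (INR n ^ 2)) 0.
Proof.
  destruct (dominated_outer_im c s c_pos c_sum (2 * p + 1)) as [K D].
  assert (L := int_R_lim _ _ D). rewrite (outer_im_moment c s c_pos c_sum) in L.
  eapply is_lim_seq_ext; [| exact L]. intros n.
  rewrite RInt_sq_substitution by apply pos_INR. now rewrite int_n_even.
Qed.

(** Binomial expansion by induction on p; the spare power x^q lets the induction close. *)
Lemma null_density_moment_shift p a q :
  is_lim_seq (fun n => RInt (fun x => (x + a) ^ p * (x ^ q * null_density x)) 0 (INR n ^ 2)) 0.
Proof.
  revert q. induction p as [|p IH]; intros q.
  - eapply is_lim_seq_ext; [| apply (null_density_moment_seq q)]. intros n. simpl.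
    apply RInt_ext. intros x _. simpl. symmetry. apply Rmult_1_l.
  - replace (Finite 0) with (Finite (0 + a * 0)) by (f_equal; ring).
    assert (Cq : forall q x, continuous (fun x => (x + a) ^ p * (x ^ q * null_density x)) x).
    { intros k x. apply (shifted_moment_integrand_continuous (fun x => x ^ k * null_density x)). intros y.
      apply cont_mult; [apply pow_continuous | apply null_density_continuous]. }
    set (u := fun k n => RInt (fun x => (x + a) ^ p * (x ^ k * null_density x)) 0 (INR n ^ 2)).
    apply is_lim_seq_ext with (fun n => u (S q) n + a * u q n).
    2: { apply is_lim_seq_plus'; [apply (IH (S q)) | apply (is_lim_seq_scal_l (u q) a 0), (IH q)]. }
    intros n. unfold u.
    rewrite <- (RInt_scal (fun x => (x + a) ^ p * (x ^ q * null_density x))) by (apply ex_RInt_cont, Cq).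
    rewrite <- (RInt_plus (fun x => (x + a) ^ p * (x ^ S q * null_density x))
      (fun x => scal a ((x + a) ^ p * (x ^ q * null_density x)))).
    + apply RInt_ext. intros x _.
      change ((x + a) ^ p * (x ^ S q * null_density x) + a * ((x + a) ^ p * (x ^ q * null_density x)) = (x + a) ^ S p * (x ^ q * null_density x)).
      simpl. ring.
    + apply ex_RInt_cont, Cq.
    + apply (ex_RInt_scal (fun x => (x + a) ^ p * (x ^ q * null_density x))). apply ex_RInt_cont, Cq.
Qed.

Lemma null_density_Zc : null_moments null_density.
Proof.
  split; [exact null_density_continuous | split; [exact null_density_nonpos | split; [exact null_density_decay |]]].
  intros p a Ha. destruct (null_density_decay (p + 2)) as [K HK]. exists ((1 + a) ^ p * K).
  apply shifted_moment_of_limit; [exact null_density_continuous | exact HK | exact Ha |].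
  intros e B He. assert (L := null_density_moment_shift p a 0).
  apply is_lim_seq_spec in L. destruct (L (mkposreal e He)) as [N HN].
  destruct (INR_unbounded (Rmax B 1)) as [N2 HN2].
  set (n := Nat.max N N2).
  assert (H1 : INR N2 <= INR n) by (apply le_INR; unfold n; lia).
  assert (M1 := Rmax_l B 1). assert (M2 := Rmax_r B 1).
  exists (INR n ^ 2). split; [nra |].
  specialize (HN n ltac:(unfold n; lia)). simpl pos in HN.
  rewrite Rminus_0_r in HN. left.
  replace (shifted_moment null_density p a (INR n ^ 2)) with (RInt (fun x => (x + a) ^ p * (x ^ 0 * null_density x)) 0 (INR n ^ 2)); [exact HN |].
  apply RInt_ext. intros x _. simpl. now rewrite Rmult_1_l.
Qed.

Lemma null_density_positive : exists x, 0 < x /\ 0 < null_density x.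
Proof.
  assert (Hs : 0 < s).
  { assert (Q := psum_le_lim c s 1 (fun k => Rlt_le _ _ (c_pos k)) c_sum). simpl in Q. assert (Q2 := c_pos 0). lra. }
  (* At this t one has 0 < th <= 2 t s = 1 < pi, so the sine is positive. *)
  set (t := / (2 * s)). assert (Ht : 0 < t) by (apply Rinv_0_lt_compat; lra).
  exists (t ^ 2). split; [now apply pow_lt |].
  unfold null_density. rewrite sqrt_pow2 by lra. unfold outer_im.
  apply Rmult_lt_0_compat; [apply exp_pos |].
  destruct (th_conv c s c_pos c_sum t) as [L B].
  assert (Hup : th c t <= 1).
  { specialize (B 0%nat). unfold th_n in B. simpl in B. rewrite !Rminus_0_r, (Rabs_right t) in B by lra.
    replace (2 * t * s) with 1 in B by (unfold t; field; lra). apply Rabs_le_between in B. lra. }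
  assert (Hlo : 0 < th c t).
  { apply Rlt_le_trans with (th_n c 1 t).
    - unfold th_n. simpl. assert (0 < atan (c 0%nat * t)); [| lra].
      rewrite <- atan_0. apply atan_increasing. apply Rmult_lt_0_compat; [apply c_pos | exact Ht].
    - unfold th_n. apply (psum_le_lim (fun k => 2 * atan (c k * t)) (th c t) 1); [| exact L].
      intros k. assert (0 <= atan (c k * t)); [| lra]. rewrite <- atan_0. left. apply atan_increasing.
      apply Rmult_lt_0_compat; [apply c_pos | exact Ht]. }
  apply sin_gt_0; [exact Hlo |]. assert (P := PI2_1). lra.
Qed.

End Kernel.

Lemma is_derive_RtoC (f : R -> R) (x l : R) : is_derive f x l ->
  is_derive (K := R_AbsRing) (V := C_R_NormedModule) (fun x => RtoC (f x)) x (RtoC l).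
Proof.
  intros H.
  assert (L : is_linear (K := R_AbsRing) (U := R_NormedModule) (V := C_R_NormedModule) (fun x : R => RtoC x)).
  { split.
    - intros a b. apply C_ext; simpl; unfold plus; simpl; ring.
    - intros k a. apply C_ext; simpl; unfold scal; simpl; unfold mult; simpl; ring.
    - exists 1. split; [lra |]. intros a. rewrite Rmult_1_l.
      right. change (sqrt (Rabs a ^ 2 + Rabs 0 ^ 2) = Rabs a). rewrite Rabs_R0.
      replace (Rabs a ^ 2 + 0 ^ 2) with (Rabs a ^ 2) by ring. apply sqrt_pow2, Rabs_pos. }
  assert (D := filterdiff_comp f (fun x : R => RtoC x) (fun y => scal y l) (fun x : R => RtoC x) H
    (filterdiff_linear (fun x : R => RtoC x) L)).
  eapply filterdiff_ext_lin; [exact D |].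
  intros y. apply C_ext; simpl; unfold scal; simpl; unfold mult; simpl; ring.
Qed.

Lemma is_RInt_gen_intro (f : R -> C) (l : C) :
  (forall e, 0 < e -> exists d B, 0 < d /\ forall a b, 0 < a < d -> B < b ->
    exists J : C, is_RInt (V := C_R_NormedModule) f a b J /\ Rabs (Re J - Re l) < e /\ Rabs (Im J - Im l) < e) ->
  is_RInt_gen (V := C_R_NormedModule) f (at_right 0) (Rbar_locally p_infty) l.
Proof.
  intros H P [e HP]. destruct (H e (cond_pos e)) as [d [B [Hd HJ]]].
  apply (Filter_prod _ _ _ (fun a => 0 < a < d) (fun b => B < b)).
  - exists (mkposreal d Hd). intros a Ha Ha0. split; [exact Ha0 |].
    assert (Q : Rabs (a - 0) < d) by exact Ha. rewrite Rminus_0_r in Q. apply Rabs_lt_between in Q. lra.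
  - exists B. auto.
  - intros a b Ha Hb. destruct (HJ a b Ha Hb) as [J [J1 [J2 J3]]]. exists J. split; [exact J1 |].
    apply HP. split; [exact J2 | exact J3].
Qed.

Lemma moment_injective_mono (S S' : (R -> C) -> Prop) :
  (forall f, S f -> S' f) -> moment_injective S' -> moment_injective S.
Proof. intros H HI phi psi m H1 H2. apply HI; auto. Qed.

Lemma in_SM_in_CM M phi : in_SM M phi -> in_CM M phi.
Proof.
  intros [Phi [<- [[D _] [h [Hh H]]]]]. split.
  - intros x _. apply (ex_derive_continuous (K := R_AbsRing) (V := C_R_NormedModule) (Phi 0%nat)).
    eexists. apply D.
  - destruct (H 0%nat) as [K HK]. exists h, K. split; [exact Hh |]. intros p x Hx.
    specialize (HK p x). rewrite Rabs_right in HK by lra. exact HK.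
Qed.

Lemma in_SMA_in_SM M A phi : in_SMA M A phi -> in_SM M phi.
Proof.
  intros [Phi [E [HS [h [K [Hh H]]]]]]. exists Phi. split; [exact E | split; [exact HS |]].
  exists h. split; [exact Hh |]. intros q. exists (K * h ^ q * Ahat A q). intros p x.
  specialize (H p q x). rewrite pow_add in H. eapply Rle_trans; [exact H |]. right. ring.
Qed.

Lemma in_SMA_zero M A : in_SMA M A (fun _ => 0%C).
Proof.
  exists (fun _ _ => 0%C). split; [reflexivity | split].
  - split; [| reflexivity]. intros q x. apply (is_derive_const (K := R_AbsRing) (V := C_R_NormedModule)).
  - exists 1, 0. split; [lra |]. intros. rewrite Cmod_0. lra.
Qed.

Lemma is_RInt_zero a b : is_RInt (V := R_NormedModule) (fun _ => 0) a b 0.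
Proof.
  assert (H := is_RInt_const (V := R_NormedModule) a b 0).
  change (is_RInt (V := R_NormedModule) (fun _ => 0) a b ((b - a) * 0)) in H. now rewrite Rmult_0_r in H.
Qed.

Lemma is_moments_zero : is_moments (fun _ => 0%C) (fun _ => 0%C).
Proof.
  intros p. apply is_RInt_gen_intro. intros e He. exists 1, 0. split; [lra |]. intros a b _ _.
  exists 0%C. split.
  - apply (is_RInt_fct_extend_pair (U := R_NormedModule) (V := R_NormedModule)).
    + apply is_RInt_ext with (fun _ => 0); [intros; simpl; ring | apply is_RInt_zero].
    + apply is_RInt_ext with (fun _ => 0); [intros; simpl; ring | apply is_RInt_zero].
  - rewrite !Rminus_eq_0, Rabs_R0. lra.
Qed.

(** At the lower end the crude bound x^p |g| <= 1 on [0, 1] suffices, at the upper end the rate K /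
    (1 + B); each gets e / 2. *)
Lemma is_moments_of_decay (g : R -> R) : (forall x, continuous g x) -> (forall x, Rabs (g x) <= 1) ->
  (forall p, exists K, forall B, 0 <= B -> Rabs (RInt (fun x => x ^ p * g x) 0 B) <= K / (1 + B)) ->
  is_moments (fun x => RtoC (g x)) (fun _ => 0%C).
Proof.
  intros Cg Bg Hm p. destruct (Hm p) as [K HK].
  set (f := fun x => x ^ p * g x).
  assert (Cf : forall x, continuous f x) by (intros; apply cont_mult; [apply pow_continuous | apply Cg]).
  assert (K0 : 0 <= K).
  { specialize (HK 0 (Rle_refl _)). unfold Rdiv in HK. rewrite Rplus_0_r, Rinv_1, Rmult_1_r in HK.
    eapply Rle_trans; [apply Rabs_pos | exact HK]. }
  apply is_RInt_gen_intro. intros e He.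
  exists (Rmin 1 (e / 2)), (2 * K / e). split; [apply Rmin_pos; lra |]. intros a b Ha Hb.
  assert (Ha1 : Rmin 1 (e / 2) <= 1) by apply Rmin_l. assert (Ha2 : Rmin 1 (e / 2) <= e / 2) by apply Rmin_r.
  assert (Hb0 : 0 <= 2 * K / e) by (apply Rmult_le_pos; [lra | left; now apply Rinv_0_lt_compat]).
  exists (RtoC (RInt f a b)). split; [| split].
  - apply (is_RInt_fct_extend_pair (U := R_NormedModule) (V := R_NormedModule)).
    + apply is_RInt_ext with f; [intros; unfold f; simpl; ring |].
      apply (RInt_correct f). now apply ex_RInt_cont.
    + apply is_RInt_ext with (fun _ => 0); [intros; simpl; ring | apply is_RInt_zero].
  - simpl. rewrite Rminus_0_r.
    assert (E : RInt f a b = RInt f 0 b - RInt f 0 a) by (rewrite (RInt_split f 0 a b) by exact Cf; lra).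
    rewrite E. unfold Rminus. eapply Rle_lt_trans; [apply Rabs_triang |]. rewrite Rabs_Ropp.
    assert (B1 : Rabs (RInt f 0 b) <= K / (1 + b)) by (apply HK; lra).
    assert (B2 : Rabs (RInt f 0 a) <= a).
    { apply Rle_trans with (RInt (fun _ => 1) 0 a).
      - apply RInt_abs_le; [lra | exact Cf | apply ex_RInt_const |].
        intros x Hx. unfold f. rewrite Rabs_mult, <- RPow_abs, (Rabs_right x) by lra.
        assert (P : x ^ p <= 1) by (rewrite <- (pow1 p); apply pow_incr; lra).
        assert (P0 : 0 <= x ^ p) by (apply pow_le; lra).
        assert (Q := Rabs_pos (g x)). specialize (Bg x). nra.
      - rewrite RInt_const. right. change ((a - 0) * 1 = a). ring. }
    assert (B3 : K / (1 + b) <= e / 2).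
    { apply Rmult_le_reg_r with (1 + b); [lra |]. replace (K / (1 + b) * (1 + b)) with K by (field; lra).
      apply Rmult_lt_compat_r with (r := e / 2) in Hb; [| lra]. replace (2 * K / e * (e / 2)) with K in Hb by (field; lra). lra. }
    lra.
  - simpl. rewrite Rminus_eq_0, Rabs_R0. exact He.
Qed.

Lemma ex_series_psum a : ex_series a -> exists l : R, is_lim_seq (psum a) l.
Proof.
  intros [l Hl]. exists l. apply is_lim_seq_incr_1.
  eapply is_lim_seq_ext; [| exact Hl]. intros n. now rewrite psum_sum_n.
Qed.

Lemma quot_Ahat A p : (forall p, 0 < A p) -> quot (Ahat A) p = INR (S p) * quot A p.
Proof.
  intros HA. unfold quot, Ahat. rewrite fact_simpl, mult_INR.
  assert (H1 := HA p). assert (H2 := INR_fact_lt_0 p). field. lra.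
Qed.

(** The last implication in contrapositive form: a regularized density has the same moments as the
    zero function, and it is nonzero because phi stays above half its value at x1 over the whole
    averaging range. *)
Theorem divergence_of_SMA_injective M A :
  weight_seq M -> M 0%nat = 1 -> (forall p, 0 < A p) -> nq A ->
  (exists B, forall n, psum (fun p => / sqrt (quot (Mtilde M) p)) n <= B) ->
  ~ moment_injective (in_SMA M A).
Proof.
  intros HM M0 HA HnqA [B HB] Hinj.
  assert (Mp : forall p, 0 < M p) by apply HM.
  destruct (quot_sum_bounded M B HM HB) as [s Hs].
  set (c := fun p => / sqrt (quot M p)).
  assert (mp : forall p, 0 < quot M p) by (intros; now apply quot_pos).
  assert (cp : forall k, 0 < c k) by (intros; apply Rinv_0_lt_compat, sqrt_lt_R0, mp).
  assert (csq : forall k, c k ^ 2 = / quot M k).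
  { intros k. unfold c. rewrite pow_inv, pow2_sqrt by (left; apply mp). reflexivity. }
  set (phi := null_density c).
  assert (ZP : null_moments phi) by apply (null_density_Zc c s cp Hs).
  assert (Cphi : forall x, continuous phi x) by apply ZP.
  assert (phi1 : forall x, Rabs (phi x) <= 1) by (intros; apply (null_density_le_1 c s cp Hs)).
  (* x^p e^(-lam_p) is the product over k < p of x / (1 + x / m_k), each factor being at most m_k;
     since M_0 = 1, the product of the m_k is M_p. *)
  assert (phiM : forall p x, 0 < x -> x ^ p * Rabs (phi x) <= M p).
  { intros p x Hx. assert (E : x ^ p * exp (- lam_n c p (sqrt x)) <= M p).
    { induction p as [|p IH].
      - unfold lam_n; simpl. rewrite Ropp_0, exp_0, M0. lra.
      - rewrite exp_lam_n_S by exact cp. rewrite Rpow_mult_distr, csq, pow2_sqrt by lra.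
        replace (M (S p)) with (M p * quot M p) by (unfold quot; field; assert (Q := Mp p); lra).
        replace (x ^ S p * (exp (- lam_n c p (sqrt x)) * / (1 + / quot M p * x))) with
          (x ^ p * exp (- lam_n c p (sqrt x)) * (x * / (1 + / quot M p * x))) by (simpl; ring).
        assert (Q := mp p). assert (Qi : 0 < / quot M p) by now apply Rinv_0_lt_compat.
        apply Rmult_le_compat; [| | exact IH |].
        + apply Rmult_le_pos; [apply pow_le; lra | left; apply exp_pos].
        + apply Rmult_le_pos; [lra | left; apply Rinv_0_lt_compat; nra].
        + apply Rmult_le_reg_r with (1 + / quot M p * x); [nra |].
          replace (x * / (1 + / quot M p * x) * (1 + / quot M p * x)) with x by (field; split; nra).
          replace (quot M p * (1 + / quot M p * x)) with (quot M p + x) by (field; lra). lra. }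
    eapply Rle_trans; [| exact E]. apply Rmult_le_compat_l; [apply pow_le; lra |].
    apply (null_density_bound c s cp Hs). }
  destruct (null_density_positive c s cp Hs) as [x1 [Hx1 Hphi1]]. fold phi in Hphi1.
  destruct (proj1 (continuous_eps phi x1) (Cphi x1) (phi x1 / 2) ltac:(lra)) as [r0 [Hr0 Hc]].
  destruct (ex_series_psum _ HnqA) as [sg Hsg].
  set (a := fun p => / (INR (S p) * quot A p)) in *.
  assert (ap : forall p, 0 < a p).
  { intros p. apply Rinv_0_lt_compat, Rmult_lt_0_compat; [apply lt_0_INR; lia | now apply quot_pos]. }
  assert (sgp : 0 < sg).
  { assert (Q := psum_le_lim a sg 1 (fun k => Rlt_le _ _ (ap k)) Hsg). assert (Q2 := ap 0%nat).
    change (0 + a 0%nat <= sg) in Q. lra. }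
  (* The total length becomes r = min (1, r0 / 2): r <= 1 gives x - r >= x / 2 for x >= 2, and r <=
     r0 / 2 keeps the averages at x1 inside the interval where phi exceeds phi(x1) / 2. *)
  set (ep := Rmin 1 (r0 / 2) / sg).
  assert (Hep : 0 < ep) by (apply Rdiv_lt_0_compat; [apply Rmin_pos; lra | exact sgp]).
  set (delta := fun p => ep * a p). set (r := ep * sg).
  assert (dp : forall k, 0 < delta k) by (intros; apply Rmult_lt_0_compat; [exact Hep | apply ap]).
  assert (dsum : is_lim_seq (psum delta) r).
  { apply is_lim_seq_ext with (fun n => ep * psum a n).
    - intros n. induction n as [|n IH]; [simpl; ring |]. rewrite !psum_S, <- IH. unfold delta. ring.
    - apply (is_lim_seq_scal_l (psum a) ep sg), Hsg. }
  assert (Er : r = Rmin 1 (r0 / 2)) by (unfold r, ep; field; lra).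
  assert (r1 : r <= 1) by (rewrite Er; apply Rmin_l). assert (r2 : r <= r0 / 2) by (rewrite Er; apply Rmin_r).
  assert (rp : 0 < r) by (rewrite Er; apply Rmin_pos; lra).
  set (P := regularized phi delta).
  assert (PD : forall q x, is_derive (P q) x (P (S q) x)) by (intros; apply (regularized_derive phi delta r); auto).
  assert (PB : forall q x E, (forall y, x - r <= y <= x -> Rabs (phi y) <= E) -> Rabs (P q x) <= diff_bound delta q * E).
  { intros. now apply (regularized_bound phi delta r). }
  assert (Pneg : forall q x, x <= 0 -> P q x = 0).
  { intros q x Hx. assert (Q : Rabs (P q x) <= diff_bound delta q * 0).
    { apply PB. intros y Hy. destruct ZP as [_ [Zn _]]. rewrite Zn, Rabs_R0 by lra. lra. }
    rewrite Rmult_0_r in Q. destruct (Req_dec (P q x) 0) as [E | E]; [exact E |].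
    apply Rabs_pos_lt in E. lra. }
  (* The two entries serve two ranges: 2 for x > 2, where x <= 2y on the averaging interval, and 2 /
     m_0 for x <= 2, where 2^p <= (H m_0)^p <= H^p M_p. *)
  set (H := Rmax 2 (2 / quot M 0)). assert (H1 : 2 <= H) by apply Rmax_l. assert (H2 : 2 / quot M 0 <= H) by apply Rmax_r.
  assert (Mlow : forall p, quot M 0 ^ p <= M p).
  { induction p as [|p IH]; [simpl; lra |].
    replace (M (S p)) with (quot M p * M p) by (unfold quot; field; assert (Q := Mp p); lra). simpl.
    apply Rmult_le_compat; [left; apply mp | apply pow_le; left; apply mp | | exact IH].
    clear IH. induction p as [|p IH]; [lra |]. eapply Rle_trans; [exact IH | now apply weight_seq_quot]. }
  assert (PM : forall p q x, Rabs x ^ p * Rabs (P q x) <= diff_bound delta q * (H ^ p * M p)).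
  { intros p q x. assert (Pqp := diff_bound_pos delta dp q).
    assert (HMp : 0 < H ^ p * M p) by (apply Rmult_lt_0_compat; [apply pow_lt; lra | apply Mp]).
    destruct (Rle_dec x 0) as [Hn | Hn].
    { rewrite Pneg, Rabs_R0, Rmult_0_r by exact Hn. nra. }
    rewrite (Rabs_right x) by lra. assert (Hxp : 0 < x ^ p) by (apply pow_lt; lra).
    assert (Q : Rabs (P q x) <= diff_bound delta q * (H ^ p * M p / x ^ p)).
    { apply PB. intros y Hy.
      apply Rmult_le_reg_l with (x ^ p); [exact Hxp |].
      replace (x ^ p * (H ^ p * M p / x ^ p)) with (H ^ p * M p) by (field; lra).
      destruct (Rle_dec x 2) as [Hx2 | Hx2].
      - apply Rle_trans with (2 ^ p * 1).
        + apply Rmult_le_compat; [lra | apply Rabs_pos | apply pow_incr; lra | apply phi1].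
        + rewrite Rmult_1_r. assert (Q0 := mp 0%nat).
          apply Rle_trans with (H ^ p * quot M 0 ^ p).
          * rewrite <- Rpow_mult_distr. apply pow_incr. split; [lra |].
            apply Rle_trans with (2 / quot M 0 * quot M 0); [right; field; lra |].
            apply Rmult_le_compat_r; lra.
          * apply Rmult_le_compat_l; [apply pow_le; lra | apply Mlow].
      - apply Rle_trans with ((2 * y) ^ p * Rabs (phi y)).
        + apply Rmult_le_compat_r; [apply Rabs_pos | apply pow_incr; lra].
        + rewrite Rpow_mult_distr, Rmult_assoc.
          apply Rmult_le_compat; [apply pow_le; lra | | apply pow_incr; lra | apply phiM; lra].
          apply Rmult_le_pos; [apply pow_le; lra | apply Rabs_pos]. }
    apply Rmult_le_compat_l with (r := x ^ p) in Q; [| lra]. eapply Rle_trans; [exact Q |]. right. field. lra. }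
  assert (Ahp : forall q, 0 < Ahat A q).
  { intros q. apply Rmult_lt_0_compat; [apply INR_fact_lt_0 | apply HA]. }
  (* [delta k] is ep divided by the k-th quotient of [Ahat A], so the product of the 2 / delta k
     telescopes. *)
  assert (PqA : forall q, diff_bound delta q = (2 / ep) ^ q * Ahat A q / Ahat A 0).
  { induction q as [|q IH].
    - simpl. field. assert (Q := Ahp 0%nat). lra.
    - simpl diff_bound. rewrite IH. unfold delta, a. rewrite <- quot_Ahat by exact HA.
      assert (Q := Ahp 0%nat). assert (Q1 := Ahp q). assert (Q2 := Ahp (S q)).
      unfold quot. simpl pow. field. repeat split; lra. }
  assert (SMA : in_SMA M A (fun x => RtoC (P 0%nat x))).
  { exists (fun q x => RtoC (P q x)). split; [reflexivity | split; [split |]].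
    - intros q x. apply is_derive_RtoC, PD.
    - intros x Hx. now rewrite Pneg by lra.
    - set (h := Rmax H (2 / ep)). assert (h1 : H <= h) by apply Rmax_l. assert (h2 : 2 / ep <= h) by apply Rmax_r.
      assert (Q0 : 0 < 2 / ep) by (apply Rdiv_lt_0_compat; lra).
      exists h, (/ Ahat A 0). split; [lra |]. intros p q x. rewrite Cmod_R.
      eapply Rle_trans; [apply PM |]. rewrite PqA, pow_add.
      assert (A0 : 0 < / Ahat A 0) by (apply Rinv_0_lt_compat, Ahp).
      replace ((2 / ep) ^ q * Ahat A q / Ahat A 0 * (H ^ p * M p)) with
        (/ Ahat A 0 * (H ^ p * (2 / ep) ^ q) * (M p * Ahat A q)) by (unfold Rdiv; ring).
      replace (/ Ahat A 0 * (h ^ p * h ^ q) * M p * Ahat A q) with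
        (/ Ahat A 0 * (h ^ p * h ^ q) * (M p * Ahat A q)) by ring.
      apply Rmult_le_compat_r; [apply Rmult_le_pos; left; [apply Mp | apply Ahp] |].
      apply Rmult_le_compat_l; [lra |].
      apply Rmult_le_compat; [apply pow_le; lra | apply pow_le; lra | apply pow_incr; lra | apply pow_incr; lra]. }
  assert (MM : is_moments (fun x => RtoC (P 0%nat x)) (fun _ => 0%C)).
  { apply is_moments_of_decay.
    - intros x. eapply derive_continuous, PD.
    - intros x. assert (Q := PB 0%nat x 1 (fun y _ => phi1 y)). simpl in Q. lra.
    - intros p. apply (regularized0_moment phi delta r); auto. }
  assert (Z := Hinj _ _ _ SMA (in_SMA_zero M A) MM is_moments_zero x1 Hx1).
  assert (L : phi x1 / 2 <= P 0%nat x1).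
  { apply (regularized0_lower phi delta r); auto. intros y Hy.
    assert (Q := Hc y ltac:(apply Rabs_lt_between; lra)). apply Rabs_lt_between in Q. lra. }
  apply (f_equal Re) in Z. simpl in Z. lra.
Qed.

Theorem theorem4p5 (M A : nat -> R) :
  weight_seq M -> M 0%nat = 1 ->
  weight_seq (Mtilde M) -> fact_incl (Mtilde M) ->
  (forall p, 0 < A p) -> nq A -> weight_seq (Ahat A) ->
  let i := is_lim_seq
             (sum_n (fun p => / sqrt (quot (Mtilde M) p))) p_infty in
  (i <-> B_injective (Mtilde M)) /\
  (i <-> moment_injective (in_CM M)) /\
  (i <-> moment_injective (in_SM M)) /\
  (i <-> moment_injective (in_SMA M A)).
Proof.
  intros HM M0 HMt _ HA HnqA _ i.
  assert (H12 : i -> B_injective (Mtilde M)) by now apply B_injective_of_divergence.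
  assert (H23 : B_injective (Mtilde M) -> moment_injective (in_CM M)) by now apply CM_injective_of_B_injective.
  assert (H34 : moment_injective (in_CM M) -> moment_injective (in_SM M))
    by (apply moment_injective_mono, in_SM_in_CM).
  assert (H45 : moment_injective (in_SM M) -> moment_injective (in_SMA M A))
    by (apply moment_injective_mono; intros; eapply in_SMA_in_SM; eassumption).
  assert (H51 : moment_injective (in_SMA M A) -> i).
  { intros H. apply NNPP. intros Hi.
    refine (divergence_of_SMA_injective M A HM M0 HA HnqA _ H).
    (* For nonnegative terms, partial sums that do not tend to infinity are bounded. *)
    apply bounded_of_not_divergent; [| exact Hi].
    intros k. left. apply Rinv_0_lt_compat, sqrt_lt_R0, quot_pos, HMt. }
  tauto.
Qed.
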